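(* Suppose $f^*$ is $(\beta,L,\mathbb R^p\to\mathbb R^d)$-Hölder. Suppose the distribution of $X$ has a density with compact support $\mathcal X$, on which the density takes values in $[\mu_{\min},\mu_{\max}]\subseteq(0,\infty)$. Suppose moreover that for some $c_0,r_0>0$, $\mathrm{Leb}[\mathcal X\cap\mathcal B(x,r)]\ge c_0\,\mathrm{Leb}[\mathcal B(x,r)]$ for all $0<r\le r_0$ and $x\in\mathcal X$. Set $h=n^{-1/(2\beta+p)}$. Then there exist $C_1,C_2>0$ depending only on $p,\beta,L,\mu_{\min},\mu_{\max},c_0,r_0$ such that for all $\delta>0$, $n\ge1$, and almost all $x$, $$\mathbb P\big(\|\hat f^*_n(x)-f^*(x)\|\ge\delta\big)\le C_1\exp\big(-C_2n^{2\beta/(2\beta+p)}\delta^2/d\big).$$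
   Context: $X\in\mathbb R^p$, $Y\in\mathbb R^d$ with $\|Y\|\le1$, $f^*(x)=\mathbb E[Y\mid X=x]$, and $(X_i,Y_i)_{i=1}^n$ i.i.d. copies of $(X,Y)$. $\mathcal B(x,r)$ is the Euclidean ball, $\mathrm{Leb}$ Lebesgue measure. For $\beta>0$, $\lfloor\beta\rfloor$ denotes the largest integer strictly smaller than $\beta$. For a $\lfloor\beta\rfloor$-times continuously differentiable $g:\mathbb R^p\to\mathbb R$, $g_x(x')=\sum_{|s|\le\lfloor\beta\rfloor}\frac{(x'-x)^s}{s!}D^sg(x)$ (multi-indices $s\in\mathbb Z_+^p$); $g$ is $(\beta,L,\mathbb R^p)$-Hölder if $|g(x')-g_x(x')|\le L\|x-x'\|^\beta$ for all $x,x'$, and $g:\mathbb R^p\to\mathbb R^d$ is $(\beta,L,\mathbb R^p\to\mathbb R^d)$-Hölder if each component is $(\beta,L,\mathbb R^p)$-Hölder. A kernel $K:\mathbb R^p\to\mathbb R$ is fixed satisfying: $\exists c>0$ with $K(x)\ge c\,\mathbb I\{\|x\|\le c\}$ for all $x$; $\int K=1$; $\sup_u(1+\|u\|^{2\beta})K(u)<\infty$; $\int(1+\|u\|^{2\beta})K(u)du<\infty$; $\int(1+\|u\|^{4\beta})K^2(u)du<\infty$. Let $M=|\{s\in\mathbb Z_+^p:|s|\le\lfloor\beta\rfloor\}|$. The local polynomial estimator at $x$ is $\hat f^{\mathrm{LP}}_n(x)=\hat\vartheta_{(0,\dots,0)}$ where $\hat\vartheta\in\arg\min_{\vartheta\in\mathbb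 R^{d\times M}}\sum_{i=1}^nK\big(\frac{X_i-x}h\big)\big\|Y_i-\sum_{|s|\le\lfloor\beta\rfloor}\vartheta_s(X_i-x)^s\big\|^2$ (columns $\vartheta_s$ indexed by multi-indices), with $\hat f^{\mathrm{LP}}_n(x)=0$ if the minimizer is not unique; $\hat f^*_n(x)$ is the Euclidean projection of $\hat f^{\mathrm{LP}}_n(x)$ onto the unit ball of $\mathbb R^d$. *)

(* Defs.v *)
From HB Require Import structures.
From mathcomp Require Import all_boot all_order all_algebra.
From mathcomp Require Import all_classical all_reals all_analysis.
Set Implicit Arguments. Unset Strict Implicit. Unset Printing Implicit Defensive.
Import Order.TTheory GRing.Theory Num.Theory.
Import numFieldNormedType.Exports.
Local Open Scope classical_set_scope.
Local Open Scope ring_scope.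

(* R^n is modelled by row vectors 'rV[R]_n.  We equip them with the    *)
(* product (= Borel) sigma-algebra generated by the coordinates.        *)
Definition rv_display : measure_display. exact: default_measure_display. Qed.

Section rv_measurable.
Context {R : realType} (n : nat).
Let coor : 'I_n -> 'rV[R]_n -> R := fun i x => x ord0 i.
Let rv_set0 : g_sigma_preimage coor set0.
Proof. exact: sigma_algebra0. Qed.
Let rv_setC A : g_sigma_preimage coor A -> g_sigma_preimage coor (~` A).
Proof. exact: sigma_algebraC. Qed.
Let rv_bigcup (F : _^nat) : (forall i, g_sigma_preimage coor (F i)) ->
  g_sigma_preimage coor (\bigcup_i (F i)).
Proof. exact: sigma_algebra_bigcup. Qed.
HB.instance Definition _ := @isMeasurable.Build rv_display
  'rV[R]_n (g_sigma_preimage coor) rv_set0 rv_setC rv_bigcup.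
End rv_measurable.

Section defs.
Context {R : realType}.

Definition enorm n (v : 'rV[R]_n) : R := Num.sqrt (\sum_(i < n) v ord0 i ^+ 2).

Definition eball n (x : 'rV[R]_n) (r : R) : set 'rV[R]_n :=
  [set y | enorm (y - x) <= r].

Definition box n (a b : 'rV[R]_n) : set 'rV[R]_n :=
  [set y | forall i, a ord0 i <= y ord0 i <= b ord0 i].

(* leb is (the) Lebesgue measure on R^n: it gives boxes their volume.
   (This determines it uniquely on the Borel sigma-algebra.) *)
Definition is_lebesgue n (leb : {measure set 'rV[R]_n -> \bar R}) : Prop :=
  forall a b : 'rV[R]_n, (forall i, a ord0 i <= b ord0 i) ->
    leb (box a b) = (\prod_(i < n) (b ord0 i - a ord0 i))%:E.

(* floor_beta b = largest integer strictly smaller than b (for b > 0) *)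
Definition floor_beta (b : R) : nat := `|Num.ceil b - 1|%N.

Definition evec n (i : 'I_n) : 'rV[R]_n := \row_j (i == j)%:R.

Definition Dseq n (s : seq 'I_n) (g : 'rV[R]_n -> R) : 'rV[R]_n -> R :=
  foldr (fun i h => fun x => ('D_(evec i) h) x) g s.

Definition Ck n (k : nat) (g : 'rV[R]_n -> R) : Prop :=
  forall s : seq 'I_n, (size s <= k)%N ->
    continuous (Dseq s g) /\
    ((size s < k)%N -> forall (i : 'I_n) x, derivable (Dseq s g) x (evec i)).

Definition multi_index n k :=
  {s : {ffun 'I_n -> 'I_k.+1} | (\sum_(i < n) (s i : nat) <= k)%N}.

Definition mi_deg n k (s : multi_index n k) (i : 'I_n) : nat := val s i.

Definition Dmulti n k (s : multi_index n k) (g : 'rV[R]_n -> R) :=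
  Dseq (flatten [seq nseq (mi_deg s i) i | i <- enum 'I_n]) g.

Definition mono n k (v : 'rV[R]_n) (s : multi_index n k) : R :=
  \prod_(i < n) v ord0 i ^+ mi_deg s i.

Definition mfact n k (s : multi_index n k) : R :=
  \prod_(i < n) ((mi_deg s i)`!)%:R.

Definition taylor n (beta : R) (g : 'rV[R]_n -> R) (x x' : 'rV[R]_n) : R :=
  \sum_(s : multi_index n (floor_beta beta))
     mono (x' - x) s / mfact s * Dmulti s g x.

Definition holder n (beta L : R) (g : 'rV[R]_n -> R) : Prop :=
  Ck (floor_beta beta) g /\
  forall x x' : 'rV[R]_n,
    `|g x' - taylor beta g x x'| <= L * powR (enorm (x - x')) beta.

Definition holder_vec n m (beta L : R) (f : 'rV[R]_n -> 'rV[R]_m) : Prop :=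
  forall j : 'I_m, holder beta L (fun x => f x ord0 j).

Definition lp_objective p d (beta h : R) (K : 'rV[R]_p -> R) (N : nat)
  (Xs : 'I_N -> 'rV[R]_p) (Ys : 'I_N -> 'rV[R]_d) (x : 'rV[R]_p)
  (th : multi_index p (floor_beta beta) -> 'rV[R]_d) : R :=
  \sum_(i < N) K (h^-1 *: (Xs i - x)) *
     enorm (Ys i - \sum_(s : multi_index p (floor_beta beta))
                     mono (Xs i - x) s *: th s) ^+ 2.

Definition is_unique_minimizer {T : Type} (J : T -> R) (t : T) : Prop :=
  (forall t', J t <= J t') /\ (forall t', (forall t'', J t' <= J t'') -> t' = t).

Definition mi_zero n k : multi_index n k.
Proof.
exists [ffun => ord0].
by rewrite (eq_bigr (fun _ => 0%N)) ?big1// => i _; rewrite ffunE.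
Defined.

Definition lp_est p d (beta h : R) (K : 'rV[R]_p -> R) (N : nat)
  (Xs : 'I_N -> 'rV[R]_p) (Ys : 'I_N -> 'rV[R]_d) (x : 'rV[R]_p) : 'rV[R]_d :=
  match pselect (exists th, is_unique_minimizer (@lp_objective p d beta h K N Xs Ys x) th)
  with
  | left H => (projT1 (cid H)) (mi_zero p (floor_beta beta))
  | right _ => 0
  end.

Definition proj_ball d (v : 'rV[R]_d) : 'rV[R]_d :=
  if enorm v <= 1 then v else (enorm v)^-1 *: v.

Definition lp_est_proj p d (beta h : R) (K : 'rV[R]_p -> R) (N : nat)
  (Xs : 'I_N -> 'rV[R]_p) (Ys : 'I_N -> 'rV[R]_d) (x : 'rV[R]_p) : 'rV[R]_d :=
  proj_ball (lp_est beta h K Xs Ys x).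

End defs.

(* Main.v *)
(* Write U_i for the vector of monomials of (X_i - x) / h.  If the weighted Gram
   form sum_i K_i <U_i, theta>^2 dominates lam n h^p |theta|^2, the normal
   equations bound the error at x by (lam n h^p)^-1 times the norm of the scores
   sum_i K_i U_i (Y_i - T(X_i)), where T is the Taylor polynomial of the
   regression function at x.
   The Gram bound holds outside an event of probability O(exp (- c n h^p)) by
   concentration of the entries and a sublevel set estimate: along the moment
   curve a polynomial becomes univariate, so that few of the translates of a
   sublevel set meet at a point, and the measure of the set is small.
   The scores have mean O(h^(p + beta)) and second moment O(h^p), hence
   exponential moments; averaging these over the d coordinates instead of taking
   a union bound gives a constant C1 that does not depend on d. *)

Require Import Defs.
From HB Require Import structures.
From mathcomp Require Import all_boot all_order all_algebra.
From mathcomp Require Import all_classical all_reals all_analysis.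
From mathcomp Require Import measurable_realfun ring lra.
Import Order.TTheory GRing.Theory Num.Theory.
Import numFieldNormedType.Exports.
Set Implicit Arguments.
Unset Strict Implicit.
Unset Printing Implicit Defensive.

Local Open Scope classical_set_scope.
Local Open Scope ring_scope.

(** * Lebesgue measure on row vectors *)

(** The estimator is a chosen minimizer, so the deviation set is not handled directly: it is covered
    by a measurable event built from sums of explicit functions of one observation. The scores are
    truncated to the observations with X in the support and the response in the unit ball. They
    become bounded, so every mean is finite and linearity has no side conditions; the truncation
    costs a null event. Independence is stated for rectangles, and means of products are reached
    through step functions rather than through a product measure. The regression function has norm
    at most 1 at every point of the support, by continuity and the thickness condition. Hence the
    exceptional set of points x is the complement of the support, whatever n and delta. The bias of
    the scores is negligible only once n h^p delta^2 / d exceeds a constant. Below it C1 makes the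
    bound trivial, and for delta > 2 the projection onto the unit ball makes the event empty. *)

Lemma sqr_enorm {R : realType} n (v : 'rV[R]_n) :
  enorm v ^+ 2 = \sum_(j < n) v ord0 j ^+ 2.
Proof. by rewrite sqr_sqrtr// sumr_ge0// => j _; exact: sqr_ge0. Qed.

Lemma enorm_ge0 {R : realType} n (v : 'rV[R]_n) : 0 <= enorm v.
Proof. exact: sqrtr_ge0. Qed.

Lemma coord_le_enorm {R : realType} n (v : 'rV[R]_n) i : `|v ord0 i| <= enorm v.
Proof.
rewrite -(@ler_pXn2r _ 2) ?nnegrE ?enorm_ge0// sqr_enorm real_normK ?num_real//.
by rewrite (bigD1 i)//= lerDl sumr_ge0// => j _; exact: sqr_ge0.
Qed.

Lemma enormZ {R : realType} n (c : R) (v : 'rV[R]_n) : 0 <= c ->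
  enorm (c *: v) = c * enorm v.
Proof.
move=> c0; apply/eqP; rewrite -(@eqrXn2 _ 2) ?mulr_ge0 ?enorm_ge0//.
rewrite exprMn !sqr_enorm big_distrr/=; apply/eqP/eq_bigr => i _.
by rewrite mxE exprMn.
Qed.

Section rv_measurability.
Context {R : realType}.

Lemma measurable_coord n (i : 'I_n) :
  measurable_fun setT (fun v : 'rV[R]_n => v ord0 i).
Proof.
move=> _ A mA; apply: sub_sigma_algebra; rewrite -bigcup_seq/=.
by exists i => /=; [rewrite mem_index_enum|exists A].
Qed.

Lemma measurable_fun_rV d (T : measurableType d) n (f : T -> 'rV[R]_n) :
  (forall i, measurable_fun setT (fun t => f t ord0 i)) ->
  measurable_fun setT f.
Proof.
move=> mf.
apply: (measurability (\big[setU/set0]_(i < n) preimage_set_system setT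
    (fun x : 'rV[R]_n => x ord0 i) measurable)) => //.
rewrite -bigcup_seq/= => _ [_ [i _] [A mA <-] <-].
by rewrite !setTI; rewrite -[X in measurable X]setTI; exact: mf.
Qed.

Lemma measurable_fun_coord d (T : measurableType d) n (f : T -> 'rV[R]_n) i :
  measurable_fun setT f -> measurable_fun setT (fun t => f t ord0 i).
Proof. by move=> mf; exact: (measurableT_comp (measurable_coord i) mf). Qed.

Lemma measurable_enorm n : measurable_fun setT (@enorm R n).
Proof.
apply: (@measurableT_comp _ _ _ _ _ _ (@Num.sqrt R)).
  exact: (continuous_measurable_fun (@sqrt_continuous R)).
apply: measurable_sum => i; apply: measurable_funX; exact: measurable_coord.
Qed.

Lemma measurable_eball n (x : 'rV[R]_n) r : measurable (eball x r).
Proof.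
have mB : measurable_fun setT (fun y : 'rV[R]_n => y - x).
  apply: measurable_fun_rV => i.
  rewrite (_ : (fun _ => _) = fun y : 'rV[R]_n => y ord0 i - x ord0 i); last first.
    by apply/funext => y; rewrite !mxE.
  by apply: measurable_funB => //; exact: measurable_coord.
rewrite -[X in measurable X]setTI.
rewrite (_ : eball x r = (fun y => enorm (y - x)) @^-1` `]-oo, r]); last first.
  by apply/seteqP; split => y /=; rewrite in_itv.
have mc : measurable_fun setT (fun y : 'rV[R]_n => enorm (y - x)).
  exact: (measurableT_comp (@measurable_enorm n) mB).
exact: mc.
Qed.

Lemma measurable_box n (a b : 'rV[R]_n) : measurable (box a b).
Proof.
rewrite (_ : box a b = \bigcap_(i in [set: 'I_n])
    ((fun v : 'rV[R]_n => v ord0 i) @^-1` `[a ord0 i, b ord0 i])); last first.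
  apply/seteqP; split => y /= yP i => [_|]; first by rewrite /= in_itv/=; exact: yP.
  by have := yP i I; rewrite /= in_itv.
apply: fin_bigcap_measurable => // i _; rewrite -[X in measurable X]setTI.
exact: measurable_coord.
Qed.

Definition boxes n : set (set 'rV[R]_n) := [set A | exists a b, A = box a b].

(** [is_lebesgue] fixes the measure on boxes, whereas the sigma-algebra is generated by coordinates.
    A half-space [c <= v_i] is the countable union of the boxes cut at [c] in direction [i] and
    otherwise bounded by [k]. *)
Lemma measurable_boxes n :
  @measurable rv_display 'rV[R]_n = <<s @boxes n >>.
Proof.
apply/seteqP; split; last first.
  apply: smallest_sub; first exact: sigma_algebra_measurable.
  by move=> _ [a [b ->]]; exact: measurable_box.
apply: smallest_sub; first exact: smallest_sigma_algebra.
rewrite -bigcup_seq/= => _ [i _] [A mA <-].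
pose T : measurableType _ := g_sigma_algebraType (@boxes n).
suff : measurable_fun [set: T] (fun v : T => (v : 'rV[R]_n) ord0 i).
  by move=> /(_ measurableT A mA).
apply: (measurability _ (RGenCInfty.measurableE R)).
move=> _ [_ [c ->] <-]; rewrite setTI.
rewrite (_ : _ @^-1` _ = \bigcup_k box
  (\row_j if j == i then c else - k%:R) (\row_(j < n) k%:R)); last first.
  apply/seteqP; split => v /=; rewrite in_itv/= andbT.
    move=> cv.
    have [k vk] : exists k : nat, forall j, `|(v : 'rV[R]_n) ord0 j| <= k%:R.
      exists (Num.trunc (\sum_j `|(v : 'rV[R]_n) ord0 j|)).+1 => j.
      apply/ltW/(le_lt_trans _ (truncnS_gt _)).
      by rewrite (bigD1 j)//= lerDl sumr_ge0.
    exists k => // j; rewrite !mxE; have := vk j; rewrite ler_norml => /andP[? ->].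
    by case: eqP => [->|]; rewrite ?cv ?andbT.
  by move=> [k _ /(_ i)]; rewrite !mxE eqxx => /andP[].
apply: bigcupT_measurable => k; apply: sub_sigma_algebra.
by exists (\row_j if j == i then c else - k%:R), (\row_(j < n) k%:R).
Qed.

(** Dynkin uniqueness: boxes are stable under intersection and exhaust the space. Agreement is asked
    only for ordered corners, since every other box is empty. *)
Lemma eq_measure_boxes n (m1 m2 : {measure set 'rV[R]_n -> \bar R}) :
  (forall a b : 'rV[R]_n, (forall i, a ord0 i <= b ord0 i) ->
    m1 (box a b) = m2 (box a b)) ->
  (forall a b : 'rV[R]_n, (m1 (box a b) < +oo)%E) ->
  forall A, measurable A -> m1 A = m2 A.
Proof.
move=> m12 fin; apply: (measure_unique (@boxes n)
  (fun k => box (\row_(j < n) (- k%:R : R)) (\row_(j < n) k%:R))).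
- exact: measurable_boxes.
- move=> _ _ [a [b ->]] [a' [b' ->]].
  exists (\row_j Num.max (a ord0 j) (a' ord0 j)),
    (\row_j Num.min (b ord0 j) (b' ord0 j)).
  apply/seteqP; split => [v [v1 v2] j|v vP].
    have /andP[h1 h2] := v1 j; have /andP[h3 h4] := v2 j.
    by rewrite !mxE ge_max le_min h1 h2 h3 h4.
  split=> j; have := vP j; rewrite !mxE ge_max le_min;
    by move=> /andP[/andP[h1 h2] /andP[h3 h4]]; apply/andP.
- by move=> k; exists (\row_(j < n) (- k%:R : R)), (\row_(j < n) k%:R).
- apply/seteqP; split => // v _.
  exists (Num.trunc (\sum_j `|v ord0 j|)).+1 => // j; rewrite !mxE -ler_norml.
  apply/ltW/(le_lt_trans _ (truncnS_gt _)).
  by rewrite (bigD1 j)//= lerDl sumr_ge0.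
- move=> _ [a [b ->]].
  have [ab|/existsNP[i]] := pselect (forall i, a ord0 i <= b ord0 i).
    exact: m12.
  move=> /negP; rewrite -ltNge => ba.
  suff -> : box a b = set0 by rewrite !measure0.
  apply/seteqP; split => // v /(_ i) /andP[av vb].
  by have := lt_le_trans ba (le_trans av vb); rewrite ltxx.
- by move=> k; exact: fin.
Qed.

Lemma measurable_affine n (x : 'rV[R]_n) (h : R) :
  measurable_fun setT (fun y : 'rV[R]_n => h *: (y - x)).
Proof.
apply: measurable_fun_rV => i.
rewrite (_ : (fun _ => _) =
    fun y : 'rV[R]_n => h * (y ord0 i - x ord0 i)); last first.
  by apply/funext => y; rewrite !mxE.
apply: measurable_funM => //; apply: measurable_funB => //.
exact: measurable_coord.
Qed.

End rv_measurability.

Section lebesgue.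
Context {R : realType} {p : nat} (leb : {measure set 'rV[R]_p -> \bar R}).
Hypothesis lebP : is_lebesgue leb.

Lemma leb_box_fin a b : (leb (box a b) < +oo)%E.
Proof.
apply: (@le_lt_trans _ _ (leb (box (\row_j Num.min (a ord0 j) (b ord0 j))
   (\row_j Num.max (a ord0 j) (b ord0 j))))).
  apply: le_measure; rewrite ?inE; [exact: measurable_box..|].
  move=> v vP j; have /andP[av vb] := vP j.
  by rewrite !mxE ge_min av le_max vb orbT.
by rewrite lebP ?ltry// => i; rewrite !mxE ge_min le_max lexx.
Qed.

(** The pushforward under [y => (y - x) / h] and [h ^ p] times Lebesgue measure agree on boxes,
    hence everywhere. *)
Lemma leb_affine (x : 'rV[R]_p) (h : R) (A : set 'rV[R]_p) : 0 < h ->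
  measurable A ->
  leb ((fun y => h^-1 *: (y - x)) @^-1` A) = ((h ^+ p)%:E * leb A)%E.
Proof.
move=> h0 mA.
pose phi := fun y : 'rV[R]_p => h^-1 *: (y - x).
have mphi : measurable_fun setT phi by exact: measurable_affine.
have hp0 : 0 <= h ^+ p by rewrite exprn_ge0// ltW.
pose m0 := (pushforward leb phi : {measure set 'rV[R]_p -> \bar R}).
pose m1 : {measure set 'rV[R]_p -> \bar R} := m0 mphi.
pose m2 : {measure set 'rV[R]_p -> \bar R} := mscale (NngNum hp0) leb.
suff : forall A, measurable A -> m1 A = m2 A by apply.
have phibox a b : phi @^-1` (box a b) = box (x + h *: a) (x + h *: b).
  have le1 (u v w : R) : (u <= h^-1 * (v - w)) = (w + h * u <= v).
    by rewrite mulrC ler_pdivlMr// lerBrDl (mulrC u).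
  have le2 (u v w : R) : (h^-1 * (v - w) <= u) = (v <= w + h * u).
    by rewrite mulrC ler_pdivrMr// lerBlDl (mulrC u).
  by apply/seteqP; split => v vP i; have := vP i; rewrite /phi !mxE le1 le2.
apply: eq_measure_boxes => [a b ab|a b]; last first.
  by rewrite /m1 /m0 /= /pushforward phibox leb_box_fin.
rewrite /m1 /m0 /m2 /= /pushforward /mscale/= phibox !lebP//; last first.
  by move=> i; rewrite !mxE lerD2l ler_wpM2l// ltW.
rewrite -EFinM; congr EFin.
have -> : h ^+ p = \prod_(i < p) h by rewrite prodr_const card_ord.
by rewrite -big_split/=; apply: eq_bigr => i _; rewrite !mxE; ring.
Qed.

Lemma leb_translate (x : 'rV[R]_p) (A : set 'rV[R]_p) : measurable A ->
  leb ((fun y => y + x) @^-1` A) = leb A.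
Proof.
move=> mA; have := leb_affine (- x) ltr01 mA.
rewrite expr1n mul1e => <-; congr (leb _); apply/seteqP; split => y /=;
  by rewrite invr1 scale1r opprK.
Qed.

Lemma eball_affine (x : 'rV[R]_p) (h r : R) : 0 < h ->
  (fun y => h^-1 *: (y - x)) @^-1` (eball 0 r) = eball x (h * r).
Proof.
move=> h0; have E y : (enorm (h^-1 *: (y - x)) <= r) = (enorm (y - x) <= h * r).
  have hV0 : 0 <= h^-1 by rewrite invr_ge0 ltW.
  by rewrite enormZ// mulrC ler_pdivrMr// mulrC.
by apply/seteqP; split => y; rewrite /eball/= subr0 E.
Qed.

Lemma leb_eball_fin (x : 'rV[R]_p) r : (leb (eball x r) < +oo)%E.
Proof.
apply: le_lt_trans (leb_box_fin (x - \row_j r) (x + \row_j r)).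
apply: le_measure; rewrite ?inE; [exact: measurable_eball|exact: measurable_box|].
move=> v /= vP j; have := le_trans (coord_le_enorm (v - x) j) vP.
by rewrite !mxE ler_distl.
Qed.

Lemma leb_eball_gt0 (x : 'rV[R]_p) r : 0 < r -> (0 < leb (eball x r))%E.
Proof.
move=> r0; have p1 : 0 < p%:R + 1 :> R by rewrite ltr_wpDl.
(* Half-side of a cube inside the ball: [p e^2 <= r^2]. Dividing by [p + 1] avoids both a square
   root and the case [p = 0]. *)
pose e : R := r / (p%:R + 1); have e0 : 0 < e by rewrite divr_gt0.
apply: (@lt_le_trans _ _ (leb (box (x - \row_j e) (x + \row_j e)))).
  rewrite lebP => [|i]; last by rewrite !mxE lerD2l (@le_trans _ _ 0)// ?oppr_le0 ltW.
  rewrite lte_fin prodr_gt0// => i _; rewrite !mxE.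
  by rewrite (_ : _ - _ = e + e) ?addr_gt0//; ring.
apply: le_measure; rewrite ?inE; [exact: measurable_box|exact: measurable_eball|].
move=> v vP; rewrite /eball/= -(@ler_pXn2r _ 2) ?nnegrE ?enorm_ge0 ?(ltW r0)//.
rewrite sqr_enorm (@le_trans _ _ (\sum_(j < p) e ^+ 2))//.
  apply: ler_sum => j _; rewrite -[leLHS]real_normK ?num_real//.
  rewrite ler_pXn2r ?nnegrE ?(ltW e0)//.
  by have := vP j; rewrite !mxE ler_distl.
rewrite sumr_const card_ord -[leLHS]mulr_natl /e expr_div_n mulrA.
rewrite ler_pdivrMr ?exprn_gt0// mulrC ler_wpM2l ?sqr_ge0//.
by rewrite expr2 mulrDl mul1r mulrDr mulr1 -[leLHS]addr0 -addrA; nra.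
Qed.

End lebesgue.

(** * Weighted least squares *)

Section weighted_least_squares.
Context {R : realType} {I : finType} {N : nat}.
Variables (k : 'I_N -> R) (a : 'I_N -> I -> R).
Hypothesis k_ge0 : forall i, 0 <= k i.

Definition normal_eq (y : 'I_N -> R) (c : I -> R) :=
  forall s, \sum_i k i * a i s * (y i - \sum_t a i t * c t) = 0.

(** The Gram matrix is injective: [v A = 0] gives [v A v^T = 0], which is the weighted sum of
    squares of the hypothesis. The index type is enumerated only to form a matrix. *)
Lemma normal_eq_solvable (y : 'I_N -> R) :
  (forall c : I -> R,
     \sum_i k i * (\sum_s a i s * c s) ^+ 2 = 0 -> forall s, c s = 0) ->
  exists c, normal_eq y c.
Proof.
move=> inj.
have sumE (F : I -> R) : \sum_s F s = \sum_(u < #|I|) F (enum_val u).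
  rewrite (reindex (enum_val : 'I_#|I| -> I))/=; last first.
    by exists enum_rank => ? _; rewrite ?enum_valK ?enum_rankK.
  by [].
pose A : 'M[R]_#|I| :=
  \matrix_(u, v) \sum_i k i * a i (enum_val u) * a i (enum_val v).
pose b : 'rV[R]_#|I| := \row_v \sum_i k i * a i (enum_val v) * y i.
have AE u v : A u v = \sum_i k i * a i (enum_val u) * a i (enum_val v).
  by rewrite mxE.
have Afree : row_free A.
  apply: inj_row_free => v vA0.
  have : (v *m A *m v^T) ord0 ord0 = 0 by rewrite vA0 mul0mx mxE.
  rewrite mxE.
  under eq_bigr do rewrite !mxE big_distrl/=.
  rewrite exchange_big/=.
  under eq_bigr do (under eq_bigr do rewrite AE big_distrr big_distrl/=).
  under eq_bigr do rewrite exchange_big/=.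
  rewrite exchange_big/= => Q0.
  have c0 := inj (fun s => v ord0 (enum_rank s)).
  apply/rowP => u; rewrite mxE -[u]enum_valK; apply: c0.
  rewrite -{}[RHS]Q0; apply: eq_bigr => i _.
  rewrite sumE expr2 big_distrl/= big_distrr/=; apply: eq_bigr => u1 _.
  rewrite !big_distrr/=; apply: eq_bigr => u2 _.
  by rewrite !enum_valK; ring.
have Aunit : A \in unitmx by rewrite -row_free_unit.
pose c := b *m invmx A.
have cA : c *m A = b by rewrite mulmxKV.
exists (fun s => c ord0 (enum_rank s)) => s.
have := congr1 (fun M : 'rV_#|I| => M ord0 (enum_rank s)) cA.
rewrite !mxE => cAs.
under eq_bigr do rewrite mulrBr.
rewrite sumrB; apply/eqP; rewrite subr_eq0; apply/eqP.
move: cAs; rewrite enum_rankK -/c => <-.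
under eq_bigr do rewrite AE big_distrr/=.
rewrite exchange_big/=; apply: eq_bigr => i _.
rewrite enum_rankK sumE big_distrr/=.
by apply: eq_bigr => u _; rewrite enum_valK; ring.
Qed.

(** The cross term is a linear combination of the normal equations. Having an equality gives
    minimality and, when the last term is definite, uniqueness as well. *)
Lemma normal_eq_pythagoras (y : 'I_N -> R) (c c' : I -> R) : normal_eq y c ->
  \sum_i k i * (y i - \sum_t a i t * c' t) ^+ 2 =
  \sum_i k i * (y i - \sum_t a i t * c t) ^+ 2 +
  \sum_i k i * (\sum_t a i t * (c' t - c t)) ^+ 2.
Proof.
move=> neq.
have cross : \sum_i k i * (y i - \sum_t a i t * c t) *
    (\sum_t a i t * (c' t - c t)) = 0.
  under eq_bigr do rewrite big_distrr/=.
  rewrite exchange_big/= big1// => s _.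
  transitivity ((c' s - c s) *
      \sum_i k i * a i s * (y i - \sum_t a i t * c t)).
    by rewrite big_distrr/=; apply: eq_bigr => i _; ring.
  by rewrite neq mulr0.
have aD i : \sum_t a i t * (c' t - c t) =
    \sum_t a i t * c' t - \sum_t a i t * c t.
  by rewrite -sumrB; apply: eq_bigr => t _; rewrite mulrBr.
transitivity (\sum_i k i * (y i - \sum_t a i t * c t) ^+ 2 +
  \sum_i k i * (\sum_t a i t * (c' t - c t)) ^+ 2 -
  2 * \sum_i k i * (y i - \sum_t a i t * c t) * (\sum_t a i t * (c' t - c t))).
  rewrite big_distrr/= -big_split/= -sumrB.
  by apply: eq_bigr => i _; rewrite !aD; ring.
by rewrite cross mulr0 subr0.
Qed.

(** With [w = c - c'], the normal equations turn the quadratic form at [w] into the pairing of [w]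
    with the scores [V], and Young's inequality absorbs that pairing into half of [lam |w|^2]. No
    equation is asked of [c'], which will hold rescaled Taylor coefficients. *)
Lemma normal_eq_error (lam : R) (y : 'I_N -> R) (c c' : I -> R) : 0 < lam ->
  (forall e : I -> R, lam * \sum_s e s ^+ 2 <=
     \sum_i k i * (\sum_s a i s * e s) ^+ 2) ->
  normal_eq y c ->
  \sum_s (c s - c' s) ^+ 2 <=
  (\sum_s (\sum_i k i * a i s * (y i - \sum_t a i t * c' t)) ^+ 2) / lam ^+ 2.
Proof.
move=> lam0 Qge neq.
set V := fun s => \sum_i k i * a i s * (y i - \sum_t a i t * c' t).
rewrite -/(V _); pose w s := c s - c' s.
have QE : \sum_i k i * (\sum_s a i s * w s) ^+ 2 = \sum_s w s * V s.
  transitivity (\sum_s w s * (V s -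
      \sum_i k i * a i s * (y i - \sum_t a i t * c t))).
    transitivity (\sum_i \sum_s
        w s * (k i * a i s * (\sum_t a i t * w t))).
      apply: eq_bigr => i _; rewrite expr2 big_distrl/= big_distrr/=.
      by apply: eq_bigr => s _; ring.
    rewrite exchange_big/=; apply: eq_bigr => s _.
    rewrite -big_distrr/= /V -sumrB; congr (_ * _); apply: eq_bigr => i _.
    have -> : \sum_t a i t * w t = \sum_t a i t * c t - \sum_t a i t * c' t.
      by rewrite -sumrB; apply: eq_bigr => t _; rewrite mulrBr.
    ring.
  by apply: eq_bigr => s _; rewrite neq subr0.
have h1 := Qge w.
rewrite QE in h1.
have h2 : \sum_s w s * V s <=
    lam / 2 * (\sum_s w s ^+ 2) + (\sum_s V s ^+ 2) / (2 * lam).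
  rewrite big_distrr big_distrl -big_split/=; apply: ler_sum => s _.
  rewrite -subr_ge0.
  have -> : lam / 2 * w s ^+ 2 + V s ^+ 2 / (2 * lam) - w s * V s =
      (lam * w s - V s) ^+ 2 / (2 * lam) by field; exact: lt0r_neq0.
  by rewrite divr_ge0 ?sqr_ge0// mulr_ge0// ltW.
have {h1 h2}h3 : lam / 2 * (\sum_s w s ^+ 2) <= (\sum_s V s ^+ 2) / (2 * lam).
  lra.
rewrite ler_pdivlMr ?exprn_gt0//.
have := ler_wpM2l (ltW (mulr_gt0 (ltr0n R 2) lam0)) h3.
have -> : 2 * lam * (lam / 2 * \sum_s w s ^+ 2) = \sum_s w s ^+ 2 * lam ^+ 2.
  by rewrite -big_distrl/=; field.
have -> // : 2 * lam * ((\sum_s V s ^+ 2) / (2 * lam)) = \sum_s V s ^+ 2.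
  by field; exact: lt0r_neq0.
by rewrite -big_distrl.
Qed.

(** The squared norm separates the [d] response coordinates, each of which is a scalar problem with
    its own normal equations; [D] below is the excess of the objective over its minimum. *)
Lemma ls_unique_minimizer d (Y : 'I_N -> 'rV[R]_d) :
  (forall c : I -> R,
     \sum_i k i * (\sum_s a i s * c s) ^+ 2 = 0 -> forall s, c s = 0) ->
  exists th : I -> 'rV[R]_d,
    is_unique_minimizer (fun th : I -> 'rV[R]_d =>
      \sum_i k i * enorm (Y i - \sum_s a i s *: th s) ^+ 2) th /\
    forall j, normal_eq (fun i => Y i ord0 j) (fun s => th s ord0 j).
Proof.
move=> inj.
have /choice[c cP] : forall j : 'I_d,
    exists c, normal_eq (fun i => Y i ord0 j) c.
  by move=> j; exact: normal_eq_solvable.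
pose th s : 'rV[R]_d := \row_j c j s.
have thP j : normal_eq (fun i => Y i ord0 j) (fun s => th s ord0 j).
  move=> s; rewrite -[RHS](cP j s); apply: eq_bigr => i _; congr (_ * (_ - _)).
  by apply: eq_bigr => t _; rewrite mxE.
exists th; split => //.
pose J (th : I -> 'rV[R]_d) :=
  \sum_i k i * enorm (Y i - \sum_s a i s *: th s) ^+ 2.
pose D (t' : I -> 'rV[R]_d) :=
  \sum_j \sum_i k i * (\sum_t a i t * (t' t ord0 j - th t ord0 j)) ^+ 2.
have JE t' : J t' = \sum_(j < d) \sum_i k i *
    (Y i ord0 j - \sum_t a i t * t' t ord0 j) ^+ 2.
  rewrite exchange_big/=; apply: eq_bigr => i _.
  rewrite sqr_enorm big_distrr/=; apply: eq_bigr => j _.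
  rewrite !mxE summxE; congr (_ * (_ - _) ^+ 2).
  by apply: eq_bigr => s _; rewrite mxE.
have JD t' : J t' = J th + D t'.
  rewrite !JE -big_split/=; apply: eq_bigr => j _.
  exact: normal_eq_pythagoras.
have D0 t' : 0 <= D t'.
  by rewrite sumr_ge0// => j _; rewrite sumr_ge0// => i _;
    rewrite mulr_ge0// sqr_ge0.
split=> [t'|t' t'min]; first by rewrite -/(J _) -/(J _) (JD t') lerDl.
have Dt'0 : D t' = 0.
  apply/eqP; rewrite eq_le D0 andbT.
  by have := t'min th; rewrite -/(J _) -/(J _) (JD t'); rewrite gerDl.
apply/funext => s; apply/rowP => j; apply/eqP; rewrite -subr_eq0; apply/eqP.
apply: (inj (fun t => t' t ord0 j - th t ord0 j)).
move/eqP: Dt'0; rewrite psumr_eq0 => [/allP/(_ j)|j' _].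
  by rewrite mem_index_enum => /(_ isT)/eqP.
by rewrite sumr_ge0// => i _; rewrite mulr_ge0// sqr_ge0.
Qed.

End weighted_least_squares.

(** * Sublevel sets of polynomials *)

Lemma monic_size_prod (R : idomainType) (I : Type) (r : seq I) (F : I -> {poly R})
    (w : I -> nat) :
  (forall i, F i \is monic /\ size (F i) = (w i).+1) ->
  \prod_(i <- r) F i \is monic /\
  size (\prod_(i <- r) F i) = (\sum_(i <- r) w i).+1.
Proof.
move=> FP; elim: r => [|i r [m1 s1]].
  by rewrite !big_nil monic1 size_poly1.
rewrite !big_cons; have [m2 s2] := FP i; split; first by rewrite monicMl.
by rewrite size_monicM ?monic_neq0// s1 s2 addSn/= addnS.
Qed.

Section univariate_bounds.
Context {R : realType}.

(* Newton interpolation: divide by [X - t] and recurse on the quotient. *)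
Lemma coef_bound_from_values (sigma : R) (W : nat) : 0 < sigma ->
  exists2 C : R, 0 < C & forall ts : seq R, size ts = W ->
    uniq ts -> {in ts &, forall t t', t != t' -> sigma <= `|t - t'|} ->
    {in ts, forall t, `|t| <= 1} ->
    forall (q : {poly R}) (eta : R), 0 <= eta -> (size q <= W)%N ->
    {in ts, forall t, `|q.[t]| <= eta} -> forall k, `|q`_k| <= C * eta.
Proof.
move=> s0; elim: W => [|W [C C0 IH]].
  exists 1 => // ts /size0nil -> _ _ _ q eta eta0.
  rewrite leqn0 size_poly_eq0 => /eqP -> _ k.
  by rewrite coef0 normr0 mul1r.
(* A coefficient of [q] is built from two coefficients of the quotient, each at most
   [C * (2 eta / sigma)], and possibly the value at [t], at most [eta]. *)
exists (4 * C / sigma + 1); first by rewrite addr_gt0// divr_gt0// mulr_gt0.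
case=> // t ts [szts] /= /andP[tts uts] sep le1 q eta eta0 szq qle k.
have : root (q - q.[t]%:P) t by rewrite rootE !hornerE subrr.
move=> /factor_theorem[q' qE].
have {}qE : q = q' * ('X - t%:P) + q.[t]%:P by rewrite -qE subrK.
have tle : `|t| <= 1 by apply: le1; rewrite mem_head.
have qtle : `|q.[t]| <= eta by apply: qle; rewrite mem_head.
have q'le : forall k, `|q'`_k| <= C * (2 * eta / sigma).
  apply: (IH ts) => //.
  - by move=> u v uts' vts; apply: sep; rewrite inE ?uts' ?vts orbT.
  - by move=> u uts'; apply: le1; rewrite inE uts' orbT.
  - by rewrite divr_ge0 ?mulr_ge0 ?(ltW s0).
  - have [->|q'0] := eqVneq q' (0 : {poly R}); first by rewrite size_poly0.
    have : (size (q - q.[t]%:P)%R <= W.+1)%N.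
      rewrite (leq_trans (size_polyD _ _))// geq_max szq size_polyN.
      by rewrite (leq_trans (size_polyC_leq1 _)).
    have -> : q - q.[t]%:P = q' * ('X - t%:P) by rewrite {1}qE addrK.
    by rewrite size_Mmonic ?monicXsubC// size_XsubC addn2.
  - move=> u uts'.
    have ut : u != t by apply: contraNneq tts => <-.
    have dge : sigma <= `|u - t|.
      by apply: sep => //; rewrite inE ?uts' ?eqxx ?orbT.
    have quE : q'.[u] * (u - t) = q.[u] - q.[t].
      by rewrite [in q.[u]]qE !hornerE addrK.
    have qu : `|q.[u]| <= eta by apply: qle; rewrite inE uts' orbT.
    rewrite ler_pdivlMr//.
    apply: (@le_trans _ _ (`|q'.[u]| * `|u - t|)); first exact: ler_wpM2l.
    rewrite -normrM quE (le_trans (ler_normB _ _))//.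
    by rewrite mulr_natl mulr2n lerD.
have qkE : q`_k = (if k is k'.+1 then q'`_k' else 0) - q'`_k * t +
    (if k == 0%N then q.[t] else 0).
  rewrite [in LHS]qE coefD mulrBr coefB coefMX coefMC coefC.
  by case: k.
rewrite qkE (le_trans (ler_normD _ _))// mulrDl mul1r lerD//; last first.
  by case: ifP => // _; rewrite normr0.
rewrite (le_trans (ler_normB _ _))// normrM.
have E : 4 * C / sigma * eta = C * (2 * eta / sigma) + C * (2 * eta / sigma).
  by field; exact: lt0r_neq0.
rewrite E lerD//.
  by case: (k) => [|k' //]; rewrite normr0 !mulr_ge0// ?invr_ge0 ltW.
by rewrite -[leRHS]mulr1 ler_pM.
Qed.

(** Majorants in the sense of Cauchy: domination passes to products, so a bound uniform over all
    shifts [u] with [|u_i| <= r] is read off from the single shift [(r, ..., r)]. *)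
Definition coef_dominated (q Q : {poly R}) := forall k, `|q`_k| <= Q`_k.

Lemma coef_dominatedM q1 Q1 q2 Q2 :
  coef_dominated q1 Q1 -> coef_dominated q2 Q2 ->
  coef_dominated (q1 * q2) (Q1 * Q2).
Proof.
move=> d1 d2 k; rewrite !coefM (le_trans (ler_norm_sum _ _ _))//.
by apply: ler_sum => j _; rewrite normrM ler_pM.
Qed.

Lemma coef_dominated1 : coef_dominated 1 1.
Proof. by move=> k; rewrite coef1 normr_nat. Qed.

Lemma coef_dominated_prod (I : Type) (s : seq I) (q Q : I -> {poly R}) :
  (forall i, coef_dominated (q i) (Q i)) ->
  coef_dominated (\prod_(i <- s) q i) (\prod_(i <- s) Q i).
Proof.
move=> qQ; elim: s => [|i s IH]; first by rewrite !big_nil; exact: coef_dominated1.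
by rewrite !big_cons; exact: coef_dominatedM.
Qed.

Lemma coef_dominatedX q Q n : coef_dominated q Q ->
  coef_dominated (q ^+ n) (Q ^+ n).
Proof.
move=> qQ; elim: n => [|n IH]; first by rewrite !expr0; exact: coef_dominated1.
by rewrite !exprS; exact: coef_dominatedM.
Qed.

(* Downward induction on the degrees: the leading terms determine the
   coefficients of a combination of monic polynomials of distinct degrees. *)
Lemma monic_family_bound (I : finType) (w : I -> nat) (W : nat) (B : R) :
  injective w -> (forall s, (w s <= W)%N) -> 0 <= B ->
  forall (q : I -> {poly R}),
  (forall s, q s \is monic /\ size (q s) = (w s).+1) ->
  (forall s k, `|(q s)`_k| <= B) ->
  forall (th : I -> R) (eps : R), 0 <= eps ->
  (forall k, `|(\sum_s th s *: q s)`_k| <= eps) ->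
  forall s, `|th s| <= (1 + #|I|%:R * B) ^+ W.+1 * eps.
Proof.
move=> winj wW B0 q qP qB th eps eps0 Ple s.
set A := 1 + _; have A1 : 1 <= A by rewrite lerDl mulr_ge0.
(* [j] counts degrees from the top: stage [j] treats the indices of degree above [W - j], and each
   stage multiplies the bound by [A]. Stage [W + 1] reaches degree 0. *)
suff H j : forall s, (W < w s + j)%N -> `|th s| <= A ^+ j * eps.
  by apply: H; rewrite addnS ltnS leq_addl.
elim: j => [|j IH] {}s; first by rewrite addn0 ltnNge wW.
rewrite addnS ltnS => Wsj.
have := Ple (w s); rewrite coef_sum (bigD1 s)//= coefZ.
have -> : (q s)`_(w s) = 1.
  by have [/monicP <-] := qP s; rewrite /lead_coef => ->.
rewrite mulr1; set T := \sum_(_ | _) _ => thT.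
have Tle : `|T| <= #|I|%:R * B * (A ^+ j * eps).
  rewrite (le_trans (ler_norm_sum _ _ _))//.
  apply: (@le_trans _ _ (\sum_(s' : I) B * (A ^+ j * eps))); last first.
    by rewrite sumr_const mulr_natl mulrnAl.
  rewrite [leRHS](bigD1 s)//= -[leLHS]add0r lerD//.
    by rewrite !mulr_ge0// exprn_ge0// (le_trans _ A1).
  apply: ler_sum => s' ss'; rewrite coefZ normrM mulrC.
  have [lt|ge] := ltnP (w s') (w s).
    rewrite [(q s')`__]nth_default ?normr0 ?mul0r; last by rewrite (qP s').2.
    by rewrite !mulr_ge0// exprn_ge0// (le_trans _ A1).
  rewrite ler_pM// IH//.
  have : w s != w s' by rewrite (inj_eq winj) eq_sym.
  by move=> ne; have := ltn_neqAle (w s) (w s'); rewrite ne ge/= => lt;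
    rewrite (leq_ltn_trans Wsj)// ltn_add2r.
have : `|th s| <= `|th s + T| + `|T|.
  by rewrite -{1}[th s](addrK T) (le_trans (ler_normB _ _)).
move=> /le_trans; apply.
rewrite (le_trans (lerD thT Tle))// exprS /A mulrDl mul1r mulrDl lerD//.
  by rewrite -{1}[eps]mul1r ler_wpM2r// exprn_ege1.
by rewrite mulrA.
Qed.

End univariate_bounds.

(** Reduction modulo [b] isolates the lowest digit; then divide by [b] and recurse. *)
Lemma digits_inj p b (f g : 'I_p -> nat) :
  (forall i, (f i < b)%N) -> (forall i, (g i < b)%N) ->
  (\sum_(i < p) f i * b ^ i = \sum_(i < p) g i * b ^ i)%N -> f =1 g.
Proof.
elim: p f g => [|p IH] f g fb gb; first by move=> _ [].
rewrite !big_ord_recl !expn0 !muln1 => E.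
have shift (e : 'I_p.+1 -> nat) :
    (\sum_(i < p) e (lift ord0 i) * b ^ lift ord0 i =
     (\sum_(i < p) e (lift ord0 i) * b ^ i) * b)%N.
  by rewrite big_distrl/=; apply: eq_bigr => i _; rewrite -mulnA -expnSr.
have E0 : f ord0 = g ord0.
  move/(congr1 (fun x => x %% b)%N): E.
  by rewrite !shift addnC modnMDl addnC modnMDl !modn_small.
have b0 : (0 < b)%N by exact: leq_ltn_trans (leq0n _) (fb ord0).
move: E; rewrite E0 => /addnI; rewrite !shift => /eqP; rewrite eqn_pmul2r// => /eqP.
move=> /(IH (fun i => f (lift ord0 i)) (fun i => g (lift ord0 i))) fg i.
case: (unliftP ord0 i) => [j ->|->//].
by apply: fg => i'; [exact: fb|exact: gb].
Qed.

Section polynomial_sublevel_sets.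
Context {R : realType} {p m : nat}.
Let MI := multi_index p m.

Definition wdeg (s : MI) : nat := (\sum_(i < p) mi_deg s i * m.+1 ^ i)%N.
Definition wdeg_max : nat := (\sum_(i < p) m * m.+1 ^ i)%N.

Lemma mi_deg_le (s : MI) i : (mi_deg s i <= m)%N.
Proof. by rewrite -ltnS /mi_deg; exact: ltn_ord. Qed.

Lemma wdeg_inj : injective wdeg.
Proof.
move=> s t st; apply/val_inj/ffunP => i; apply/val_inj.
by apply: (digits_inj _ _ st) => j; rewrite ltnS mi_deg_le.
Qed.

Lemma wdeg_le s : (wdeg s <= wdeg_max)%N.
Proof. by apply: leq_sum => i _; rewrite leq_mul2r mi_deg_le orbT. Qed.

(** The exponents [(m+1)^i], in place of the usual consecutive ones, are Kronecker's
    substitution. *)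
Definition moment_curve (t : R) : 'rV[R]_p := \row_(i < p) t ^+ (m.+1 ^ i).

Definition mono_curve (u : 'rV[R]_p) (s : MI) : {poly R} :=
  \prod_(i < p) ('X^(m.+1 ^ i) + (u ord0 i)%:P) ^+ mi_deg s i.

Lemma horner_mono_curve u s t :
  (mono_curve u s).[t] = mono (u + moment_curve t) s.
Proof.
rewrite horner_prod; apply: eq_bigr => i _.
by rewrite horner_exp !hornerE !mxE addrC.
Qed.

Lemma mono_curve_monic u s :
  mono_curve u s \is monic /\ size (mono_curve u s) = (wdeg s).+1.
Proof.
apply: (@monic_size_prod R _ _ _ (fun i : 'I_p => mi_deg s i * m.+1 ^ i)%N) => i.
have := @monic_size_prod R _ (index_enum 'I_(mi_deg s i))
  (fun=> 'X^(m.+1 ^ i) + (u ord0 i)%:P) (fun=> (m.+1 ^ i)%N).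
rewrite prodr_const sum_nat_const card_ord; apply => _.
by rewrite monicXnaddC ?size_XnaddC ?expn_gt0.
Qed.

Lemma mono_curve_coef_bound (r : R) : 0 <= r ->
  exists2 B : R, 0 <= B & forall (u : 'rV[R]_p) (s : MI) k,
    (forall i, `|u ord0 i| <= r) ->
    `|(mono_curve u s)`_k| <= B.
Proof.
move=> r0; pose ur : 'rV[R]_p := const_mx r.
have dom (u : 'rV[R]_p) (s : MI) : (forall i, `|u ord0 i| <= r) ->
    coef_dominated (mono_curve u s) (mono_curve ur s).
  move=> ur_le; apply: coef_dominated_prod => i; apply: coef_dominatedX => k.
  rewrite !coefD !coefXn !coefC mxE (le_trans (ler_normD _ _))//.
  by rewrite normr_nat lerD2l; case: eqP => _; rewrite ?normr0 ?ur_le.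
have urP i : `|ur ord0 i| <= r by rewrite mxE ger0_norm.
have ge0 s k : 0 <= (mono_curve ur s)`_k.
  exact: le_trans (normr_ge0 _) (dom ur s urP k).
exists (\sum_s \sum_(k < wdeg_max.+1) (mono_curve ur s)`_k).
  by rewrite sumr_ge0// => s _; rewrite sumr_ge0.
move=> u s k uP; have [kW|Wk] := ltnP k wdeg_max.+1; last first.
  rewrite nth_default ?normr0; last first.
    by rewrite (mono_curve_monic u s).2 (leq_trans _ Wk)// ltnS wdeg_le.
  by rewrite sumr_ge0// => s' _; rewrite sumr_ge0.
rewrite (le_trans (dom u s uP k))// (bigD1 s)//= (bigD1 (Ordinal kW))//=.
rewrite -addrA lerDl addr_ge0// sumr_ge0// => s' _.
by rewrite sumr_ge0.
Qed.

(* Along the translated moment curve a polynomial in [p] variables becomes a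
   univariate one, and by uniqueness of base-[m.+1] digits distinct monomials
   get distinct degrees. *)
Lemma few_small_values (r : R) (k : nat) : 0 <= r -> (0 < k)%N ->
  exists2 A : R, 0 < A & forall (th : MI -> R) (u : 'rV[R]_p) (eta : R),
    0 <= eta -> (forall i, `|u ord0 i| <= r) ->
    (wdeg_max < #|[set j : 'I_k | (`|\sum_s th s *
       mono (u + moment_curve (j%:R / k%:R)) s| <= eta)%R]%SET|)%N ->
    forall s, `|th s| <= A * eta.
Proof.
move=> r0 k0; have k0' : 0 < k%:R :> R by rewrite ltr0n.
have [B B0 Bbound] := mono_curve_coef_bound r0.
have kV0 : 0 < k%:R^-1 :> R by rewrite invr_gt0.
have [C C0 Cbound] := coef_bound_from_values wdeg_max.+1 kV0.
exists ((1 + #|{: MI}|%:R * B) ^+ wdeg_max.+1 * C).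
  by rewrite mulr_gt0// exprn_gt0// ltr_wpDr// mulr_ge0.
move=> th u eta eta0 ur cardj s.
set J := [set j | _]%SET in cardj.
pose q : {poly R} := \sum_s th s *: mono_curve u s.
have qE t : q.[t] = \sum_s th s * mono (u + moment_curve t) s.
  rewrite horner_sum; apply: eq_bigr => s' _.
  by rewrite hornerZ horner_mono_curve.
have szq : (size q <= wdeg_max.+1)%N.
  apply: (leq_trans (size_sum _ _ _)); apply/bigmax_leqP => s' _.
  rewrite (leq_trans (size_scale_leq _ _))//.
  by rewrite (mono_curve_monic u s').2 ltnS wdeg_le.
have tinj : injective (fun j : 'I_k => j%:R / k%:R : R).
  move=> i j /(mulIf _) ij; apply/val_inj/eqP.
  by rewrite -(eqr_nat R) ij// gt_eqF.
(* As many nodes as [q] can have coefficients, which is what interpolation expects. *)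
pose ts := take wdeg_max.+1 [seq (j%:R / k%:R : R) | j : 'I_k <- enum J].
have tsP t : t \in ts -> exists2 j : 'I_k, j \in J & t = j%:R / k%:R.
  by move=> /mem_take /mapP[j]; rewrite mem_enum => jJ ->; exists j.
rewrite -mulrA; apply: (monic_family_bound wdeg_inj wdeg_le B0
  (mono_curve_monic u) (fun s' k' => Bbound u s' k' ur)).
  by rewrite mulr_ge0// ltW.
rewrite -/q; apply: (Cbound ts) => //.
- by rewrite size_takel ?size_map -?cardE.
- by rewrite take_uniq// map_inj_uniq// enum_uniq.
- move=> t t' /tsP[j _ ->] /tsP[j' _ ->] jj'.
  have kV0' := ltW kV0.
  rewrite -mulrBl normrM [X in _ * X]gtr0_norm// ler_peMl//.
  have nejj' : (j : nat) != j' by apply: contraNneq jj' => ->.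
  wlog lt : j j' nejj' {jj'} / (j < j')%N.
    move=> W; have [/W|/W|E] := ltngtP j j'; first exact.
      by rewrite distrC; apply; rewrite eq_sym.
    by rewrite E eqxx in nejj'.
  have le := ltnW lt.
  by rewrite distrC ger0_norm ?subr_ge0 ?ler_nat// -natrB// ler1n subn_gt0.
- move=> t /tsP[j _ ->]; rewrite ger0_norm ?divr_ge0 ?ler0n//.
  by rewrite ler_pdivrMr// mul1r ler_nat ltnW.
- by move=> t /tsP[j + ->]; rewrite inE qE.
Qed.

Lemma measurable_mono (s : MI) : measurable_fun setT (fun v : 'rV[R]_p => mono v s).
Proof.
apply: measurable_prod => i _; apply: measurable_funX.
exact: measurable_coord.
Qed.

Variable leb : {measure set 'rV[R]_p -> \bar R}.
Hypothesis lebP : is_lebesgue leb.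

Lemma sublevel_measure (r eps : R) : 0 <= r -> 0 < eps ->
  exists2 eta : R, 0 < eta & forall th : MI -> R, (exists s, 1 <= `|th s|) ->
    (leb (box (\row__ (- r)) (\row__ r) `&`
      [set u | `|\sum_s th s * mono u s| <= eta])%R <= eps%:E)%E.
Proof.
move=> r0 eps0; pose V : R := wdeg_max%:R * (2 * (r + 1)) ^+ p.
have V0 : 0 <= V by rewrite mulr_ge0// exprn_ge0// mulr_ge0// addr_ge0.
pose k := (Num.trunc (V / eps)).+1.
have kV : V / eps < k%:R by exact: truncnS_gt.
have k0 : (0 < k)%N by [].
have r10 : 0 <= r + 1 by rewrite addr_ge0.
have [A A0 Abound] := few_small_values r10 k0.
(* This makes [A * eta] equal to 1/2, below the coefficient of modulus at least 1. *)
exists (2 * A)^-1; first by rewrite invr_gt0 mulr_gt0.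
move=> th [s0 ths0]; set eta := (2 * A)^-1; set Z := _ `&` _.
have eta0 : 0 <= eta by rewrite invr_ge0 mulr_ge0// ltW.
have mZ : measurable Z.
  apply: measurableI; first exact: measurable_box.
  have mP : measurable_fun setT (fun u : 'rV[R]_p => `|\sum_s th s * mono u s|).
    apply: (measurableT_comp (@normr_measurable _ _)).
    apply: measurable_sum => s; apply: measurable_funM => //.
    exact: measurable_mono.
  rewrite -[X in measurable X]setTI.
  rewrite (_ : [set u | _] = (fun u : 'rV[R]_p =>
      `|\sum_s th s * mono u s|) @^-1` `]-oo, eta]); first exact: mP.
  by apply/seteqP; split => u /=; rewrite in_itv.
pose c (j : 'I_k) := moment_curve (j%:R / k%:R).
pose Zj (j : 'I_k) := (fun u => u + c j) @^-1` Z.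
pose Bx : set 'rV[R]_p := box (\row__ (- (r + 1))) (\row__ (r + 1)).
have mZj j : measurable (Zj j).
  have : measurable_fun setT (fun u : 'rV[R]_p => u + c j).
    apply: measurable_fun_rV => i.
    rewrite (_ : (fun _ => _) = fun u : 'rV[R]_p => u ord0 i + c j ord0 i).
      by apply: measurable_funD => //; exact: measurable_coord.
    by apply/funext => u; rewrite mxE.
  by move=> mc; rewrite -[X in measurable X]setTI; exact: mc.
have c01 j i : 0 <= c j ord0 i <= 1.
  rewrite mxE exprn_ge0 ?divr_ge0 ?ler0n//= exprn_ile1 ?divr_ge0 ?ler0n//.
  by rewrite ler_pdivrMr ?ltr0n// mul1r ler_nat ltnW.
have ZjB j : Zj j `<=` Bx.
  move=> u [uB _] i; move: (uB i) (c01 j i); move: (c j) => cj.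
  by rewrite !mxE; lra.
(* If more than [wdeg_max] translates contained [u], the polynomial would be small at too many
   points of the curve through [u], and all coefficients would be at most 1/2. *)
have count u : (\sum_(j < k) \1_(Zj j) u <= wdeg_max%:R * \1_Bx u :> R)%R.
  have [uB|uB] := pselect (Bx u); last first.
    rewrite big1 ?mulr_ge0 ?ler0n// => j _; rewrite indicE memNset//.
    by move/ZjB.
  rewrite [\1_Bx u]indicE mem_set// mulr1 leNgt; apply/negP => lt.
  have : (wdeg_max < #|[set j : 'I_k | (`|\sum_s th s *
       mono (u + moment_curve (j%:R / k%:R)) s| <= eta)%R]%SET|)%N.
    rewrite -(ltr_nat R) (lt_le_trans lt)// -sum1_card natr_sum.
    rewrite [leRHS]big_mkcond/=; apply: ler_sum => j _; rewrite indicE inE.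
    case: (boolP (u \in Zj j)) => [|_]; last by case: ifP.
    by rewrite inE => -[_ /= ->].
  move=> /(Abound th u eta eta0) H.
  have uP i : `|u ord0 i| <= r + 1.
    by have := uB i; rewrite !mxE ler_norml.
  have := le_trans ths0 (H uP s0).
  by rewrite /eta invfM mulrCA divff ?gt_eqF// mulr1; lra.
have lebZ j : leb (Zj j) = leb Z by exact: leb_translate.
have : (\sum_(j < k) leb (Zj j) <= wdeg_max%:R%:E * leb Bx)%E.
  rewrite (eq_bigr (fun j => \int[leb]_u (\1_(Zj j) u)%:E)%E); last first.
    by move=> j _; rewrite integral_indic// setIT.
  have mB : measurable Bx by exact: measurable_box.
  rewrite -ge0_integral_sum//; last first.
    by move=> j; apply/measurable_EFinP; exact: measurable_indic.
  have -> : leb Bx = (\int[leb]_u (\1_Bx u)%:E)%E by rewrite integral_indic// setIT.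
  rewrite -ge0_integralZl_EFin//; last first.
    by apply/measurable_EFinP; exact: measurable_indic.
  apply: ge0_le_integral => //.
  - by move=> u _; apply: sume_ge0 => j _; rewrite lee_fin.
  - apply: emeasurable_sum => j.
    by apply/measurable_EFinP; exact: measurable_indic.
  - apply/measurable_EFinP; apply: measurable_funM => //.
  - by move=> u _; rewrite sumEFin -EFinM lee_fin count.
under eq_bigr do rewrite lebZ.
have -> : leb Bx = ((2 * (r + 1)) ^+ p)%:E.
  rewrite /Bx lebP => [|i]; last first.
    by rewrite !mxE (le_trans _ r10)// oppr_le0.
  congr EFin; rewrite (eq_bigr (fun=> 2 * (r + 1))).
    by rewrite prodr_const card_ord.
  by move=> i _; rewrite !mxE; ring.
have Zfin : leb Z \is a fin_num.
  rewrite ge0_fin_numE//; apply: le_lt_trans (leb_box_fin lebP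
    (\row__ (- r)) (\row__ r)).
  apply: le_measure; rewrite ?inE//; first exact: measurable_box.
  exact: subIsetl.
rewrite -(fineK Zfin) sumEFin sumr_const card_ord -EFinM !lee_fin -/V => H.
have : fine (leb Z) * k%:R < k%:R * eps.
  rewrite -mulr_natr in H.
  by rewrite (le_lt_trans H)// -ltr_pdivrMr.
by rewrite mulrC ltr_pM2l ?ltr0n// => /ltW.
Qed.

End polynomial_sublevel_sets.

(** * Exponential moments of independent samples *)

Section bounded_measurable_functions.
Context {R : realType} {d : measure_display} {T : measurableType d}.

(** This class is closed under all the operations used below and integrable against any probability,
    so that means can be real numbers rather than extended ones. *)
Definition bmf (f : T -> R) :=
  measurable_fun setT f /\ exists B, forall x, `|f x| <= B.

Lemma bmf_cst c : bmf (cst c).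
Proof. by split; [exact: measurable_cst|exists `|c| => x]. Qed.

Lemma bmfD f g : bmf f -> bmf g -> bmf (fun x => f x + g x).
Proof.
move=> [mf [B fB]] [mg [C gC]]; split; first exact: measurable_funD.
by exists (B + C) => x; rewrite (le_trans (ler_normD _ _))// lerD.
Qed.

Lemma bmfM f g : bmf f -> bmf g -> bmf (fun x => f x * g x).
Proof.
move=> [mf [B fB]] [mg [C gC]]; split; first exact: measurable_funM.
by exists (B * C) => x; rewrite normrM ler_pM.
Qed.

Lemma bmfZ c f : bmf f -> bmf (fun x => c * f x).
Proof. exact: (bmfM (bmf_cst c)). Qed.

Lemma bmfN f : bmf f -> bmf (fun x => - f x).
Proof.
by move=> bf; under eq_fun do rewrite -mulN1r; exact: bmfZ.
Qed.

Lemma bmfB f g : bmf f -> bmf g -> bmf (fun x => f x - g x).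
Proof. by move=> bf bg; apply: bmfD => //; exact: bmfN. Qed.

Lemma bmf_indic A : measurable A -> bmf (\1_A).
Proof.
move=> mA; split; first exact: measurable_indic.
by exists 1 => x; rewrite indicE; case: (_ \in _); rewrite ?normr1 ?normr0.
Qed.

Lemma bmf_sum (I : Type) (s : seq I) (f : I -> T -> R) :
  (forall i, bmf (f i)) -> bmf (fun x => \sum_(i <- s) f i x).
Proof.
move=> bf; elim: s => [|i s IH].
  by under eq_fun do rewrite big_nil; exact: bmf_cst.
by under eq_fun do rewrite big_cons; exact: bmfD.
Qed.

Lemma bmf_prod (I : Type) (s : seq I) (f : I -> T -> R) :
  (forall i, bmf (f i)) -> bmf (fun x => \prod_(i <- s) f i x).
Proof.
move=> bf; elim: s => [|i s IH].
  by under eq_fun do rewrite big_nil; exact: bmf_cst.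
by under eq_fun do rewrite big_cons; exact: bmfM.
Qed.

Lemma bmf_expR f : bmf f -> bmf (fun x => expR (f x)).
Proof.
move=> [mf [B fB]]; split.
  exact: (measurableT_comp (@measurable_expR R) mf).
exists (expR B) => x; rewrite ger0_norm ?expR_ge0// ler_expR.
exact: le_trans (ler_norm _) (fB x).
Qed.

Lemma bmf_dominated (f g : T -> R) : measurable_fun setT f -> bmf g ->
  (forall x, `|f x| <= `|g x|) -> bmf f.
Proof.
by move=> mf [_ [B gB]] fg; split=> //; exists B => x; exact: le_trans (gB x).
Qed.

Variable P : probability T R.

Lemma bmf_integrable f : bmf f -> P.-integrable setT (EFin \o f).
Proof.
move=> [mf [B fB]]; apply: measurable_bounded_integrable => //.
  exact: (le_lt_trans (probability_le1 P measurableT) (ltry _)).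
by exists B; split; [exact: num_real|move=> M BM x _; exact: le_trans (fB x) (ltW BM)].
Qed.

Lemma bmf_EFin f : bmf f ->
  (\int[P]_x (f x)%:E = (\int[P]_x f x)%R%:E)%E.
Proof. by move=> bf; rewrite fineK// integrable_fin_num//; exact: bmf_integrable. Qed.

Lemma meanD f g : bmf f -> bmf g ->
  (\int[P]_x (f x + g x) = \int[P]_x f x + \int[P]_x g x)%R.
Proof. by move=> bf bg; rewrite RintegralD//; exact: bmf_integrable. Qed.

Lemma meanZ c f : bmf f -> (\int[P]_x (c * f x) = c * \int[P]_x f x)%R.
Proof. by move=> bf; rewrite RintegralZl//; exact: bmf_integrable. Qed.

Lemma mean_cst c : (\int[P]_x c = c)%R.
Proof.
rewrite [LHS](Rintegral_cst P measurableT c).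
rewrite (_ : fine _ = 1) ?mulr1//.
exact: (congr1 fine (probability_setT P)).
Qed.

Lemma mean_le (f g : T -> R) : bmf f -> bmf g -> (forall x, f x <= g x) ->
  (\int[P]_x f x <= \int[P]_x g x)%R.
Proof. by move=> bf bg fg; apply: le_Rintegral => //; exact: bmf_integrable. Qed.

Lemma mean_norm_le (f g : T -> R) : bmf f -> bmf g -> (forall x, `|f x| <= g x) ->
  (`|\int[P]_x f x| <= \int[P]_x g x)%R.
Proof.
move=> bf bg fg; rewrite ler_norml -mulN1r -meanZ//.
apply/andP; split; apply: mean_le => //; try exact: bmfZ;
  by move=> x; have := fg x; rewrite ler_norml ?mulN1r => /andP[].
Qed.

Lemma mean_sum (I : Type) (s : seq I) (f : I -> T -> R) : (forall i, bmf (f i)) ->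
  (\int[P]_x (\sum_(i <- s) f i x) = \sum_(i <- s) \int[P]_x f i x)%R.
Proof.
move=> bf; elim: s => [|i s IH].
  by under eq_Rintegral do rewrite big_nil; rewrite mean_cst big_nil.
under eq_Rintegral do rewrite big_cons.
by rewrite meanD ?IH ?big_cons//; exact: bmf_sum.
Qed.

Lemma mean_indic A : measurable A -> ((\int[P]_x \1_A x)%R%:E = P A)%E.
Proof.
by move=> mA; rewrite -bmf_EFin ?integral_indic ?setIT//; exact: bmf_indic.
Qed.

Lemma mean_indic_fine A : measurable A -> (\int[P]_x \1_A x = fine (P A))%R.
Proof. by move=> mA; rewrite -mean_indic. Qed.

(** Markov's inequality, in product form so that nothing is asked of the sign of [tau]. *)
Lemma mean_indic_ge (f : T -> R) A tau : bmf f -> measurable A -> (forall x, 0 <= f x) ->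
  (forall x, A x -> tau <= f x) ->
  (tau%:E * P A <= (\int[P]_x f x)%R%:E)%E.
Proof.
move=> bf mA f0 fA; rewrite -mean_indic// -EFinM lee_fin -meanZ; last exact: bmf_indic.
apply: mean_le => //; first by apply: bmfZ; exact: bmf_indic.
move=> x.
rewrite indicE; case: (boolP (x \in A)) => [/[!inE]/fA|_]; rewrite ?mulr1 ?mulr0//.
Qed.

End bounded_measurable_functions.

Lemma bmf_comp {R : realType} d d' (T : measurableType d) (X : measurableType d')
    (f : T -> X) (g : X -> R) :
  measurable_fun setT f -> bmf g -> bmf (fun z => g (f z)).
Proof.
move=> mf [mg [B gB]]; split; first exact: (measurableT_comp mg mf).
by exists B => z; exact: gB.
Qed.

Section step_approximation.
Context {R : realType} {d : measure_display} {T : measurableType d}.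

(** Values are rounded up to the next multiple of [e]. Approximating from above allows products of
    nonnegative functions to be compared factor by factor. *)
Lemma step_approx (f : T -> R) (B e : R) : measurable_fun setT f ->
  (forall x, 0 <= f x <= B) -> 0 < e ->
  exists K (v : 'I_K -> R) (A : 'I_K -> set T),
    [/\ forall k, 0 <= v k, forall k, measurable (A k) &
      forall x, f x <= \sum_(k < K) v k * \1_(A k) x <= f x + e].
Proof.
move=> mf fB e0; pose K := (Num.trunc (B / e)).+1.
exists K, (fun k : 'I_K => k.+1%:R * e),
  (fun k : 'I_K => f @^-1` `[k%:R * e, k.+1%:R * e[).
split=> [k|k|x].
- by rewrite mulr_ge0// ltW.
- by rewrite -[X in measurable X]setTI; apply: mf => //; exact: measurable_itv.
have /andP[f0 fle] := fB x.
have fe0 : 0 <= f x / e by rewrite divr_ge0// ltW.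
have /andP[k1 k2] := truncn_itv fe0; set k := Num.trunc _ in k1 k2.
have kK : (k < K)%N.
  rewrite ltnS -(ler_nat R) (le_trans _ (_ : k%:R <= _))//.
  by rewrite ler_nat; apply: le_truncn; rewrite ler_pM2r ?invr_gt0.
have kx : (f @^-1` `[k%:R * e, k.+1%:R * e[) x.
  by rewrite /= in_itv/= -ler_pdivlMr// -ltr_pdivrMr// k1 k2.
rewrite (bigD1 (Ordinal kK))//= big1 => [|j jk].
  rewrite addr0 indicE mem_set// mulr1; move: kx; rewrite /= in_itv/=.
  move=> /andP[h1 h2]; rewrite (ltW h2)/= -natr1 mulrDl mul1r lerD2r//.
rewrite indicE memNset ?mulr0// => /=; rewrite in_itv/= -ler_pdivlMr// -ltr_pdivrMr//.
move=> /andP[j1 j2]; move/eqP: jk; apply; apply/val_inj => /=.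
apply/eqP; rewrite eqn_leq; apply/andP; split; rewrite -ltnS -(ltr_nat R).
  exact: le_lt_trans j1 k2.
exact: le_lt_trans k1 j2.
Qed.

End step_approximation.

(** From [expR x <= 1 / (1 - x)] and [(1 + x + 2 x^2) (1 - x) = 1 + x^2 (1 - 2 x) >= 1]. No lower
    bound on [x] enters, so exponents need only be bounded above. *)
Lemma expR_le_quadratic {R : realType} (x : R) : x <= 1 / 2 ->
  expR x <= 1 + x + 2 * x ^+ 2.
Proof.
move=> x12; have x1 : 0 < 1 - x by lra.
have h := expR_ge1Dx (- x).
have e0 := expR_gt0 x.
have : expR x * (1 - x) <= 1.
  by rewrite -[leRHS](expRxMexpNx_1 x) ler_wpM2l// ltW.
rewrite -ler_pdivlMr// => /le_trans; apply.
by rewrite ler_pdivrMr//; nra.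
Qed.

Lemma measurable_superlevel {R : realType} d (T : measurableType d) (f : T -> R) tau :
  measurable_fun setT f -> measurable [set x | tau <= f x].
Proof.
move=> mf; rewrite -[X in measurable X]setTI.
rewrite (_ : [set x | _] = f @^-1` `[tau, +oo[); first exact: mf.
by apply/seteqP; split => x /=; rewrite in_itv/= andbT.
Qed.

Section iid.
Context {R : realType} {d : measure_display} {Z : measurableType d}.
Context {dO : measure_display} {Omega : measurableType dO}.
Variables (P : probability Omega R) (Q : probability Z R).
Variables (n : nat) (Zs : 'I_n -> Omega -> Z).
Hypothesis mZs : forall i, measurable_fun setT (Zs i).
Hypothesis indep : forall B : 'I_n -> set Z, (forall i, measurable (B i)) ->
  P (\bigcap_(i in [set: 'I_n]) [set w | B i (Zs i w)]) =
  (\prod_(i < n) P [set w | B i (Zs i w)])%E.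
Hypothesis same_law : forall i B, measurable B -> P [set w | B (Zs i w)] = Q B.

Lemma bmf_comp_sample (f : Z -> R) i : bmf f -> bmf (fun w => f (Zs i w)).
Proof.
exact: bmf_comp.
Qed.

(** Replace [phi] by a step function above it and expand the product of sums: each choice of one
    level per observation gives a rectangle, to which independence applies. The slack [e] is kept in
    the bound instead of passing to the limit. *)
Lemma iid_mean_prod_le (phi : Z -> R) (B e : R) : measurable_fun setT phi ->
  (forall z, 0 <= phi z <= B) -> 0 < e ->
  (\int[P]_w (\prod_(i < n) phi (Zs i w)) <= (\int[Q]_z phi z + e) ^+ n)%R.
Proof.
move=> mphi phiB e0.
have [K [v [A [v0 mA vA]]]] := step_approx mphi phiB e0.
pose S z := \sum_(k < K) v k * \1_(A k) z.
have bS : bmf S by apply: bmf_sum => k; apply: bmfZ; exact: bmf_indic.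
have bphi : bmf phi.
  split => //; exists B => z; have /andP[p0 pB] := phiB z.
  by rewrite ger0_norm.
have S0 z : 0 <= S z.
  by apply: sumr_ge0 => k _; rewrite mulr_ge0// indicE.
have le1 : (\int[P]_w (\prod_(i < n) phi (Zs i w)) <=
            \int[P]_w (\prod_(i < n) S (Zs i w)))%R.
  apply: mean_le.
  - by apply: bmf_prod => i; exact: bmf_comp_sample.
  - by apply: bmf_prod => i; exact: bmf_comp_sample.
  - move=> w; apply: ler_prod => i _.
    by have /andP[-> _] := phiB (Zs i w); have /andP[-> _] := vA (Zs i w).
apply: (le_trans le1).
pose C (k : {ffun 'I_n -> 'I_K}) : set Omega :=
  \bigcap_(i in [set: 'I_n]) [set w | A (k i) (Zs i w)].
have mZA i k : measurable [set w | A k (Zs i w)].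
  by rewrite -[X in measurable X]setTI; exact: mZs.
have mC k : measurable (C k) by apply: fin_bigcap_measurable.
have prodS w : \prod_(i < n) S (Zs i w) =
    \sum_(k : {ffun 'I_n -> 'I_K}) (\prod_(i < n) v (k i)) * \1_(C k) w.
  rewrite /S bigA_distr_bigA/=; apply: eq_bigr => k _.
  rewrite big_split/=; congr (_ * _).
  rewrite indicE; case: (boolP (w \in C k)) => [|/negP]; rewrite inE => wC.
    by rewrite big1// => i _; rewrite indicE mem_set//; exact: wC.
  have [i wi] : exists i, ~ A (k i) (Zs i w).
    by apply/existsNP => H; apply: wC => i _; exact: H.
  by rewrite (bigD1 i)//= indicE memNset// mul0r.
under eq_Rintegral do rewrite prodS.
rewrite mean_sum; last by move=> k; apply: bmfZ; exact: bmf_indic.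
have PC k : (\int[P]_w \1_(C k) w)%R = \prod_(i < n) fine (Q (A (k i))).
  apply: EFin_inj; rewrite mean_indic//.
  apply: (etrans (indep (fun i => mA (k i)))).
  rewrite (@big_morph _ _ EFin 1%E *%E 1 *%R (fun _ _ => erefl) erefl).
  apply: eq_bigr => i _.
  apply: (etrans (same_law i (mA (k i)))).
  by apply/esym/fineK; exact: fin_num_measure.
rewrite (eq_bigr (fun k : {ffun 'I_n -> 'I_K} =>
    \prod_(i < n) (v (k i) * fine (Q (A (k i)))))); last first.
  move=> k _; rewrite meanZ; last exact: bmf_indic.
  by rewrite PC -big_split.
rewrite -(bigA_distr_bigA (fun (_ : 'I_n) k => v k * fine (Q (A k))))/=.
rewrite prodr_const card_ord.
have -> : \sum_(k < K) v k * fine (Q (A k)) = (\int[Q]_z S z)%R.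
  rewrite mean_sum => [|k]; last by apply: bmfZ; exact: bmf_indic.
  apply: eq_bigr => k _; rewrite meanZ; last exact: bmf_indic.
  by rewrite mean_indic_fine.
rewrite lerXn2r// ?nnegrE.
- exact: Rintegral_ge0.
- apply: addr_ge0; last exact: ltW.
  by apply: Rintegral_ge0 => z _; have /andP[] := phiB z.
rewrite -[X in _ + X](mean_cst Q) -meanD//; last exact: bmf_cst.
apply: mean_le => //; first by apply: bmfD => //; exact: bmf_cst.
by move=> z; have /andP[] := vA z.
Qed.

(** The summand 1 pays for the step approximation: with slack [1 / (n + 1)] in each of [n] factors,
    the total in the exponent stays below 1. *)
Lemma iid_exp_moment (g : Z -> R) (m1 m2 : R) : bmf g ->
  (forall z, g z <= 1 / 2) ->
  (\int[Q]_z g z <= m1)%R -> (\int[Q]_z (g z ^+ 2) <= m2)%R ->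
  (\int[P]_w expR (\sum_(i < n) g (Zs i w)) <=
    expR (n%:R * (m1 + 2 * m2) + 1))%R.
Proof.
move=> bg g12 gm1 gm2.
have bexp := bmf_expR bg.
have [mexp [B expB]] := bexp.
have e0 : 0 < n.+1%:R^-1 :> R by rewrite invr_gt0.
under eq_Rintegral do rewrite expR_sum.
have := @iid_mean_prod_le (fun z => expR (g z)) B _ mexp _ e0.
move=> /(_ _)/le_trans; apply => [z|].
  by rewrite expR_ge0 (le_trans (ler_norm _) (expB z)).
have b2 : bmf (fun z => g z ^+ 2) by under eq_fun do rewrite expr2; exact: bmfM.
have bg1 : bmf (fun z => 1 + g z) by apply: bmfD => //; exact: bmf_cst.
have b22 : bmf (fun z => 2 * g z ^+ 2) by exact: bmfZ.
have le1 : (\int[Q]_z expR (g z) <= 1 + m1 + 2 * m2)%R.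
  apply: (@le_trans _ _ (\int[Q]_z (1 + g z + 2 * g z ^+ 2))%R).
    apply: mean_le => //; first exact: bmfD.
    by move=> z; exact: expR_le_quadratic.
  rewrite meanD// meanD//; last exact: bmf_cst.
  by rewrite mean_cst meanZ// !lerD// ler_wpM2l.
have m0 : 0 <= (\int[Q]_z expR (g z))%R.
  by apply: Rintegral_ge0 => z _; exact: expR_ge0.
apply: (@le_trans _ _ (expR (m1 + 2 * m2 + n.+1%:R^-1) ^+ n)).
  rewrite lerXn2r ?nnegrE ?expR_ge0 ?addr_ge0 ?(ltW e0)//.
  apply: le_trans (expR_ge1Dx _); rewrite addrA lerD2r addrA.
  exact: le1.
rewrite -expRM_natl ler_expR mulrDr lerD2l ler_pdivrMr// mul1r ler_nat.
exact: leqnSn.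
Qed.

Lemma iid_chernoff (g : Z -> R) (m1 m2 tau : R) : bmf g ->
  (forall z, g z <= 1 / 2) ->
  (\int[Q]_z g z <= m1)%R -> (\int[Q]_z (g z ^+ 2) <= m2)%R ->
  (P [set w | (tau <= \sum_(i < n) g (Zs i w))%R] <=
    (expR (n%:R * (m1 + 2 * m2) + 1 - tau))%:E)%E.
Proof.
move=> bg g12 gm1 gm2.
have bsum : bmf (fun w => \sum_(i < n) g (Zs i w)).
  by apply: bmf_sum => i; exact: bmf_comp_sample.
have mE := measurable_superlevel tau bsum.1.
have f0 w : 0 <= expR (\sum_(i < n) g (Zs i w)) by exact: expR_ge0.
have fA w : [set w | tau <= \sum_(i < n) g (Zs i w)] w ->
  expR tau <= expR (\sum_(i < n) g (Zs i w)) by rewrite /= ler_expR.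
have H := mean_indic_ge P (bmf_expR bsum) mE f0 fA.
have PE := fin_num_measure P _ mE.
rewrite -(fineK PE) in H *; rewrite -EFinM !lee_fin in H *.
rewrite expRD expRN ler_pdivlMr ?expR_gt0// mulrC (le_trans H)//.
exact: iid_exp_moment.
Qed.

End iid.

Section orthogonality.
Context {R : realType} {d d' : measure_display}.
Context {T : measurableType d} {X : measurableType d'}.
Variables (P : probability T R) (f : T -> X).
Hypothesis mf : measurable_fun setT f.

(** Orthogonality to indicators extends to step functions and then, by uniform approximation, to
    bounded functions of [f]. Since [step_approx] wants nonnegative values, [phi + B] is
    approximated; the shift contributes nothing because [psi] has mean zero. *)
Lemma mean_orthogonal (psi : T -> R) (phi : X -> R) : bmf psi -> bmf phi ->
  (forall A, measurable A -> \int[P]_z (\1_A (f z) * psi z) = 0)%R ->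
  (\int[P]_z (phi (f z) * psi z) = 0)%R.
Proof.
move=> bpsi [mphi [B phiB]] orth.
have [_ [C psiC]] := bpsi.
have bcomp (g : X -> R) : bmf g -> bmf (fun z => g (f z)).
  exact: bmf_comp.
have bphi : bmf phi by split => //; exists B.
have T0 : (\int[P]_z psi z = 0)%R.
  rewrite -[RHS](orth setT measurableT).
  by apply: eq_Rintegral => z _; rewrite indicE in_setT mul1r.
apply/eqP; rewrite -normr_eq0 eq_le normr_ge0 andbT.
apply/ler_addgt0Pr => e e0; rewrite add0r.
have C1 : 0 < `|C| + 1 by rewrite ltr_wpDl.
pose e' := e / (`|C| + 1); have e'0 : 0 < e' by rewrite divr_gt0.
have mphiB : measurable_fun setT (fun x => phi x + B) by exact: measurable_funD.
have phiBb x : 0 <= phi x + B <= 2 * B.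
  by have := phiB x; rewrite ler_norml => /andP[? ?]; apply/andP; split; lra.
have [K [v [A [v0 mA vA]]]] := step_approx mphiB phiBb e'0.
pose S x := \sum_(k < K) v k * \1_(A k) x.
have bS : bmf S by apply: bmf_sum => k; apply: bmfZ; exact: bmf_indic.
have S0 : (\int[P]_z (S (f z) * psi z) = 0)%R.
  under eq_Rintegral do rewrite /S big_distrl/=.
  rewrite mean_sum => [|k].
    rewrite big1// => k _; under eq_Rintegral do rewrite -mulrA.
    rewrite meanZ ?orth ?mulr0//; apply: bmfM => //.
    by apply: (bcomp (\1_(A k))); exact: bmf_indic.
  apply: bmfM => //; apply: bmfZ.
  by apply: (bcomp (\1_(A k))); exact: bmf_indic.
have b1 : bmf (fun z => S (f z) * psi z) by apply: bmfM => //; exact: bcomp.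
have b2 : bmf (fun z => phi (f z) * psi z) by apply: bmfM => //; exact: bcomp.
have b3 : bmf (fun z => B * psi z) by exact: bmfZ.
have -> : (\int[P]_z (phi (f z) * psi z) =
    \int[P]_z (phi (f z) * psi z + B * psi z - S (f z) * psi z))%R.
  under [RHS]eq_Rintegral do rewrite -mulN1r.
  rewrite meanD; [|exact: bmfD|exact: bmfZ].
  by rewrite meanD// !meanZ// S0 T0 !mulr0 !addr0.
apply: le_trans (_ : _ <= (\int[P]_z cst e z)%R) _; last by rewrite mean_cst.
apply: mean_norm_le => [||z]; last first.
- have -> : phi (f z) * psi z + B * psi z - S (f z) * psi z =
     (phi (f z) + B - S (f z)) * psi z by ring.
  have -> : cst e z = e' * (`|C| + 1) by rewrite /e' divfK ?gt_eqF.
  rewrite normrM ler_pM//.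
    have /andP[h1 h2] := vA (f z); rewrite distrC ger0_norm ?subr_ge0//.
    by rewrite lerBlDl.
  by rewrite (le_trans (psiC z))// (le_trans (ler_norm _))// lerDl.
- exact: bmf_cst.
- by apply: bmfB => //; exact: bmfD.
Qed.

End orthogonality.

(** * The local polynomial estimator *)

Section estimator.
Context {R : realType}.

Lemma floor_beta_lt (beta : R) : 0 < beta -> (floor_beta beta)%:R < beta.
Proof.
move=> b0; rewrite /floor_beta.
have c1 : (1 <= Num.ceil beta)%R by rewrite -gtz0_ge1 ceil_gt0.
have /andP[h _] := ceil_itv beta.
by rewrite natr_absz ger0_norm// subr_ge0.
Qed.

Lemma mono_scale n k (c : R) (v : 'rV[R]_n) (s : multi_index n k) :
  mono (c *: v) s = c ^+ (\sum_i mi_deg s i)%N * mono v s.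
Proof.
rewrite /mono expr_sum -big_split/=; apply: eq_bigr => i _.
by rewrite mxE exprMn.
Qed.

Lemma taylorE n beta (g : 'rV[R]_n -> R) x x' : taylor beta g x x' =
  \sum_(s : multi_index n (floor_beta beta))
     mono (x' - x) s * (Dmulti s g x / mfact s).
Proof. by apply: eq_bigr => s _; ring. Qed.

Lemma Dmulti_zero n k (g : 'rV[R]_n -> R) x :
  Dmulti (mi_zero n k) g x / mfact (mi_zero n k) = g x.
Proof.
have d0 i : mi_deg (mi_zero n k) i = 0%N by rewrite /mi_deg /= ffunE.
rewrite /Dmulti (_ : flatten _ = [::]) => [|]; last first.
  by elim: (enum _) => //= i r ->; rewrite d0.
by rewrite /mfact big1 ?divr1// => i _; rewrite d0.
Qed.

(** With [t = |v| > 1] and [e = <v, y> / t], the squared distances differ by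
    [(t - 1) (t + 1 - 2 e)]. Nonnegativity of [|v / t - y|^2] gives [e <= 1]. *)
Lemma enorm_proj_ball d (v y : 'rV[R]_d) : enorm y <= 1 ->
  enorm (proj_ball v - y) <= enorm (v - y).
Proof.
move=> y1; rewrite /proj_ball; case: (lerP (enorm v) 1) => // v1.
set t := enorm v in v1 *; have t0 : 0 < t by exact: lt_trans v1.
pose dot := \sum_(j < d) v ord0 j * y ord0 j.
have sq (c : R) : enorm (c *: v - y) ^+ 2 =
    c ^+ 2 * t ^+ 2 - 2 * c * dot + enorm y ^+ 2.
  rewrite !sqr_enorm /dot !big_distrr/= -sumrB -big_split/=.
  by apply: eq_bigr => j _; rewrite !mxE; ring.
pose e := dot / t; have dotE : dot = e * t by rewrite /e divfK// gt_eqF.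
have sqV : enorm (t^-1 *: v - y) ^+ 2 = 1 - 2 * e + enorm y ^+ 2.
  by rewrite sq dotE; field; rewrite gt_eqF.
have sq1 : enorm (v - y) ^+ 2 = t ^+ 2 - 2 * (e * t) + enorm y ^+ 2.
  by have := sq 1; rewrite scale1r => ->; rewrite dotE; ring.
have y2 : enorm y ^+ 2 <= 1 by rewrite expr_le1// enorm_ge0.
have e1 : e <= 1 by have := sqr_ge0 (enorm (t^-1 *: v - y)); rewrite sqV; lra.
rewrite -(@ler_pXn2r _ 2) ?nnegrE ?enorm_ge0// sqV sq1.
by nra.
Qed.

Section error.
Variables (p d : nat) (beta h : R) (K : 'rV[R]_p -> R) (N : nat).
Variables (Xs : 'I_N -> 'rV[R]_p) (Ys : 'I_N -> 'rV[R]_d) (x : 'rV[R]_p).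
Hypothesis h0 : 0 < h.
Hypothesis K0 : forall u, 0 <= K u.
Let MI := multi_index p (floor_beta beta).
Let u i := h^-1 *: (Xs i - x).

(** The lower bound on the form makes the minimizer unique, so the default value of [lp_est] is
    excluded. Passing to [(X_i - x) / h] multiplies coefficient [s] by [h^|s|]; the constant
    coefficient is unchanged, and it is [f x] for the Taylor polynomial. All other coefficients are
    dropped from the error. *)
Lemma lp_est_error (lam : R) (f : 'rV[R]_p -> 'rV[R]_d) : 0 < lam ->
  (forall th : MI -> R, lam * \sum_s th s ^+ 2 <=
     \sum_i K (u i) * (\sum_s mono (u i) s * th s) ^+ 2) ->
  enorm (lp_est beta h K Xs Ys x - f x) ^+ 2 <=
  (\sum_j \sum_(s : MI) (\sum_i K (u i) * mono (u i) s *
     (Ys i ord0 j - taylor beta (fun y => f y ord0 j) x (Xs i))) ^+ 2)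
  / lam ^+ 2.
Proof.
move=> lam0 Qge.
pose g (s : MI) : R := h ^+ (\sum_i mi_deg s i)%N.
have g0 s : g s != 0 by rewrite expf_neq0// gt_eqF.
have monoE i (s : MI) : mono (Xs i - x) s = g s * mono (u i) s.
  by rewrite /u mono_scale exprVn mulrA divff ?mul1r.
have inj (c : MI -> R) : \sum_i K (u i) *
    (\sum_s mono (Xs i - x) s * c s) ^+ 2 = 0 -> forall s, c s = 0.
  move=> Q0 s; have := Qge (fun s => g s * c s).
  under [leRHS]eq_bigr do under eq_bigr do rewrite mulrA [mono _ _ * _]mulrC -monoE.
  rewrite Q0 pmulr_rle0// => le0.
  have : \sum_s (g s * c s) ^+ 2 = 0.
    by apply/eqP; rewrite eq_le le0 sumr_ge0// => t _; exact: sqr_ge0.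
  move/eqP; rewrite psumr_eq0 => [/allP/(_ s)|t _]; last exact: sqr_ge0.
  rewrite mem_index_enum => /(_ isT); rewrite sqrf_eq0 mulf_eq0.
  by rewrite (negbTE (g0 s))/= => /eqP.
have Ku i : 0 <= K (u i) by exact: K0.
have [th [thmin thneq]] := ls_unique_minimizer Ku Ys inj.
have -> : lp_est beta h K Xs Ys x = th (mi_zero p (floor_beta beta)).
  rewrite /lp_est; case: pselect => [H|[]]; last by exists th.
  suff -> : projT1 (cid H) = th by [].
  by case: (cid H) => th' [th'min _] /=; exact: thmin.2.
rewrite sqr_enorm big_distrl/=; apply: ler_sum => j _.
pose c s := g s * th s ord0 j.
pose c' s := g s * (Dmulti s (fun y => f y ord0 j) x / mfact s).
have cneq : normal_eq (fun i => K (u i)) (fun i s => mono (u i) s)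
    (fun i => Ys i ord0 j) c.
  move=> s; apply: (mulfI (g0 s)); rewrite mulr0 -[RHS](thneq j s) big_distrr/=.
  apply: eq_bigr => i _; rewrite monoE /c.
  under eq_bigr do rewrite mulrA [mono _ _ * _]mulrC -monoE.
  ring.
have VE s : \sum_i K (u i) * mono (u i) s *
      (Ys i ord0 j - \sum_t mono (u i) t * c' t) =
    \sum_i K (u i) * mono (u i) s * (Ys i ord0 j -
      taylor beta (fun y => f y ord0 j) x (Xs i)).
  apply: eq_bigr => i _; congr (_ * (_ - _)).
  by rewrite taylorE; apply: eq_bigr => t _; rewrite monoE /c'; ring.
have := normal_eq_error c' lam0 Qge cneq.
under [X in _ <= X / _]eq_bigr do rewrite VE.
apply: le_trans.
rewrite (bigD1 (mi_zero p (floor_beta beta)))//=.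
have gz : g (mi_zero p (floor_beta beta)) = 1.
  rewrite /g big1 ?expr0// => i _; by rewrite /mi_deg /= ffunE.
rewrite /c /c' gz !mul1r Dmulti_zero !mxE lerDl sumr_ge0// => s _.
exact: sqr_ge0.
Qed.

End error.

End estimator.

(** * Moments of one observation *)

(** Cauchy-Schwarz, obtained by expanding [|u / |u| - y|^2 >= 0]. *)
Lemma dot_le_enorm {R : realType} n (u y : 'rV[R]_n) : enorm y <= 1 ->
  \sum_(j < n) u ord0 j * y ord0 j <= enorm u.
Proof.
move=> y1; have [u0|u0] := leP (enorm u) 0.
  have uj j : u ord0 j = 0.
    apply/eqP; rewrite -normr_le0; exact: le_trans (coord_le_enorm u j) u0.
  by rewrite big1 ?enorm_ge0// => j _; rewrite uj mul0r.
set t := enorm u in u0 *; set dot := \sum_(j < n) _.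
pose e := dot / t; have dotE : dot = e * t by rewrite /e divfK// gt_eqF.
have sq (c : R) : enorm (c *: u - y) ^+ 2 =
    c ^+ 2 * t ^+ 2 - 2 * c * dot + enorm y ^+ 2.
  rewrite !sqr_enorm /dot !big_distrr/= -sumrB -big_split/=.
  by apply: eq_bigr => j _; rewrite !mxE; ring.
have sqV : enorm (t^-1 *: u - y) ^+ 2 = 1 - 2 * e + enorm y ^+ 2.
  by rewrite sq dotE; field; rewrite gt_eqF.
have y2 : enorm y ^+ 2 <= 1 by rewrite expr_le1// enorm_ge0.
have : e <= 1 by have := sqr_ge0 (enorm (t^-1 *: u - y)); rewrite sqV; lra.
by rewrite ler_pdivrMr// mul1r.
Qed.

Section polynomial_weight.
Context {R : realType} {p : nat}.
Variable (beta : R).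
Hypothesis beta0 : 0 < beta.

(** The moment weight of the kernel hypotheses. It dominates the square of [max 1 |v|^beta], and
    monomials of degree below [beta] are at most that maximum; so it controls any product of two
    factors among monomials and [|v|^beta]. *)
Definition weight (v : 'rV[R]_p) : R := 1 + powR (enorm v) (2 * beta).

Lemma weight_ge0 v : 0 <= weight v.
Proof. by rewrite addr_ge0// powR_ge0. Qed.

Lemma measurable_weight : measurable_fun setT weight.
Proof.
apply: measurable_funD => //.
exact: (measurableT_comp (measurable_powR (2 * beta)) (@measurable_enorm R p)).
Qed.

Let mx (v : 'rV[R]_p) : R := Num.max 1 (powR (enorm v) beta).

Let mx_ge1 v : 1 <= mx v. Proof. by rewrite le_max lexx. Qed.

Let mx_sqr v : mx v * mx v <= weight v.
Proof.
have e : powR (enorm v) (2 * beta) = powR (enorm v) beta * powR (enorm v) beta.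
  rewrite mulr_natl mulr2n powRD//.
  by rewrite gt_eqF// addr_gt0.
rewrite /weight e /mx; have := powR_ge0 (enorm v) beta.
by case: (leP 1 (powR (enorm v) beta)) => _ h; nra.
Qed.

Let mono_le_mx v (s : multi_index p (floor_beta beta)) : `|mono v s| <= mx v.
Proof.
have le1 : `|mono v s| <= enorm v ^+ (\sum_i mi_deg s i)%N.
  rewrite /mono normr_prod expr_sum; apply: ler_prod => i _.
  rewrite normr_ge0 normrX lerXn2r ?nnegrE ?enorm_ge0//.
  exact: coord_le_enorm.
apply: (le_trans le1).
have [v1|v1] := leP (enorm v) 1.
  by rewrite (le_trans _ (mx_ge1 v))// exprn_ile1// enorm_ge0.
rewrite /mx le_max; apply/orP; right.
rewrite -powR_mulrn ?enorm_ge0// ler_powR ?(ltW v1)//.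
apply: (@le_trans _ _ (floor_beta beta)%:R); last exact/ltW/floor_beta_lt.
by rewrite ler_nat; exact: (svalP s).
Qed.

Lemma mono_le_weight v (s : multi_index p (floor_beta beta)) :
  `|mono v s| <= weight v.
Proof.
apply: le_trans (mx_sqr v); apply: (le_trans (mono_le_mx v s)).
by rewrite ler_peMr// (le_trans _ (mx_ge1 v)).
Qed.

Lemma monoM_le_weight v (s t : multi_index p (floor_beta beta)) :
  `|mono v s * mono v t| <= weight v.
Proof. by apply: le_trans (mx_sqr v); rewrite normrM ler_pM. Qed.

Lemma mono_powR_le_weight v (s : multi_index p (floor_beta beta)) :
  `|mono v s| * powR (enorm v) beta <= weight v.
Proof.
by apply: le_trans (mx_sqr v); rewrite ler_pM ?powR_ge0// /mx le_max lexx orbT.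
Qed.

End polynomial_weight.

Section single_sample.
Context {R : realType} {p d : nat}.
Variables (leb : {measure set 'rV[R]_p -> \bar R}).
Variables (PXY : probability ('rV[R]_p * 'rV[R]_d)%type R).
Variables (f : 'rV[R]_p -> 'rV[R]_d) (q : 'rV[R]_p -> R) (Xc : set 'rV[R]_p).
Variables (mu_min mu_max c0 r0 : R).
Hypothesis lebP : is_lebesgue leb.
Hypothesis mu_min0 : 0 < mu_min.
Hypothesis mu_minmax : mu_min <= mu_max.
Hypothesis c00 : 0 < c0.
Hypothesis r00 : 0 < r0.
Hypothesis Y1 : PXY [set z | enorm z.2 <= 1] = 1%E.
Hypothesis mXc : measurable Xc.
Hypothesis mq : measurable_fun setT q.
Hypothesis q0 : forall x, ~ Xc x -> q x = 0.
Hypothesis qP : forall x, Xc x -> mu_min <= q x <= mu_max.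
Hypothesis density : forall A, measurable A ->
  (PXY (A `*` setT) = \int[leb]_(x in A) (q x)%:E)%E.
Hypothesis mf : measurable_fun setT f.
Hypothesis regression : forall A, measurable A -> forall j : 'I_d,
  (\int[PXY]_(z in A `*` setT) (z.2 ord0 j)%:E =
   \int[PXY]_(z in A `*` setT) (f z.1 ord0 j)%:E)%E.
Hypothesis f_continuous : forall j : 'I_d, continuous (fun y => f y ord0 j).
Hypothesis thick : forall x r, Xc x -> 0 < r <= r0 ->
  (c0%:E * leb (eball x r) <= leb (Xc `&` eball x r))%E.

Let mu_max0 : 0 < mu_max. Proof. exact: lt_le_trans mu_minmax. Qed.

Let q_ge0 x : 0 <= q x.
Proof.
have [/qP/andP[h _]|/q0 ->//] := pselect (Xc x); exact: le_trans (ltW mu_min0) h.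
Qed.

Let q_le x : q x <= mu_max.
Proof.
by have [/qP/andP[]//|/q0 ->] := pselect (Xc x); exact: ltW.
Qed.

Lemma PX_le A : measurable A -> (PXY (A `*` setT) <= mu_max%:E * leb A)%E.
Proof.
move=> mA; rewrite density// -integral_cst//.
apply: ge0_le_integral => //.
- by move=> x _; rewrite lee_fin.
- by apply/measurable_EFinP; exact: measurable_funTS.
- by move=> x _; rewrite lee_fin.
Qed.

Lemma PX_ge A : measurable A ->
  (mu_min%:E * leb (A `&` Xc) <= PXY (A `*` setT))%E.
Proof.
move=> mA; have mAX : measurable (A `&` Xc) by exact: measurableI.
rewrite density//; apply: (@le_trans _ _ (\int[leb]_(x in A `&` Xc) (q x)%:E)%E).
  rewrite -integral_cst//; apply: ge0_le_integral => //.
  - by move=> x _; rewrite lee_fin ltW.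
  - by apply/measurable_EFinP; exact: measurable_funTS.
  - by move=> x [_ /qP/andP[h _]]; rewrite lee_fin.
apply: ge0_subset_integral => //.
- by apply/measurable_EFinP; exact: measurable_funTS.
- by move=> x _; rewrite lee_fin.
Qed.

Lemma PX_support : PXY (~` Xc `*` setT) = 0%E.
Proof.
rewrite density; last exact: measurableC.
by rewrite integral0_eq// => x /q0 ->.
Qed.

(** The law of [(X - x) / h] is dominated by [mu_max * h ^ p] times Lebesgue measure, which is where
    every factor [h^p] in the moment bounds comes from. *)
Lemma mean_scaled_le (x : 'rV[R]_p) (h I : R) (g : 'rV[R]_p -> R) : 0 < h ->
  bmf g -> (forall u, 0 <= g u) -> (\int[leb]_u (g u)%:E <= I%:E)%E ->
  (\int[PXY]_z g (h^-1 *: (z.1 - x)) <= mu_max * h ^+ p * I)%R.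
Proof.
move=> h0 bg g0 gI; have [mg [B gB]] := bg.
pose phi (z : 'rV[R]_p * 'rV[R]_d) := h^-1 *: (z.1 - x).
have mphi : measurable_fun setT phi.
  exact: (measurableT_comp (measurable_affine x h^-1) measurable_fst).
have bgphi : bmf (fun z => g (phi z)) by exact: bmf_comp.
have k0 : 0 <= mu_max * h ^+ p by rewrite mulr_ge0 ?exprn_ge0// ltW.
pose m0 := (pushforward PXY phi : {measure set 'rV[R]_p -> \bar R}).
pose m1 : {measure set 'rV[R]_p -> \bar R} := m0 mphi.
pose m2 : {measure set 'rV[R]_p -> \bar R} := mscale (NngNum k0) leb.
have m12 S : measurable S -> (m1 S <= m2 S)%E.
  move=> mS; rewrite /m1 /m0 /m2 /= /pushforward /mscale/=.
  rewrite EFinM -muleA -(leb_affine lebP x h0 mS).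
  have -> : phi @^-1` S =
      ((fun y => h^-1 *: (y - x)) @^-1` S) `*` [set: 'rV[R]_d].
    by apply/seteqP; split => z //= -[].
  apply: PX_le; rewrite -[X in measurable X]setTI.
  exact: measurable_affine.
have mgE : measurable_fun setT (EFin \o g) by exact/measurable_EFinP.
rewrite -lee_fin -bmf_EFin//.
have -> : (\int[PXY]_z (g (phi z))%:E = \int[m1]_u (g u)%:E)%E.
  rewrite /m1 /m0 [RHS](@ge0_integral_pushforward _ _ _ _ _ phi mphi)//.
  by move=> u _; rewrite lee_fin.
apply: (@le_trans _ _ (\int[m2]_u (g u)%:E)%E).
  by apply: ge0_le_measure_integral => // u; rewrite lee_fin.
rewrite /m2 ge0_integral_mscale//; last by move=> u _; rewrite lee_fin.
by rewrite [leRHS]EFinM lee_wpmul2l// lee_fin.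
Qed.

Let Dy : set ('rV[R]_p * 'rV[R]_d) := [set z | enorm z.2 <= 1].

Lemma measurable_unit_response : measurable Dy.
Proof.
rewrite -[X in measurable X]setTI.
rewrite (_ : Dy = (fun z => enorm z.2) @^-1` `]-oo, 1]); last first.
  by apply/seteqP; split => y /=; rewrite in_itv.
have mc : measurable_fun setT (fun z : 'rV[R]_p * 'rV[R]_d => enorm z.2).
  exact: (measurableT_comp (@measurable_enorm R d) measurable_snd).
exact: mc.
Qed.

Lemma ae_unit_response : {ae PXY, forall z, enorm z.2 <= 1}.
Proof.
exists (~` Dy); split.
- exact: measurableC measurable_unit_response.
- by rewrite probability_setC ?Y1 ?subee//; exact: measurable_unit_response.
- by move=> z.
Qed.

(** The indicator of the unit ball equals 1 almost surely and makes the response bounded everywhere.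
    The bound [C] is local to [A] because it serves twice: near one point, in proving that [f] is at
    most 1 on the support, and afterwards on the support with [C = 1]. *)
Lemma mean_regression_residual (A : set 'rV[R]_p) (j : 'I_d) (C : R) :
  measurable A -> (forall y, A y -> `|f y ord0 j| <= C) ->
  (\int[PXY]_z (\1_A z.1 * (\1_Dy z * (z.2 ord0 j - f z.1 ord0 j))) = 0)%R.
Proof.
move=> mA fC; have mDy := measurable_unit_response.
have mAT : measurable (A `*` [set: 'rV[R]_d]) by exact: measurableX.
have my : measurable_fun setT (fun z : 'rV[R]_p * 'rV[R]_d => z.2 ord0 j).
  exact: (measurable_fun_coord j measurable_snd).
have mfj : measurable_fun setT (fun z : 'rV[R]_p * 'rV[R]_d => f z.1 ord0 j).
  exact: (measurable_fun_coord j (measurableT_comp mf measurable_fst)).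
have restr (g : 'rV[R]_p * 'rV[R]_d -> R) : measurable_fun setT g ->
    (\int[PXY]_(z in A `*` setT) (g z)%:E =
     \int[PXY]_z (\1_A z.1 * (\1_Dy z * g z))%:E)%E.
  move=> mg.
  transitivity (\int[PXY]_(z in A `*` setT) (\1_Dy z * g z)%:E)%E.
    apply: ae_eq_integral => //.
    - exact/measurable_EFinP/measurable_funTS.
    - by apply/measurable_EFinP/measurable_funTS; apply: measurable_funM.
    - apply: filterS ae_unit_response => z z1 _.
      by rewrite indicE mem_set// mul1r.
  rewrite integral_mkcond; apply: eq_integral => z _; rewrite patchE [\1_A _]indicE.
  have [zA|zA] := boolP (z.1 \in A).
    rewrite mem_set ?mul1r//; split => //; by rewrite inE in zA.
  rewrite memNset ?mul0r// => -[/= zA' _].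
  by move/negP: zA; apply; rewrite inE.
have b1A : bmf (fun z : 'rV[R]_p * 'rV[R]_d => \1_A z.1 : R).
  exact: (bmf_comp measurable_fst (bmf_indic mA)).
have bY : bmf (fun z => \1_A z.1 * (\1_Dy z * z.2 ord0 j)).
  apply: bmfM => //; split; first by apply: measurable_funM.
  exists 1 => z; rewrite indicE; case: (boolP (z \in Dy)); rewrite ?mul0r ?normr0//.
  by rewrite inE mul1r => z1; exact: le_trans (coord_le_enorm z.2 j) z1.
have bF : bmf (fun z => \1_A z.1 * (\1_Dy z * f z.1 ord0 j)).
  split.
    by apply: measurable_funM; [exact: b1A.1|apply: measurable_funM].
  exists `|C| => z; rewrite !indicE; case: (boolP (z.1 \in A)); last first.
    by rewrite mul0r normr0.
  rewrite inE mul1r => zA; case: (_ \in _); rewrite ?mul0r ?normr0// mul1r.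
  exact: le_trans (fC _ zA) (ler_norm _).
have E := regression mA j.
rewrite !restr// !bmf_EFin// in E; case: E => E.
under eq_Rintegral do rewrite !mulrBr -mulN1r.
by rewrite meanD ?meanZ//; [rewrite E mulN1r subrr|exact: bmfZ].
Qed.

(** If [F = |f x| > 1], then [<f x, f y>] stays above [F + kap] for [y] near [x], while
    [<f x, Y> <= F]. A small ball around [x] has positive probability by thickness, so the residual
    paired with [f x] would have a negative mean there instead of mean zero. *)
Lemma regression_le1 x : Xc x -> enorm (f x) <= 1.
Proof.
move=> Xx; rewrite leNgt; apply/negP => F1.
set F := enorm (f x) in F1.
pose g y := \sum_(j < d) f x ord0 j * f y ord0 j.
(* Half the gap between [g x = F^2] and the largest possible value [F] of [<f x, Y>]. *)
pose kap := (F ^+ 2 - F) / 2; have kap0 : 0 < kap by rewrite /kap; nra.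
have gx : g x = F ^+ 2 by rewrite sqr_enorm; apply: eq_bigr => j _; rewrite expr2.
have cgr (r : seq 'I_d) : (fun y => \sum_(j <- r) f x ord0 j * f y ord0 j) @ x
    --> \sum_(j <- r) f x ord0 j * f x ord0 j.
  elim: r => [|j r IH].
    rewrite big_nil (_ : (fun _ => _) = cst 0); first exact: cst_continuous.
    by apply/funext => y; rewrite big_nil.
  rewrite big_cons (_ : (fun _ => _) = fun y => f x ord0 j * f y ord0 j +
    \sum_(j <- r) f x ord0 j * f y ord0 j).
    exact: (cvgD (cvgM (@cst_continuous _ _ (f x ord0 j) x) (@f_continuous j x)) IH).
  by apply/funext => y; rewrite big_cons.
have cg : g y @[y --> x] --> g x by exact: cgr.
have near1 : \forall y \near x, F + kap < g y.
  have gap : 0 < g x - (F + kap) by rewrite gx /kap; nra.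
  have /cvgrPdist_lt/(_ _ gap) := cg.
  by apply: filterS => y /=; rewrite ltr_norml => /andP[_]; lra.
have near2 : \forall y \near x, forall j : 'I_d, `|f y ord0 j| <= `|f x ord0 j| + 1.
  apply: (@filter_forall _ _ (fun j : 'I_d => [set y | `|f y ord0 j| <=
    `|f x ord0 j| + 1]) (nbhs x)) => j.
  have /cvgrPdist_lt/(_ 1 ltr01) := @f_continuous j x.
  apply: filterS => y /= h; rewrite -lerBlDl.
  by rewrite (le_trans (lerB_dist _ _))// distrC ltW.
have near12 : nbhs x [set y | F + kap < g y /\
    forall j : 'I_d, `|f y ord0 j| <= `|f x ord0 j| + 1].
  exact: filterI near1 near2.
have [e /= e0 eP] := proj1 (nbhs_ballP x _) near12.
(* Halved because [eball] is closed and [ball] open; capped at [r0] for the thickness condition. *)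
pose r := Num.min (e / 2) r0.
have r'0 : 0 < r by rewrite lt_min r00 divr_gt0.
have rr0 : r <= r0 by rewrite ge_min lexx orbT.
have sub y : eball x r y -> ball x e y.
  move=> yr; split=> // i j; rewrite (ord1 i) /ball/= distrC.
  have := coord_le_enorm (y - x) j; rewrite !mxE => /le_lt_trans; apply.
  apply: (le_lt_trans yr); rewrite (@le_lt_trans _ _ (e / 2)) ?ge_min ?lexx//.
  by rewrite ltr_pdivrMr// ltr_pMr// ltr1n.
set A := eball x r.
have mA : measurable A by exact: measurable_eball.
have mDy := measurable_unit_response.
have PA0 : (0 < PXY (A `*` setT))%E.
  apply: lt_le_trans (PX_ge mA); rewrite mule_gt0 ?lte_fin//.
  rewrite setIC; apply: lt_le_trans (thick Xx _); last by rewrite r'0.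
  by rewrite mule_gt0 ?lte_fin// leb_eball_gt0.
have mAT : measurable (A `*` [set: 'rV[R]_d]) by exact: measurableX.
have resid j : (\int[PXY]_z (\1_A z.1 *
    (\1_Dy z * (z.2 ord0 j - f z.1 ord0 j))) = 0)%R.
  apply: (mean_regression_residual (C := `|f x ord0 j| + 1)) => // y /sub/eP[_].
  exact.
have b1A : bmf (fun z : 'rV[R]_p * 'rV[R]_d => \1_A z.1 : R).
  exact: (bmf_comp measurable_fst (bmf_indic mA)).
have bres j : bmf (fun z : 'rV[R]_p * 'rV[R]_d => \1_A z.1 *
    (\1_Dy z * (z.2 ord0 j - f z.1 ord0 j)) : R).
  split.
    apply: measurable_funM; first exact: b1A.1.
    apply: measurable_funM => //; apply: measurable_funB.
      exact: (measurable_fun_coord j measurable_snd).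
    exact: (measurable_fun_coord j (measurableT_comp mf measurable_fst)).
  exists (1 + (`|f x ord0 j| + 1)) => z; rewrite !indicE.
  case: (boolP (z.1 \in A)); last by rewrite mul0r normr0 !addr_ge0.
  case: (boolP (z \in Dy)); last by rewrite mul0r mulr0 normr0 !addr_ge0.
  rewrite !inE !mul1r => z1 /sub/eP[_ /(_ j) fz].
  rewrite (le_trans (ler_normB _ _))// lerD//.
  exact: le_trans (coord_le_enorm z.2 j) z1.
have mADy : measurable ((A `*` [set: 'rV[R]_d]) `&` Dy) by exact: measurableI.
have : (\int[PXY]_z (\sum_(j < d) f x ord0 j * (\1_A z.1 *
    (\1_Dy z * (z.2 ord0 j - f z.1 ord0 j)))) <=
    \int[PXY]_z ((- kap) * \1_((A `*` [set: 'rV[R]_d]) `&` Dy) z))%R.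
  apply: mean_le.
  - by apply: bmf_sum => j; exact: bmfZ.
  - by apply: bmfZ; exact: bmf_indic.
  move=> z; have [zA|zA] := pselect (A z.1); last first.
    rewrite big1 => [|j _]; last by rewrite indicE memNset// mul0r mulr0.
    by rewrite indicE memNset ?mulr0// => -[[]].
  have [z1|z1] := pselect (Dy z); last first.
    rewrite big1 => [|j _]; last by rewrite [\1_Dy z]indicE memNset// !(mul0r, mulr0).
    by rewrite indicE memNset ?mulr0// => -[].
  rewrite [\1_(_ `&` _) z]indicE mem_set ?mulr1//.
  under eq_bigr do rewrite !indicE !mem_set// !mul1r mulrBr.
  rewrite sumrB -/(g z.1).
  have /sub/eP[/= gz _] := zA.
  have := dot_le_enorm (f x) z1; rewrite -/F => dF.
  by rewrite lerBlDr (le_trans dF)// addrC lerBrDr ltW.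
rewrite mean_sum => [|j]; last exact: bmfZ.
rewrite big1 => [|j _]; last by rewrite meanZ// resid mulr0.
rewrite meanZ; last exact: bmf_indic.
rewrite mulNr oppr_ge0 pmulr_rle0// mean_indic_fine//.
have -> : PXY ((A `*` [set: 'rV[R]_d]) `&` Dy) = PXY (A `*` setT).
  have DyC0 : PXY (~` Dy) = 0%E by rewrite probability_setC// Y1 subee.
  rewrite -[in RHS](setIT (A `*` _)) -(setUv Dy) setIUr measureU//.
  - rewrite [X in (_ + X)%E](_ : _ = 0%E) ?adde0//.
    apply: (@subset_measure0 _ _ _ _ _ (~` Dy)) => //.
      by apply: measurableI => //; exact: measurableC.
    exact: measurableC.
  - by apply: measurableI => //; exact: measurableC.
  - by rewrite setIACA setICr setI0.
by apply/negP; rewrite -ltNge fine_gt0// PA0 ltey_eq fin_num_measure.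
Qed.

End single_sample.

Lemma enormB {R : realType} n (v w : 'rV[R]_n) : enorm (v - w) = enorm (w - v).
Proof.
rewrite /enorm; congr Num.sqrt; apply: eq_bigr => i _; rewrite !mxE.
by rewrite -sqrrN opprB.
Qed.

(** * Moments of the scores *)

Section score.
Context {R : realType} {p d : nat}.
Variables (PXY : probability ('rV[R]_p * 'rV[R]_d)%type R).
Variables (f : 'rV[R]_p -> 'rV[R]_d) (Xc : set 'rV[R]_p) (K : 'rV[R]_p -> R).
Variables (beta L h B mG : R) (x : 'rV[R]_p).
Hypothesis beta0 : 0 < beta.
Hypothesis L0 : 0 < L.
Hypothesis h0 : 0 < h.
Hypothesis h1 : h <= 1.
Hypothesis mXc : measurable Xc.
Hypothesis mK : measurable_fun setT K.
Hypothesis K0 : forall u, 0 <= K u.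
Hypothesis KB : forall u, weight beta u * K u <= B.
Hypothesis mf : measurable_fun setT f.
Hypothesis f_le1 : forall y, Xc y -> enorm (f y) <= 1.
Hypothesis f_holder : holder_vec beta L f.
Hypothesis residual0 : forall A (j : 'I_d), measurable A -> A `<=` Xc ->
  (\int[PXY]_z (\1_A z.1 * (\1_[set z | enorm z.2 <= 1] z *
     (z.2 ord0 j - f z.1 ord0 j))) = 0)%R.
Let u (z : 'rV[R]_p * 'rV[R]_d) : 'rV[R]_p := h^-1 *: (z.1 - x).
Hypothesis mean_weight : (\int[PXY]_z (weight beta (u z) * K (u z)) <= mG)%R.

Let MI := multi_index p (floor_beta beta).

Definition admissible : set ('rV[R]_p * 'rV[R]_d) :=
  [set z | Xc z.1 /\ enorm z.2 <= 1].

(** The truncation to [admissible] has full probability and makes the response and the regression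
    function bounded by 1. The residual is taken from the Taylor polynomial at [x], as the error
    bound for least squares requires. *)
Definition score (j : 'I_d) (s : MI) (z : 'rV[R]_p * 'rV[R]_d) : R :=
  \1_admissible z * (K (h^-1 *: (z.1 - x)) * mono (h^-1 *: (z.1 - x)) s *
    (z.2 ord0 j - taylor beta (fun y => f y ord0 j) x z.1)).

Let mu : measurable_fun setT u.
Proof. exact: (measurableT_comp (measurable_affine x h^-1) measurable_fst). Qed.

Lemma measurable_admissible : measurable admissible.
Proof.
rewrite (_ : admissible = (Xc `*` setT) `&` [set z | enorm z.2 <= 1]).
  by apply: measurableI; [exact: measurableX|exact: measurable_unit_response].
by apply/seteqP; split => z /= [? ?]; intuition.
Qed.

Let bG : bmf (fun z => weight beta (u z) * K (u z)).
Proof.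
apply: (bmf_comp (g := fun v => weight beta v * K v) mu); split.
  by apply: measurable_funM => //; exact: measurable_weight.
exists B => v; rewrite ger0_norm ?KB//.
by rewrite mulr_ge0// weight_ge0.
Qed.

Let G0 z : 0 <= weight beta (u z) * K (u z).
Proof. by rewrite mulr_ge0// weight_ge0. Qed.

Let measurable_monou (s : MI) : measurable_fun setT (fun z => mono (u z) s).
Proof. exact: (measurableT_comp (measurable_mono s) mu). Qed.

Let my (j : 'I_d) :
  measurable_fun setT (fun z : 'rV[R]_p * 'rV[R]_d => z.2 ord0 j).
Proof. exact: (measurable_fun_coord j measurable_snd). Qed.

Let mfj (j : 'I_d) :
  measurable_fun setT (fun z : 'rV[R]_p * 'rV[R]_d => f z.1 ord0 j).
Proof. exact: (measurable_fun_coord j (measurableT_comp mf measurable_fst)). Qed.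

Let mtaylor (j : 'I_d) : measurable_fun setT
  (fun z : 'rV[R]_p * 'rV[R]_d => taylor beta (fun y => f y ord0 j) x z.1).
Proof.
rewrite (_ : (fun _ => _) = fun z => \sum_(s : MI) h ^+ (\sum_i mi_deg s i)%N *
    mono (u z) s * (Dmulti s (fun y => f y ord0 j) x / mfact s)); last first.
  apply/funext => z; rewrite taylorE; apply: eq_bigr => s _.
  by rewrite /u mono_scale exprVn mulVKf// expf_neq0// gt_eqF.
apply: measurable_sum => s; apply: measurable_funM => //.
exact: measurable_funM.
Qed.

Let remainder (j : 'I_d) z :
  `|f z.1 ord0 j - taylor beta (fun y => f y ord0 j) x z.1| <=
  L * powR h beta * powR (enorm (u z)) beta.
Proof.
have [_ H] := f_holder j; apply: (le_trans (H x z.1)).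
rewrite -mulrA ler_wpM2l ?(ltW L0)// -powRM ?(ltW h0) ?enorm_ge0//.
by rewrite -enormZ ?(ltW h0)// /u scalerA divff ?gt_eqF// scale1r enormB.
Qed.

Let powRh1 : powR h beta <= 1.
Proof.
have -> : 1 = powR 1 beta by rewrite powR1.
by rewrite ge0_ler_powR ?nnegrE ?(ltW h0) ?(ltW beta0).
Qed.

(** Split the residual at [f]: the noise is at most 2 on admissible points and the Taylor remainder
    at most [L |u|^beta], since [h <= 1]. The weight covers the monomial times either part. *)
Lemma score_le j s z : `|score j s z| <= (2 + L) * (weight beta (u z) * K (u z)).
Proof.
rewrite /score indicE; case: (boolP (z \in admissible)); last first.
  by rewrite mul0r normr0 mulr_ge0// addr_ge0// ltW.
rewrite inE mul1r -/(u z) => -[zX z1].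
have Y2 : `|z.2 ord0 j - f z.1 ord0 j| <= 2.
  rewrite (le_trans (ler_normB _ _))// -[leRHS]/(1 + 1) lerD//.
    exact: le_trans (coord_le_enorm _ _) z1.
  exact: le_trans (coord_le_enorm _ _) (f_le1 zX).
have split : `|z.2 ord0 j - taylor beta (fun y => f y ord0 j) x z.1| <=
    2 + L * powR (enorm (u z)) beta.
  rewrite -(subrKA (f z.1 ord0 j)) (le_trans (ler_normD _ _))// lerD//.
  apply: (le_trans (remainder j z)); rewrite ler_wpM2r ?powR_ge0//.
  by rewrite -[leRHS]mulr1 ler_wpM2l// ltW.
rewrite !normrM (ger0_norm (K0 _)).
apply: (@le_trans _ _ (K (u z) * `|mono (u z) s| * (2 + L * powR (enorm (u z)) beta))).
  by rewrite ler_wpM2l// mulr_ge0.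
have w1 := mono_le_weight beta0 (u z) s.
have w2 := mono_powR_le_weight beta0 (u z) s.
rewrite (_ : _ * _ * _ = K (u z) * (2 * `|mono (u z) s| +
    L * (`|mono (u z) s| * powR (enorm (u z)) beta))); last by ring.
rewrite (_ : (2 + L) * _ = K (u z) * (2 * weight beta (u z) +
    L * weight beta (u z))); last by ring.
rewrite ler_wpM2l// lerD// ler_wpM2l//; exact: ltW.
Qed.

Lemma score_bmf j s : bmf (score j s).
Proof.
apply: (bmf_dominated _ (bmfZ (2 + L) bG)) => [|z].
  apply: measurable_funM; first exact: measurable_indic measurable_admissible.
  apply: measurable_funM; last exact: measurable_funB.
  by apply: measurable_funM => //; exact: (measurableT_comp mK mu).
rewrite (le_trans (score_le j s z))// ler_norm//.
Qed.

Lemma score_bound j s z : `|score j s z| <= (2 + L) * B.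
Proof.
by rewrite (le_trans (score_le j s z))// ler_wpM2l// addr_ge0// ltW.
Qed.

(** The noise part is a function of [X] times a residual orthogonal to all such functions, so only
    the Taylor remainder, of order [h^beta], contributes. *)
Lemma score_mean j s :
  (`|\int[PXY]_z score j s z| <= L * powR h beta * mG)%R.
Proof.
have mAd := measurable_admissible.
have mDy := @measurable_unit_response R p d.
pose psi z := \1_admissible z * (z.2 ord0 j - f z.1 ord0 j).
have bpsi : bmf psi.
  split.
    apply: measurable_funM; last exact: measurable_funB.
    exact: measurable_indic mAd.
  exists 2 => z; rewrite /psi indicE; case: (boolP (z \in admissible)) => [|_].
    rewrite inE mul1r => -[zX z1].
    rewrite (le_trans (ler_normB _ _))// -[leRHS]/(1 + 1) lerD//.
      exact: le_trans (coord_le_enorm _ _) z1.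
    exact: le_trans (coord_le_enorm _ _) (f_le1 zX).
  by rewrite mul0r normr0.
pose phi (y : 'rV[R]_p) := K (h^-1 *: (y - x)) * mono (h^-1 *: (y - x)) s.
have bphi : bmf phi.
  apply: (bmf_comp (g := fun v => K v * mono v s) (measurable_affine x h^-1)).
  split; first by apply: measurable_funM => //; exact: measurable_mono.
  exists B => v; rewrite normrM (ger0_norm (K0 _)) (le_trans _ (KB v))// mulrC.
  by rewrite ler_wpM2r// mono_le_weight.
have phipsi0 : (\int[PXY]_z (phi z.1 * psi z) = 0)%R.
  apply: (mean_orthogonal measurable_fst bpsi bphi) => A mA.
  rewrite -[RHS](@residual0 (A `&` Xc) j) ?subIsetr//; last exact: measurableI.
  apply: eq_Rintegral => z _; rewrite /psi mulrA [in RHS]mulrA; congr (_ * _).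
  rewrite !indicE -!natrM; congr (_%:R).
  rewrite !mulnb; congr nat_of_bool.
  apply/andP/andP => -[]; rewrite !inE /=.
    by move=> ? [? ?].
  by move=> [? ?] ?.
pose rem z := \1_admissible z * (phi z.1 *
  (f z.1 ord0 j - taylor beta (fun y => f y ord0 j) x z.1)).
have scoreE z : score j s z = phi z.1 * psi z + rem z.
  by rewrite /score /psi /rem /phi; ring.
have bpp : bmf (fun z => phi z.1 * psi z).
  by apply: bmfM => //; exact: (bmf_comp measurable_fst bphi).
have brem : bmf rem.
  rewrite (_ : rem = fun z => score j s z - phi z.1 * psi z).
    by apply: bmfB => //; exact: score_bmf.
  by apply/funext => z; rewrite scoreE addrC addKr.
under eq_Rintegral do rewrite scoreE.
rewrite meanD// phipsi0 add0r.
apply: (@le_trans _ _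
  (\int[PXY]_z (L * powR h beta * (weight beta (u z) * K (u z))))%R).
  apply: mean_norm_le => //; first exact: bmfZ.
  move=> z; rewrite /rem indicE.
  have Lh0 : 0 <= L * powR h beta by rewrite mulr_ge0 ?powR_ge0// ltW.
  case: (boolP (z \in admissible)); last by rewrite mul0r normr0 mulr_ge0.
  move=> _; rewrite mul1r !normrM (ger0_norm (K0 _)) -/(u z).
  apply: (@le_trans _ _ (K (u z) * `|mono (u z) s| *
      (L * powR h beta * powR (enorm (u z)) beta))).
    by rewrite ler_wpM2l ?mulr_ge0//; exact: remainder.
  rewrite (_ : _ * _ * _ = L * powR h beta * (K (u z) *
    (`|mono (u z) s| * powR (enorm (u z)) beta))); last by ring.
  rewrite ler_wpM2l// mulrC ler_wpM2r//.
  exact: mono_powR_le_weight.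
rewrite meanZ// ler_wpM2l// mulr_ge0 ?powR_ge0//; exact: ltW.
Qed.

(** One factor is bounded by its supremum, the other is integrated; this keeps a single power of
    [h^p] inside [mG]. *)
Lemma score_second_moment j s : 0 <= B ->
  (\int[PXY]_z (score j s z ^+ 2) <= (2 + L) ^+ 2 * B * mG)%R.
Proof.
move=> B0; have c0 : 0 <= 2 + L by rewrite addr_ge0// ltW.
apply: (@le_trans _ _
  (\int[PXY]_z ((2 + L) ^+ 2 * B * (weight beta (u z) * K (u z))))%R).
  apply: mean_le.
  - by under eq_fun do rewrite expr2; apply: bmfM; exact: score_bmf.
  - exact: bmfZ.
  move=> z; rewrite -[leLHS]real_normK ?num_real// expr2.
  rewrite (_ : _ * _ * _ = ((2 + L) * B) *
    ((2 + L) * (weight beta (u z) * K (u z)))); last by ring.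
  by rewrite ler_pM// ?score_bound// score_le.
by rewrite meanZ// ler_wpM2l// mulr_ge0// sqr_ge0.
Qed.

End score.

(** * Deviation events *)

Section deviation.
Context {R : realType} {d : measure_display} {Z : measurableType d}.
Context {dO : measure_display} {Omega : measurableType dO}.
Variables (P : probability Omega R) (Q : probability Z R).
Variables (n : nat) (Zs : 'I_n -> Omega -> Z).
Hypothesis mZs : forall i, measurable_fun setT (Zs i).
Hypothesis indep : forall B : 'I_n -> set Z, (forall i, measurable (B i)) ->
  P (\bigcap_(i in [set: 'I_n]) [set w | B i (Zs i w)]) =
  (\prod_(i < n) P [set w | B i (Zs i w)])%E.
Hypothesis same_law : forall i B, measurable B -> P [set w | B (Zs i w)] = Q B.

Lemma iid_deviation (g : Z -> R) (Dg V t r : R) : bmf g ->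
  (forall z, `|g z| <= Dg) -> (\int[Q]_z (g z ^+ 2) <= V)%R ->
  0 < t -> t * Dg <= 1 / 2 ->
  (P [set w | (n%:R * \int[Q]_z g z + r <= \sum_(i < n) g (Zs i w))%R] <=
   (expR (2 * n%:R * t ^+ 2 * V + 1 - t * r))%:E)%E.
Proof.
move=> bg gD gV t0 tD.
have b2 : bmf (fun z => g z ^+ 2) by under eq_fun do rewrite expr2; exact: bmfM.
have g12 z : t * g z <= 1 / 2.
  apply: le_trans tD; rewrite ler_wpM2l ?(ltW t0)//.
  exact: le_trans (ler_norm _) (gD z).
have m1 : (\int[Q]_z (t * g z) <= t * \int[Q]_z g z)%R by rewrite meanZ.
have m2 : (\int[Q]_z ((t * g z) ^+ 2) <= t ^+ 2 * V)%R.
  under eq_Rintegral do rewrite exprMn.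
  by rewrite meanZ// ler_wpM2l// sqr_ge0.
have := iid_chernoff mZs indep same_law (t * (n%:R * \int[Q]_z g z + r)%R)
  (bmfZ t bg) g12 m1 m2.
set m := (\int[Q]_z g z)%R.
rewrite (_ : [set w | _] = [set w | n%:R * m + r <= \sum_(i < n) g (Zs i w)]).
  move=> /le_trans; apply; rewrite lee_fin ler_expR.
  by rewrite le_eqVlt; apply/orP; left; apply/eqP; ring.
by apply/seteqP; split => w /=; rewrite -big_distrr/= ler_pM2l.
Qed.

End deviation.

(** [E] is the set where the indicators sum to at least 1, so the estimate is Markov's
    inequality. *)
Lemma union_bound {R : realType} d (T : measurableType d) (P : probability T R)
    (I : finType) (B : I -> set T) (b : R) :
  (forall i, measurable (B i)) -> (forall i, (P (B i) <= b%:E)%E) ->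
  exists E, [/\ measurable E, forall i, B i `<=` E &
    (P E <= (#|I|%:R * b)%:E)%E].
Proof.
move=> mB Bb; pose S w : R := \sum_i \1_(B i) w.
have bS : bmf S by apply: bmf_sum => i; exact: bmf_indic.
have mE := measurable_superlevel 1 bS.1.
exists [set w | 1 <= S w]; split => // [i w Biw|].
  rewrite /= /S (bigD1 i)// indicE mem_set// lerDl.
  by rewrite sumr_ge0.
have S0 w : 0 <= S w by apply: sumr_ge0 => i _; rewrite indicE.
have := mean_indic_ge P bS mE S0 (fun w h => h).
rewrite mul1e => /le_trans; apply; rewrite lee_fin /S mean_sum; last first.
  by move=> i; exact: bmf_indic.
rewrite mulr_natl -sumr_const; apply: ler_sum => i _.
by rewrite -lee_fin mean_indic.
Qed.

(* Convexity replaces a union bound over the coordinates: a large quadratic mean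
   forces a large mean of the exponentials, at a cost free of [#|J|]. *)
Lemma exp_average {R : realType} (J : finType) (y : J -> R) (c s : R) :
  0 < c -> 1 <= s -> #|J|%:R <= \sum_k y k ^+ 2 ->
  #|J|%:R / 2 * expR (c * s / 2) <=
  (1 / 2 + 4 / c ^+ 2) * \sum_k (expR (c * s * y k) + expR (- (c * s * y k))).
Proof.
move=> c0 s1 Jle; set C := 1 / 2 + _.
have c20 : 0 < c ^+ 2 by rewrite exprn_gt0.
have C0 : 0 < C by rewrite /C addr_gt0// divr_gt0.
have cs0 : 0 <= c * s by rewrite mulr_ge0// ltW// (lt_le_trans ltr01).
(* The offset 1/2 leaves [#|J| / 2] after summation and produces the factor [expR (- (c * s / 2))].
   Since [s >= 1], the quadratic is compared with [expR (c * t)], and the constant depends on [c]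
   alone. *)
have main (z : R) : 0 <= z -> z ^+ 2 - 1 / 2 <= C * expR (c * s * (z - 1 / 2)).
  move=> z0; have [zlt|zge] := ltP z (1 / 2).
    apply: (@le_trans _ _ 0); first by nra.
    by rewrite mulr_ge0 ?expR_ge0// ltW.
  set t := z - 1 / 2; have t0 : 0 <= t by rewrite subr_ge0.
  have le1 : expR (c * t) <= expR (c * s * t).
    by rewrite ler_expR ler_wpM2r// ler_peMr// ltW.
  have le2 : 1 + (c * t) ^+ 2 / 2 <= expR (c * t).
    have := @expR_ge1Dxn R (c * t) 1; rewrite mulr_ge0 ?(ltW c0)//.
    exact.
  apply: (@le_trans _ _ (C * (1 + (c * t) ^+ 2 / 2))); last first.
    by rewrite ler_wpM2l ?(ltW C0)// (le_trans le2).
  have -> : C * (1 + (c * t) ^+ 2 / 2) =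
      1 / 2 + 4 / c ^+ 2 + (c * t) ^+ 2 / 4 + 2 * t ^+ 2.
    by rewrite /C; field; rewrite gt_eqF.
  have h1 : 0 <= 4 / c ^+ 2 by rewrite divr_ge0// ltW.
  have h2 : 0 <= (c * t) ^+ 2 / 4 by rewrite divr_ge0// sqr_ge0.
  have -> : z = t + 1 / 2 by rewrite /t; ring.
  by have := sqr_ge0 (t - 1 / 2); nra.
have each k : y k ^+ 2 - 1 / 2 <= C * expR (- (c * s / 2)) *
    (expR (c * s * y k) + expR (- (c * s * y k))).
  have := main `|y k| (normr_ge0 _); rewrite real_normK ?num_real//.
  move=> /le_trans; apply; rewrite -(mulrA C) ler_wpM2l ?(ltW C0)//.
  have -> : c * s * (`|y k| - 1 / 2) = - (c * s / 2) + c * s * `|y k| by ring.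
  rewrite expRD ler_wpM2l ?expR_ge0//.
  have [yk|yk] := leP 0 (y k).
    by rewrite ger0_norm// lerDl expR_ge0.
  by rewrite ltr0_norm// mulrN lerDr expR_ge0.
have : \sum_k (y k ^+ 2 - 1 / 2) <= \sum_k (C * expR (- (c * s / 2)) *
    (expR (c * s * y k) + expR (- (c * s * y k)))).
  by apply: ler_sum => k _; exact: each.
rewrite sumrB sumr_const -big_distrr/= => H.
have {}H : #|J|%:R / 2 <= C * expR (- (c * s / 2)) *
    \sum_k (expR (c * s * y k) + expR (- (c * s * y k))).
  apply: le_trans H; rewrite -[X in _ <= _ - X]mulr_natr.
  have -> : (1 / 2 : R) * #|J|%:R = #|J|%:R / 2 by ring.
  by rewrite lerBrDr; lra.
have := ler_wpM2r (expR_ge0 (c * s / 2)) H.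
move=> /le_trans; apply.
set S := \sum_k _; set a := c * s / 2.
have -> : C * expR (- a) * S * expR a = C * S * (expR a * expR (- a)) by ring.
by rewrite expRxMexpNx_1 mulr1.
Qed.

(** * Lower bound for the Gram form *)

Section gram.
Context {R : realType} {p d : nat}.
Variables (PXY : probability ('rV[R]_p * 'rV[R]_d)%type R).
Variables (beta h c1 : R) (x : 'rV[R]_p).
Hypothesis beta0 : 0 < beta.
Hypothesis c10 : 0 < c1.
Let u (z : 'rV[R]_p * 'rV[R]_d) : 'rV[R]_p := h^-1 *: (z.1 - x).
Let MI := multi_index p (floor_beta beta).

(** The kernel is replaced by the indicator of a ball on which it is at least a positive constant:
    only a lower bound on the form is wanted, and the entries become bounded. *)
Definition gram (s t : MI) (z : 'rV[R]_p * 'rV[R]_d) : R :=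
  \1_(eball 0 c1) (h^-1 *: (z.1 - x)) *
  (mono (h^-1 *: (z.1 - x)) s * mono (h^-1 *: (z.1 - x)) t).

Definition gram_max : R := 1 + powR c1 (2 * beta).

Let mu : measurable_fun setT u.
Proof. exact: (measurableT_comp (measurable_affine x h^-1) measurable_fst). Qed.

Lemma gram_max_gt0 : 0 < gram_max.
Proof. by rewrite ltr_wpDr// powR_ge0. Qed.

Lemma gram_le s t z : `|gram s t z| <= gram_max * \1_(eball 0 c1) (u z).
Proof.
rewrite /gram -/(u z) normrM mulrC indicE; case: (boolP (u z \in _)); last first.
  by rewrite normr0 !mulr0.
rewrite inE normr1 !mulr1 /eball/= subr0 => uc.
apply: (le_trans (monoM_le_weight beta0 (u z) s t)).
rewrite lerD2l ge0_ler_powR ?nnegrE ?enorm_ge0 ?(ltW c10)//.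
by rewrite mulr_ge0// ltW.
Qed.

Lemma gram_bound s t z : `|gram s t z| <= gram_max.
Proof.
rewrite (le_trans (gram_le s t z))// ler_piMr ?(ltW gram_max_gt0)//.
Qed.

Lemma gram_bmf s t : bmf (gram s t).
Proof.
split; last by exists gram_max => z; exact: gram_bound.
apply: measurable_funM.
  exact: (bmf_comp mu (bmf_indic (measurable_eball 0 c1))).1.
by apply: measurable_funM; exact: (measurableT_comp (measurable_mono _) mu).
Qed.

Lemma gram_second_moment s t (v : R) :
  (\int[PXY]_z \1_(eball 0 c1) (u z) <= v)%R ->
  (\int[PXY]_z (gram s t z ^+ 2) <= gram_max ^+ 2 * v)%R.
Proof.
move=> vP.
have bi : bmf (fun z => \1_(eball 0 c1) (u z) : R).
  by apply: (bmf_comp mu); apply: bmf_indic; exact: measurable_eball.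
apply: (@le_trans _ _
  (\int[PXY]_z (gram_max ^+ 2 * \1_(eball 0 c1) (u z)))%R).
  apply: mean_le.
  - by under eq_fun do rewrite expr2; apply: bmfM; exact: gram_bmf.
  - exact: bmfZ.
  move=> z; rewrite -[leLHS]real_normK ?num_real// !expr2 -mulrA.
  by rewrite ler_pM// ?gram_bound// gram_le.
by rewrite meanZ// ler_wpM2l// sqr_ge0.
Qed.

Lemma gram_quadratic (th : MI -> R) z :
  \sum_s \sum_t th s * th t * gram s t z =
  \1_(eball 0 c1) (u z) * (\sum_s mono (u z) s * th s) ^+ 2.
Proof.
rewrite expr2 big_distrl/= big_distrr/=; apply: eq_bigr => s _.
rewrite !big_distrr/=; apply: eq_bigr => t _; rewrite /gram; ring.
Qed.

(** Divide by the largest coefficient [tau]. The polynomial exceeds [eta * tau] in modulus with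
    probability at least [kappa], and the sum of squares is at most [tau^2] times the number of
    monomials. *)
Lemma gram_lower_bound (eta kappa : R) (th : MI -> R) : 0 < eta -> 0 <= kappa ->
  (forall th' : MI -> R, (exists s, 1 <= `|th' s|) -> (kappa%:E <=
     PXY [set z | eball 0 c1 (u z) /\
       (eta < `|\sum_s th' s * mono (u z) s|)%R])%E) ->
  eta ^+ 2 * kappa / #|{: MI}|%:R * (\sum_s th s ^+ 2) <=
  \sum_s \sum_t th s * th t * (\int[PXY]_z gram s t z)%R.
Proof.
move=> eta0 kappa0 kP.
pose s0 := [arg max_(s > mi_zero p (floor_beta beta)) `|th s|]%O.
have s0max s : `|th s| <= `|th s0|.
  by rewrite /s0; case: arg_maxP => // i _ H; exact: H.
have M0 : 0 < #|{: MI}|%:R :> R.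
  by rewrite ltr0n; apply/card_gt0P; exists (mi_zero p (floor_beta beta)).
set tau := `|th s0| in s0max.
have tau_ge0 : 0 <= tau by exact: normr_ge0.
have Qint : \sum_s \sum_t th s * th t * (\int[PXY]_z gram s t z)%R =
    (\int[PXY]_z (\1_(eball 0 c1) (u z) *
      (\sum_s mono (u z) s * th s) ^+ 2))%R.
  under [RHS]eq_Rintegral do rewrite -gram_quadratic.
  rewrite mean_sum => [|s]; last first.
    by apply: bmf_sum => t; apply: bmfZ; exact: gram_bmf.
  apply: eq_bigr => s _; rewrite mean_sum => [|t]; last first.
    by apply: bmfZ; exact: gram_bmf.
  by apply: eq_bigr => t _; rewrite meanZ//; exact: gram_bmf.
have sumle : \sum_s th s ^+ 2 <= #|{: MI}|%:R * tau ^+ 2.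
  rewrite mulr_natl -sumr_const; apply: ler_sum => s _.
  by rewrite -[leLHS]real_normK ?num_real// lerXn2r ?nnegrE//.
apply: (@le_trans _ _ (eta ^+ 2 * kappa * tau ^+ 2)).
  have k0 : 0 <= eta ^+ 2 * kappa by rewrite mulr_ge0// sqr_ge0.
  set T := \sum_s _ in sumle *.
  rewrite [leLHS](_ : _ = eta ^+ 2 * kappa * (T / #|{: MI}|%:R)); last by ring.
  by rewrite ler_wpM2l// ler_pdivrMr// mulrC.
rewrite Qint.
have [tau0|tau_neq0] := eqVneq tau 0.
  rewrite tau0 expr0n/= mulr0; apply: Rintegral_ge0 => z _.
  by rewrite mulr_ge0 ?sqr_ge0// indicE.
have tau0 : 0 < tau by rewrite lt0r tau_neq0 normr_ge0.
pose th' s := th s / tau.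
pose S := [set z | eball 0 c1 (u z) /\ eta < `|\sum_s th' s * mono (u z) s|].
have mS : measurable S.
  rewrite (_ : S = (u @^-1` (eball 0 c1)) `&`
    ((fun z => `|\sum_s th' s * mono (u z) s|) @^-1` `]eta, +oo[)); last first.
    by apply/seteqP; split => z /=; rewrite in_itv/= andbT.
  apply: measurableI; rewrite -[X in measurable X]setTI.
    by apply: mu => //; exact: measurable_eball.
  have mP : measurable_fun setT (fun z => `|\sum_s th' s * mono (u z) s|).
    apply: (measurableT_comp (@normr_measurable _ _)).
    apply: measurable_sum => s; apply: measurable_funM => //.
    exact: (measurableT_comp (measurable_mono s) mu).
  exact: mP.
have kS : kappa <= fine (PXY S).
  rewrite -lee_fin fineK; last exact: fin_num_measure.
  apply: kP; exists s0.
  by rewrite /th' normrM normfV (ger0_norm tau_ge0) -/tau divff.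
apply: (@le_trans _ _ (\int[PXY]_z (eta ^+ 2 * tau ^+ 2 * \1_S z))%R).
  rewrite meanZ; last exact: bmf_indic.
  by rewrite mean_indic_fine// mulrAC ler_wpM2l// mulr_ge0// sqr_ge0.
apply: mean_le.
- by apply: bmfZ; exact: bmf_indic.
- under eq_fun do rewrite -gram_quadratic.
  apply: bmf_sum => s; apply: bmf_sum => t; apply: bmfZ; exact: gram_bmf.
move=> z; rewrite [\1_S z]indicE; case: (boolP (z \in S)); last first.
  by rewrite mulr0 mulr_ge0 ?sqr_ge0// indicE.
rewrite inE mulr1 => -[ub gt].
rewrite indicE mem_set// mul1r.
have -> : \sum_s mono (u z) s * th s = tau * \sum_s th' s * mono (u z) s.
  rewrite big_distrr/=; apply: eq_bigr => s _.
  by rewrite /th' mulrA mulrCA divff// mulr1 mulrC.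
rewrite exprMn mulrC ler_wpM2l ?sqr_ge0// -[leRHS]real_normK ?num_real//.
by rewrite lerXn2r ?nnegrE// ltW.
Qed.

End gram.

Section deviation_events.
Context {R : realType} {d : measure_display} {Z : measurableType d}.
Context {dO : measure_display} {Omega : measurableType dO}.
Variables (P : probability Omega R) (Q : probability Z R).
Variables (n : nat) (Zs : 'I_n -> Omega -> Z).
Hypothesis mZs : forall i, measurable_fun setT (Zs i).
Hypothesis indep : forall B : 'I_n -> set Z, (forall i, measurable (B i)) ->
  P (\bigcap_(i in [set: 'I_n]) [set w | B i (Zs i w)]) =
  (\prod_(i < n) P [set w | B i (Zs i w)])%E.
Hypothesis same_law : forall i B, measurable B -> P [set w | B (Zs i w)] = Q B.

(** The event is that the sum [F] of two-sided exponentials is large. Its mean is at most [#|J|]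
    times a common bound and the threshold is also proportional to [#|J|], so the cardinality
    cancels in Markov's inequality. *)
Lemma iid_quadratic_mean (J : finType) (g : J -> Z -> R) (Dg m1 m2 t b c s : R) :
  (0 < #|J|)%N -> (forall k, bmf (g k)) -> (forall k z, `|g k z| <= Dg) ->
  (forall k, `|\int[Q]_z g k z| <= m1)%R ->
  (forall k, \int[Q]_z (g k z ^+ 2) <= m2)%R ->
  0 < t -> t * Dg <= 1 / 2 -> 0 < b -> 0 < c -> 1 <= s -> t * b = c * s ->
  exists E, [/\ measurable E,
    forall w, ~ E w ->
      \sum_k (\sum_(i < n) g k (Zs i w)) ^+ 2 <= #|J|%:R * b ^+ 2 &
    (P E <= (4 * (1 / 2 + 4 / c ^+ 2) *
      expR (n%:R * (t * m1 + 2 * (t ^+ 2 * m2)) + 1 - c * s / 2))%:E)%E].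
Proof.
move=> J0 bg gD gm1 gm2 t0 tD b0 c0 s1 tb.
pose S k w := \sum_(i < n) g k (Zs i w).
pose F w := \sum_k (expR (t * S k w) + expR (- (t * S k w))).
set C := 1 / 2 + 4 / c ^+ 2.
have C0 : 0 < C by rewrite addr_gt0// divr_gt0// exprn_gt0.
have J0' : 0 < #|J|%:R :> R by rewrite ltr0n.
(* The value that [exp_average] forces on [F] when the quadratic mean exceeds [b]. *)
pose tau := #|J|%:R / 2 * expR (c * s / 2) / C.
have tau0 : 0 < tau by rewrite divr_gt0// mulr_gt0 ?expR_gt0// divr_gt0.
have moment (sg : R) k : sg ^+ 2 = 1 -> `|sg| = 1 ->
    (\int[P]_w expR (sg * (t * S k w)) <=
     expR (n%:R * (t * m1 + 2 * (t ^+ 2 * m2)) + 1))%R.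
  move=> sg2 sg1.
  have bsg : bmf (fun z => (sg * t) * g k z) by exact: bmfZ.
  have h12 z : (sg * t) * g k z <= 1 / 2.
    apply: (le_trans (ler_norm _)).
    rewrite !normrM sg1 (gtr0_norm t0) [1 * t]mul1r.
    by apply: (le_trans _ tD); rewrite ler_wpM2l ?(ltW t0).
  have h1 : (\int[Q]_z ((sg * t) * g k z) <= t * m1)%R.
    rewrite meanZ//; apply: (le_trans (ler_norm _)).
    rewrite !normrM sg1 mul1r (gtr0_norm t0).
    by rewrite ler_wpM2l ?(ltW t0).
  have h2 : (\int[Q]_z (((sg * t) * g k z) ^+ 2) <= t ^+ 2 * m2)%R.
    under eq_Rintegral do rewrite !exprMn sg2 mul1r.
    rewrite meanZ; last first.
      by under eq_fun do rewrite expr2; exact: bmfM.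
    by rewrite ler_wpM2l// sqr_ge0.
  have := iid_exp_moment mZs indep same_law bsg h12 h1 h2.
  move=> /(le_trans _); apply; rewrite le_eqVlt; apply/orP; left; apply/eqP.
  apply: eq_Rintegral => w _; congr expR.
  by rewrite mulrA /S big_distrr.
have bS k : bmf (S k).
  by apply: bmf_sum => i; exact: (bmf_comp (mZs i) (bg k)).
have be k : bmf (fun w => expR (t * S k w)) by apply: bmf_expR; exact: bmfZ.
have bem k : bmf (fun w => expR (- (t * S k w))).
  by apply: bmf_expR; apply: bmfN; exact: bmfZ.
have bF : bmf F by apply: bmf_sum => k; exact: bmfD.
have mE := measurable_superlevel tau bF.1.
exists [set w | tau <= F w]; split => // [w /negP|].
  rewrite -ltNge => Flt; rewrite leNgt; apply/negP => lt.
  have yP : #|J|%:R <= \sum_k (S k w / b) ^+ 2.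
    under eq_bigr do rewrite expr_div_n.
    rewrite -big_distrl/= ler_pdivlMr ?exprn_gt0//; exact: ltW.
  have yE k : c * s * (S k w / b) = t * S k w.
    by rewrite -tb; field; rewrite gt_eqF.
  have := exp_average c0 s1 yP; rewrite -/C.
  under eq_bigr do rewrite yE.
  rewrite -/(F w) mulrC [C * _]mulrC -ler_pdivrMr// mulrC -/tau leNgt.
  by rewrite Flt.
have F0 w : 0 <= F w by apply: sumr_ge0 => k _; rewrite addr_ge0 ?expR_ge0.
have := mean_indic_ge P bF mE F0 (fun w h => h).
set X := expR _ => H.
have FX : (\int[P]_w F w <= #|J|%:R * (2 * expR
    (n%:R * (t * m1 + 2 * (t ^+ 2 * m2)) + 1)))%R.
  rewrite /F mean_sum => [|k]; last exact: bmfD.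
  rewrite mulr_natl -sumr_const; apply: ler_sum => k _.
  rewrite meanD// mulr_natl mulr2n lerD//.
    have := @moment 1 k; rewrite expr1n normr1 => /(_ erefl erefl).
    by under eq_Rintegral do rewrite mul1r.
  have := @moment (-1) k; rewrite sqrrN expr1n normrN1 => /(_ erefl erefl).
  by under eq_Rintegral do rewrite mulN1r.
have PE := fin_num_measure P _ mE.
rewrite -(fineK PE) in H *; rewrite -EFinM !lee_fin in H *.
have {}H := le_trans H FX.
rewrite -(ler_pM2l tau0) (le_trans H)//.
have -> : X = expR (n%:R * (t * m1 + 2 * (t ^+ 2 * m2)) + 1) / expR (c * s / 2).
  by rewrite /X expRD expRN.
rewrite /tau le_eqVlt; apply/orP; left; apply/eqP; field.
by rewrite !gt_eqF ?expR_gt0.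
Qed.

End deviation_events.

Section gram_event.
Context {R : realType} {p d : nat}.
Context {dO : measure_display} {Omega : measurableType dO}.
Variables (PXY : probability ('rV[R]_p * 'rV[R]_d)%type R).
Variables (P : probability Omega R).
Variables (n : nat) (Zs : 'I_n -> Omega -> ('rV[R]_p * 'rV[R]_d)%type).
Hypothesis mZs : forall i, measurable_fun setT (Zs i).
Hypothesis indep : forall B : 'I_n -> set ('rV[R]_p * 'rV[R]_d)%type,
  (forall i, measurable (B i)) ->
  P (\bigcap_(i in [set: 'I_n]) [set w | B i (Zs i w)]) =
  (\prod_(i < n) P [set w | B i (Zs i w)])%E.
Hypothesis same_law : forall i B, measurable B -> P [set w | B (Zs i w)] = PXY B.
Variables (beta h c1 : R) (x : 'rV[R]_p).
Hypothesis beta0 : 0 < beta.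
Hypothesis c10 : 0 < c1.
Let u (z : 'rV[R]_p * 'rV[R]_d) : 'rV[R]_p := h^-1 *: (z.1 - x).
Let MI := multi_index p (floor_beta beta).
Let G (s t : MI) := @gram R p d beta h c1 x s t.

(** A deviation of at most [r] in every entry changes the quadratic form by at most [r] times the
    squared l1-norm, and Cauchy-Schwarz turns this into the loss [r * #|MI|]. The boolean in the
    index is the sign of the deviation. *)
Lemma gram_event (V t r lamG : R) : 0 < t -> t * gram_max beta c1 <= 1 / 2 ->
  (forall s s' : MI, \int[PXY]_z (G s s' z ^+ 2) <= V)%R ->
  (forall th : MI -> R, lamG * (\sum_s th s ^+ 2) <=
    \sum_s \sum_s' th s * th s' * (\int[PXY]_z G s s' z)%R) ->
  exists E, [/\ measurable E,
    forall w, ~ E w -> forall th : MI -> R,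
      (n%:R * lamG - r * #|{: MI}|%:R) * (\sum_s th s ^+ 2) <=
      \sum_(i < n) \1_(eball 0 c1) (u (Zs i w)) *
        (\sum_s mono (u (Zs i w)) s * th s) ^+ 2 &
    (P E <= (#|{: MI * MI * bool}|%:R *
      expR (2 * n%:R * t ^+ 2 * V + 1 - t * r))%:E)%E].
Proof.
move=> t0 tD GV lamP.
pose sgn (b : bool) : R := if b then 1 else -1.
have sgn2 b : sgn b ^+ 2 = 1 by case: b; rewrite /sgn ?sqrrN expr1n.
have sgn1 b : `|sgn b| = 1 by case: b; rewrite /sgn ?normrN1 ?normr1.
pose g (k : MI * MI * bool) z := sgn k.2 * G k.1.1 k.1.2 z.
have bG s s' : bmf (G s s') by exact: gram_bmf.
have bg k : bmf (g k) by exact: bmfZ.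
have gD k z : `|g k z| <= gram_max beta c1.
  by rewrite normrM sgn1 mul1r; exact: gram_bound.
have gV k : (\int[PXY]_z (g k z ^+ 2) <= V)%R.
  by under eq_Rintegral do rewrite exprMn sgn2 mul1r; exact: GV.
pose B (k : MI * MI * bool) := [set w | (n%:R * \int[PXY]_z g k z + r <=
  \sum_(i < n) g k (Zs i w))%R].
have mB k : measurable (B k).
  apply: measurable_superlevel.
  by apply: (bmf_sum (f := fun i w => g k (Zs i w)) _ _).1 => i;
    exact: (bmf_comp (mZs i) (bg k)).
have BP k := iid_deviation mZs indep same_law r (bg k) (gD k) (gV k) t0 tD.
have [E [mE BE PE]] := union_bound mB BP.
exists E; split => // w wE th.
have dev s s' : `|\sum_(i < n) G s s' (Zs i w) - n%:R * (\int[PXY]_z G s s' z)%R| <= r.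
  have half b : sgn b * (\sum_(i < n) G s s' (Zs i w) -
      n%:R * (\int[PXY]_z G s s' z)%R) <= r.
    have : ~ B (s, s', b) w by move=> /BE.
    move=> /negP; rewrite -ltNge /g/= -big_distrr/= meanZ// => /ltW.
    by rewrite mulrBr lerBlDl mulrCA addrC.
  have := half true; have := half false; rewrite /sgn mul1r mulN1r => h1 h2.
  by rewrite ler_norml h2 andbT lerNl.
have -> : \sum_(i < n) \1_(eball 0 c1) (u (Zs i w)) *
    (\sum_s mono (u (Zs i w)) s * th s) ^+ 2 =
    \sum_s \sum_s' th s * th s' * \sum_(i < n) G s s' (Zs i w).
  under eq_bigr do rewrite -gram_quadratic.
  rewrite exchange_big/=; apply: eq_bigr => s _.
  rewrite exchange_big/=; apply: eq_bigr => s' _.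
  by rewrite big_distrr.
have sumsq : (\sum_s `|th s|) ^+ 2 <= #|{: MI}|%:R * \sum_s th s ^+ 2.
  rewrite expr2 big_distrl/=.
  under eq_bigr do rewrite big_distrr/=.
  apply: (@le_trans _ _ (\sum_(s : MI) \sum_(s' : MI)
      (th s ^+ 2 / 2 + th s' ^+ 2 / 2))).
    apply: ler_sum => s _; apply: ler_sum => s' _.
    rewrite -[th s ^+ 2]real_normK ?num_real// -[th s' ^+ 2]real_normK ?num_real//.
    by have := sqr_ge0 (`|th s| - `|th s'|); nra.
  have inner s : \sum_(s' : MI) (th s ^+ 2 / 2 + th s' ^+ 2 / 2) =
      #|{: MI}|%:R * (th s ^+ 2 / 2) + (\sum_s' th s' ^+ 2) / 2.
    by rewrite big_split/= sumr_const mulr_natl -big_distrl.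
  rewrite (eq_bigr _ (fun s _ => inner s)) big_split/= sumr_const -big_distrr/=.
  rewrite -big_distrl/= -[X in _ + X]mulr_natl le_eqVlt; apply/orP; left.
  by apply/eqP; field.
have dist : \sum_s \sum_s' th s * th s' * (n%:R * (\int[PXY]_z G s s' z)%R -
    \sum_(i < n) G s s' (Zs i w)) <= r * (\sum_s `|th s|) ^+ 2.
  rewrite expr2 big_distrl/= big_distrr/=; apply: ler_sum => s _.
  rewrite !big_distrr/=; apply: ler_sum => s' _.
  rewrite (le_trans (ler_norm _))// !normrM distrC.
  by rewrite [r * _]mulrC ler_wpM2l// mulr_ge0.
have split : \sum_s \sum_s' th s * th s' * (n%:R * (\int[PXY]_z G s s' z)%R -
    \sum_(i < n) G s s' (Zs i w)) =
  n%:R * (\sum_s \sum_s' th s * th s' * (\int[PXY]_z G s s' z)%R) -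
  \sum_s \sum_s' th s * th s' * \sum_(i < n) G s s' (Zs i w).
  rewrite big_distrr/= -sumrB; apply: eq_bigr => s _.
  rewrite big_distrr/= -sumrB; apply: eq_bigr => s' _; ring.
(* The sign of [r] is not assumed: off the event, [r] bounds an absolute value. *)
have r0 : 0 <= r.
  exact: le_trans (normr_ge0 _) (dev (mi_zero p _) (mi_zero p _)).
have h1 := ler_wpM2l (ler0n R n) (lamP th).
have h2 := ler_wpM2l r0 sumsq.
rewrite split in dist; lra.
Qed.

End gram_event.

(** By thickness the support fills at least the proportion [c0] of the ball of radius [h c1], of
    measure [c0 v h^p]. The sublevel set takes at most half of this, and the density is at least
    [mu_min] on the rest. *)
Lemma sublevel_prob {R : realType} {p d : nat} (beta : R)
    (leb : {measure set 'rV[R]_p -> \bar R})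
    (PXY : probability ('rV[R]_p * 'rV[R]_d)%type R) (Xc : set 'rV[R]_p)
    (mu_min c0 h c1 eta v : R) (x : 'rV[R]_p)
    (th : multi_index p (floor_beta beta) -> R) :
  is_lebesgue leb -> 0 < mu_min -> 0 < h -> measurable Xc ->
  (forall A, measurable A ->
    (mu_min%:E * leb (A `&` Xc) <= PXY (A `*` setT))%E) ->
  leb (eball 0 c1) = v%:E ->
  (c0%:E * leb (eball x (h * c1)) <= leb (Xc `&` eball x (h * c1)))%E ->
  (leb (box (\row__ (- c1)) (\row__ c1) `&`
     [set u | `|\sum_s th s * mono u s| <= eta])%R <= (c0 * v / 2)%:E)%E ->
  ((mu_min * (c0 * v / 2) * h ^+ p)%:E <=
    PXY [set z | eball 0 c1 (h^-1 *: (z.1 - x)) /\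
       (eta < `|\sum_s th s * mono (h^-1 *: (z.1 - x)) s|)%R])%E.
Proof.
move=> lebP mu0 h0 mXc PXge vE thick small.
pose phi := fun y : 'rV[R]_p => h^-1 *: (y - x).
pose Pt (u : 'rV[R]_p) := `|\sum_s th s * mono u s|.
have mP : measurable_fun setT Pt.
  apply: (measurableT_comp (@normr_measurable _ _)).
  by apply: measurable_sum => s; apply: measurable_funM => //; exact: measurable_mono.
have mphi : measurable_fun setT phi by exact: measurable_affine.
have mpre S : measurable S -> measurable (phi @^-1` S).
  by move=> mS; rewrite -[X in measurable X]setTI; exact: mphi.
pose A0 := eball 0 c1 `&` [set u | eta < Pt u].
pose B0 := box (\row__ (- c1)) (\row_(j < p) c1) `&` [set u | Pt u <= eta].
have mA0 : measurable A0.
  apply: measurableI; first exact: measurable_eball.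
  rewrite -[X in measurable X]setTI (_ : [set u | _] = Pt @^-1` `]eta, +oo[).
    exact: mP.
  by apply/seteqP; split => u /=; rewrite in_itv/= andbT.
have mB0 : measurable B0.
  apply: measurableI; first exact: measurable_box.
  rewrite -[X in measurable X]setTI (_ : [set u | _] = Pt @^-1` `]-oo, eta]).
    exact: mP.
  by apply/seteqP; split => u /=; rewrite in_itv.
pose A := phi @^-1` A0.
have -> : [set z : 'rV[R]_p * 'rV[R]_d | eball 0 c1 (h^-1 *: (z.1 - x)) /\
    eta < `|\sum_s th s * mono (h^-1 *: (z.1 - x)) s|] = A `*` setT.
  by apply/seteqP; split => z /= => [?|[]].
apply: le_trans (PXge _ (mpre _ mA0)).
have mAX : measurable (A `&` Xc) by apply: measurableI => //; exact: mpre.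
have ballE : eball x (h * c1) = phi @^-1` (eball 0 c1) by rewrite eball_affine.
have sub : Xc `&` eball x (h * c1) `<=` (A `&` Xc) `|` phi @^-1` B0.
  rewrite ballE => y [yX yb]; have [lt|le] := ltP eta (Pt (phi y)); first by left.
  right; split => //= j; have := coord_le_enorm (phi y) j.
  move=> /le_trans/(_ (_ : _ <= c1)); rewrite ler_norml !mxE; apply.
  by move: yb; rewrite /eball/= subr0.
have mball := measurable_eball x (h * c1).
have leU : (leb (Xc `&` eball x (h * c1)) <=
    leb (A `&` Xc) + leb (phi @^-1` B0))%E.
  apply: le_trans (measureU2 _ mAX (mpre _ mB0)).
  apply: le_measure; rewrite ?inE//; first exact: measurableI.
  by apply: measurableU => //; exact: mpre.
have := le_trans thick leU.
rewrite ballE !(leb_affine lebP x h0)//; last exact: measurable_eball.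
rewrite vE.
have Afin : leb (A `&` Xc) \is a fin_num.
  rewrite ge0_fin_numE//; apply: le_lt_trans (leb_eball_fin lebP x (h * c1)).
  apply: le_measure; rewrite ?inE// ballE => y [[]] //.
have Bfin : leb B0 \is a fin_num.
  rewrite ge0_fin_numE//; apply: le_lt_trans (leb_box_fin lebP
    (\row__ (- c1)) (\row_(j < p) c1)).
  apply: le_measure; rewrite ?inE//; first exact: measurable_box.
  exact: subIsetl.
rewrite -/B0 in small; rewrite -(fineK Bfin) lee_fin in small.
rewrite -(fineK Afin) -(fineK Bfin) -!EFinM -EFinD !lee_fin => H.
have hp0 : 0 <= h ^+ p by rewrite exprn_ge0// ltW.
rewrite -mulrA ler_wpM2l ?(ltW mu0)//.
have := ler_wpM2l hp0 small; lra.
Qed.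

(** The deterministic part: on an admissible sample the truncation of the scores is invisible, and
    [K >= c] on the ball turns the Gram bound into one for the kernel-weighted form. *)
Lemma lp_est_proj_error {R : realType} (p d : nat) (beta h c c1 lamn T : R)
    (K : 'rV[R]_p -> R) (N : nat) (Xs : 'I_N -> 'rV[R]_p) (Ys : 'I_N -> 'rV[R]_d)
    (x : 'rV[R]_p) (f : 'rV[R]_p -> 'rV[R]_d) (Xc : set 'rV[R]_p) :
  0 < h -> (forall u, 0 <= K u) -> 0 < c -> 0 < lamn ->
  (forall u, eball 0 c1 u -> c <= K u) ->
  enorm (f x) <= 1 ->
  (forall i, admissible Xc (Xs i, Ys i)) ->
  (forall th : multi_index p (floor_beta beta) -> R, lamn * (\sum_s th s ^+ 2) <=
     \sum_i \1_(eball 0 c1) (h^-1 *: (Xs i - x)) *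
       (\sum_s mono (h^-1 *: (Xs i - x)) s * th s) ^+ 2) ->
  \sum_(k : 'I_d * multi_index p (floor_beta beta))
    (\sum_i score f Xc K h x k.1 k.2 (Xs i, Ys i)) ^+ 2 <= T ->
  enorm (lp_est_proj beta h K Xs Ys x - f x) ^+ 2 <= T / (c * lamn) ^+ 2.
Proof.
move=> h0 K0 c0 lamn0 Kc fx1 adm gramP scoreP.
apply: (@le_trans _ _ (enorm (lp_est beta h K Xs Ys x - f x) ^+ 2)).
  by rewrite lerXn2r ?nnegrE ?enorm_ge0//; exact: enorm_proj_ball.
have cl0 : 0 < c * lamn by rewrite mulr_gt0.
apply: (le_trans (lp_est_error Ys h0 K0 f cl0 _)) => [th|].
  rewrite -mulrA; apply: (le_trans (ler_wpM2l (ltW c0) (gramP th))).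
  rewrite big_distrr/=; apply: ler_sum => i _; rewrite mulrA ler_wpM2r ?sqr_ge0//.
  rewrite indicE; case: (boolP (_ \in _)) => [|_]; last by rewrite mulr0.
  by rewrite inE mulr1 => /Kc.
rewrite ler_wpM2r ?invr_ge0 ?sqr_ge0//; apply: le_trans scoreP.
rewrite pair_bigA/= le_eqVlt; apply/orP; left; apply/eqP.
apply: eq_bigr => k _; congr (_ ^+ 2); apply: eq_bigr => i _.
by rewrite /score indicE mem_set ?mul1r//; exact: adm.
Qed.

(** * The deviation bound at a point of the support *)

Section local_bound.
Context {R : realType} {p d : nat}.
Variables (leb : {measure set 'rV[R]_p -> \bar R}) (K : 'rV[R]_p -> R).
Variables (beta L mu_min mu_max c0 r0 c c1 B I v eta : R).
Variables (PXY : probability ('rV[R]_p * 'rV[R]_d)%type R).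
Variables (f : 'rV[R]_p -> 'rV[R]_d) (q : 'rV[R]_p -> R) (Xc : set 'rV[R]_p).
Hypothesis beta0 : 0 < beta.
Hypothesis L0 : 0 < L.
Hypothesis mu_min0 : 0 < mu_min.
Hypothesis mu_minmax : mu_min <= mu_max.
Hypothesis c00 : 0 < c0.
Hypothesis r00 : 0 < r0.
Hypothesis lebP : is_lebesgue leb.
Hypothesis mK : measurable_fun setT K.
Hypothesis K0 : forall u, 0 <= K u.
Hypothesis c_gt0 : 0 < c.
Hypothesis c1_gt0 : 0 < c1.
Hypothesis c1r0 : c1 <= r0.
Hypothesis Kc : forall u, eball 0 c1 u -> c <= K u.
Hypothesis B0 : 0 < B.
Hypothesis KB : forall u, weight beta u * K u <= B.
Hypothesis KI : (\int[leb]_u (weight beta u * K u)%:E <= I%:E)%E.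
Hypothesis v0 : 0 < v.
Hypothesis vE : leb (eball 0 c1) = v%:E.
Hypothesis eta0 : 0 < eta.
Let MI := multi_index p (floor_beta beta).
Hypothesis sublevel : forall th : MI -> R, (exists s, 1 <= `|th s|) ->
  (leb (box (\row__ (- c1)) (\row__ c1) `&`
    [set u | `|\sum_s th s * mono u s| <= eta])%R <= (c0 * v / 2)%:E)%E.
Hypothesis d0 : (0 < d)%N.
Hypothesis Y1 : PXY [set z | enorm z.2 <= 1] = 1%E.
Hypothesis mXc : measurable Xc.
Hypothesis mq : measurable_fun setT q.
Hypothesis q0 : forall x, ~ Xc x -> q x = 0.
Hypothesis qP : forall x, Xc x -> mu_min <= q x <= mu_max.
Hypothesis density : forall A, measurable A ->
  (PXY (A `*` setT) = \int[leb]_(x in A) (q x)%:E)%E.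
Hypothesis mf : measurable_fun setT f.
Hypothesis regression : forall A, measurable A -> forall j : 'I_d,
  (\int[PXY]_(z in A `*` setT) (z.2 ord0 j)%:E =
   \int[PXY]_(z in A `*` setT) (f z.1 ord0 j)%:E)%E.
Hypothesis f_holder : holder_vec beta L f.
Hypothesis thick : forall x r, Xc x -> 0 < r <= r0 ->
  (c0%:E * leb (eball x r) <= leb (Xc `&` eball x r))%E.
Variables (n : nat) (dO : measure_display) (Omega : measurableType dO).
Variables (P : probability Omega R).
Variables (Xs : 'I_n -> Omega -> 'rV[R]_p) (Ys : 'I_n -> Omega -> 'rV[R]_d).
Hypothesis mZs : forall i, measurable_fun setT (fun w => (Xs i w, Ys i w)).
Hypothesis indep : forall B : 'I_n -> set ('rV[R]_p * 'rV[R]_d)%type,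
  (forall i, measurable (B i)) ->
  P (\bigcap_(i in [set: 'I_n]) [set w | B i (Xs i w, Ys i w)]) =
  (\prod_(i < n) P [set w | B i (Xs i w, Ys i w)])%E.
Hypothesis same_law : forall i B, measurable B ->
  P [set w | B (Xs i w, Ys i w)] = PXY B.

(** Times [h^p], [lamG] bounds the expected Gram form below and [VG] the second moments of its
    entries above. An entrywise deviation [zeta], amplified by [M], costs half of [lamG]; the other
    half, times the kernel bound [c], is [lam]. [C3] and [C4] are the constants in the mean and
    second moment of a score. *)
Let M : R := #|{: MI}|%:R.
Let lamG : R := eta ^+ 2 * (mu_min * (c0 * v / 2)) / M.
Let VG : R := gram_max beta c1 ^+ 2 * (mu_max * v).
Let zeta : R := lamG / (2 * M).
Let lam : R := c * lamG / 2.
Let C3 : R := L * (mu_max * I).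
Let C4 : R := (2 + L) ^+ 2 * B * (mu_max * I).

Let f_continuous (j : 'I_d) : continuous (fun y => f y ord0 j).
Proof. by have [H _] := f_holder j; exact: (H [::] isT).1. Qed.

Lemma support_regression_le1 y : Xc y -> enorm (f y) <= 1.
Proof.
exact: (regression_le1 lebP mu_min0 c00 r00 Y1 mXc mq q0 qP density mf
  regression f_continuous thick).
Qed.

(** The event is a union of three: some observation is inadmissible (a null event, by a union bound
    with [b = 0]), the Gram form is too small, or the quadratic mean of the [d * M] scores exceeds
    [b]. The exponential parameters are [t1] for the Gram entries and [cc * s / b] for the
    scores. *)
Lemma deviation_event (x : 'rV[R]_p) (h t1 cc b s : R) : Xc x ->
  0 < h -> h <= 1 ->
  0 < t1 -> t1 * gram_max beta c1 <= 1 / 2 -> 2 * t1 * VG <= zeta / 2 ->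
  0 < cc -> 0 < b -> 1 <= s -> (0 < n)%N ->
  cc * s / b * ((2 + L) * B) <= 1 / 2 ->
  let a := n%:R * h ^+ p in
  exists E : set Omega, [/\ measurable E,
    forall w, ~ E w -> enorm (lp_est_proj beta h K (fun i => Xs i w)
        (fun i => Ys i w) x - f x) ^+ 2 <= d%:R * M * b ^+ 2 / (a * lam) ^+ 2 &
    (P E <= (#|{: MI * MI * bool}|%:R * expR (1 - a * t1 * zeta / 2) +
      4 * (1 / 2 + 4 / cc ^+ 2) * expR (cc * s / b * powR h beta * a * C3 +
        2 * (cc * s / b) ^+ 2 * a * C4 + 1 - cc * s / 2))%:E)%E].
Proof.
move=> Xx h0 h1 t10 t1G t1V cc0 b0 s1 n0 tB a.
have M0 : 0 < M.
  by rewrite ltr0n; apply/card_gt0P; exists (mi_zero p (floor_beta beta)).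
have n0' : 0 < n%:R :> R by rewrite ltr0n.
have mu_max0 : 0 < mu_max by exact: lt_le_trans mu_minmax.
have hp0 : 0 < h ^+ p by rewrite exprn_gt0.
have a0 : 0 < a by rewrite mulr_gt0.
have cv0 : 0 < c0 * v / 2 by rewrite !mulr_gt0.
have lamG0 : 0 < lamG by rewrite divr_gt0// mulr_gt0 ?exprn_gt0// mulr_gt0.
pose Zs i w := (Xs i w, Ys i w).
have mball := measurable_eball (0 : 'rV[R]_p) c1.
have scaled I' (g : 'rV[R]_p -> R) := @mean_scaled_le R p d leb PXY q Xc
  mu_min mu_max lebP mu_min0 mu_minmax mq q0 qP density x h I' g h0.
have bwK : bmf (fun u => weight beta u * K u).
  split; first by apply: measurable_funM => //; exact: measurable_weight.
  exists B => u; rewrite ger0_norm ?KB//.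
  by rewrite mulr_ge0// weight_ge0.
have mean_w := scaled I _ bwK (fun u => mulr_ge0 (weight_ge0 beta u) (K0 u)) KI.
have i0 (u : 'rV[R]_p) : 0 <= \1_(eball 0 c1) u :> R by rewrite indicE.
have mean_b := scaled v _ (bmf_indic mball) i0.
have {}mean_b : (\int[PXY]_z \1_(eball 0 c1) (h^-1 *: (z.1 - x)) <=
    mu_max * h ^+ p * v)%R.
  by apply: mean_b; rewrite integral_indic// setIT vE.
have f1 := support_regression_le1.
have resid A (j : 'I_d) : measurable A -> A `<=` Xc ->
    (\int[PXY]_z (\1_A z.1 * (\1_[set z | enorm z.2 <= 1] z *
     (z.2 ord0 j - f z.1 ord0 j))) = 0)%R.
  move=> mA AX; apply: (mean_regression_residual Y1 mf regression (C := 1)) => //.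
  by move=> y /AX/f1; apply: le_trans; exact: coord_le_enorm.
have mAd : measurable (admissible Xc : set ('rV[R]_p * 'rV[R]_d)).
  exact: measurable_admissible.
have PAd : PXY (~` admissible Xc) = 0%E.
  have PX0 : PXY (~` Xc `*` setT) = 0%E by exact: (PX_support mXc q0 density).
  have mY := @measurable_unit_response R p d.
  have PY0 : PXY (~` [set z | enorm z.2 <= 1]) = 0%E.
    by rewrite probability_setC// Y1 subee.
  have mXC : measurable (~` Xc `*` [set: 'rV[R]_d]).
    by apply: measurableX => //; exact: measurableC.
  apply/eqP; rewrite eq_le measure_ge0 andbT.
  apply: (@le_trans _ _ (PXY ((~` Xc `*` setT) `|` ~` [set z | enorm z.2 <= 1]))).
    apply: le_measure; rewrite ?inE.
    - exact: measurableC.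
    - by apply: measurableU => //; exact: measurableC.
    move=> z; rewrite /admissible => /not_andP[zX|z1]; first by left.
    by right.
  apply: (le_trans (measureU2 _ mXC (measurableC mY))).
  have PX0' : (PXY (~` Xc `*` setT) <= 0)%E by rewrite PX0.
  have PY0' : (PXY (~` [set z | (enorm z.2 <= 1)%R]) <= 0)%E by rewrite PY0.
  by apply: (le_trans (leeD PX0' PY0')); rewrite adde0.
have [E0 [mE0 E0P PE0]] : exists E, [/\ measurable E,
    forall i : 'I_n, [set w | (~` admissible Xc) (Zs i w)] `<=` E &
    (P E <= (#|'I_n|%:R * 0)%:E)%E].
  apply: union_bound => i.
    by rewrite -[X in measurable X]setTI; apply: (mZs i) => //; exact: measurableC.
  rewrite le_eqVlt; apply/orP; left; apply/eqP.
  by apply: (etrans (same_law i (measurableC mAd))).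
have gV (k l : MI) :
    (\int[PXY]_z (gram h c1 x k l z ^+ 2) <= VG * h ^+ p)%R.
  apply: (le_trans (gram_second_moment (x := x) (h := h) beta0 c1_gt0 _ _ mean_b)).
  by rewrite /VG le_eqVlt; apply/orP; left; apply/eqP; ring.
have gL (th : MI -> R) : lamG * h ^+ p * (\sum_s th s ^+ 2) <=
    \sum_s \sum_s' th s * th s' * (\int[PXY]_z gram h c1 x s s' z)%R.
  have k0 : 0 <= mu_min * (c0 * v / 2) * h ^+ p by rewrite ltW// !mulr_gt0.
  apply: le_trans (gram_lower_bound beta0 c1_gt0 th eta0 k0 _).
    rewrite /lamG le_eqVlt; apply/orP; left; apply/eqP; rewrite -/M; ring.
  move=> th' th'1; apply: (sublevel_prob lebP mu_min0 h0 mXc _ vE) => //.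
  - by move=> A mA; exact: (PX_ge mu_min0 mXc mq q0 qP density).
  - apply: thick => //; rewrite mulr_gt0//=.
    by apply: le_trans c1r0; rewrite ler_piMl// ltW.
  - exact: sublevel.
have [E1 [mE1 E1P PE1]] := gram_event mZs indep same_law beta0 c1_gt0
  (a * zeta) t10 t1G gV gL.
have sB (k : 'I_d * MI) : bmf (score f Xc K h x k.1 k.2).
  exact: (score_bmf x beta0 L0 h0 h1 mXc mK K0 KB f1 f_holder k.1 k.2).
have J0 : (0 < #|{: 'I_d * MI}|)%N.
  apply/card_gt0P; exists (Ordinal d0, mi_zero p (floor_beta beta)); by [].
have tpos : 0 < cc * s / b by rewrite divr_gt0// mulr_gt0// (lt_le_trans ltr01).
have tb : cc * s / b * b = cc * s by rewrite divfK// gt_eqF.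
have [E2 [mE2 E2P PE2]] := iid_quadratic_mean mZs indep same_law J0 sB
  (fun k z => score_bound x beta0 L0 h0 h1 K0 KB f1 f_holder k.1 k.2 z)
  (fun k => score_mean beta0 L0 h0 h1 mXc mK K0 KB mf f1 f_holder resid mean_w k.1 k.2)
  (fun k => score_second_moment beta0 L0 h0 h1 mXc mK K0 KB f1 f_holder mean_w
     k.1 k.2 (ltW B0))
  tpos tB b0 cc0 s1 tb.
exists (E0 `|` (E1 `|` E2)); split.
- by apply: measurableU => //; exact: measurableU.
- move=> w /not_orP[nE0 /not_orP[nE1 nE2]].
  have adm i : admissible Xc (Xs i w, Ys i w).
    by apply: contrapT => H; apply: nE0; exact: (E0P i).
  have half : n%:R * (lamG * h ^+ p) - a * zeta * M = a * lamG / 2.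
    by rewrite /zeta /a; field; rewrite gt_eqF.
  have lamn0 : 0 < a * lamG / 2 by rewrite divr_gt0// mulr_gt0.
  have low (th : MI -> R) : a * lamG / 2 * (\sum_s th s ^+ 2) <=
     \sum_(i < n) \1_(eball 0 c1) (h^-1 *: (Xs i w - x)) *
       (\sum_s mono (h^-1 *: (Xs i w - x)) s * th s) ^+ 2.
    by rewrite -half; exact: (E1P w nE1 th).
  have := lp_est_proj_error h0 K0 c_gt0 lamn0 Kc (f1 x Xx) adm low (E2P w nE2).
  rewrite card_prod card_ord natrM.
  by have -> : c * (a * lamG / 2) = a * lam by rewrite /lam; ring.
have mE12 : measurable (E1 `|` E2) by exact: measurableU.
apply: (le_trans (measureU2 _ mE0 mE12)).
have PE0' : (P E0 <= 0%:E)%E by rewrite mulr0 in PE0.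
rewrite -[leRHS]add0e; apply: leeD; first exact: PE0'.
apply: (le_trans (measureU2 _ mE1 mE2)); rewrite EFinD; apply: leeD.
  apply: (le_trans PE1); rewrite lee_fin ler_wpM2l// ler_expR.
  have -> : 2 * n%:R * t1 ^+ 2 * (VG * h ^+ p) = a * t1 * (2 * t1 * VG).
    by rewrite /a; ring.
  have := ler_wpM2l (ltW (mulr_gt0 a0 t10)) t1V; lra.
apply: (le_trans PE2); rewrite lee_fin ler_wpM2l//.
  by rewrite mulr_ge0// addr_ge0// divr_ge0// sqr_ge0.
rewrite ler_expR le_eqVlt; apply/orP; left; apply/eqP.
rewrite /C3 /C4 /a; ring.
Qed.

End local_bound.

(** * Bandwidth and choice of the constants *)

(** The bandwidth balances the squared bias [h^(2 beta)] with the variance [1 / (n h^p)]: both are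
    [1 / a]. *)
Lemma powR_bandwidth {R : realType} (n p : nat) (beta : R) :
  (0 < n)%N -> (0 < p)%N -> 0 < beta ->
  let h := powR n%:R (- (1 / (2 * beta + p%:R))) in
  let a := powR n%:R (2 * beta / (2 * beta + p%:R)) in
  [/\ 0 < h, h <= 1, n%:R * h ^+ p = a & a * powR h beta ^+ 2 = 1].
Proof.
move=> n0 p0 beta0 h a.
have n0' : 0 < n%:R :> R by rewrite ltr0n.
have n1 : 1 <= n%:R :> R by rewrite ler1n.
have D0 : 0 < 2 * beta + p%:R by rewrite addr_gt0 ?mulr_gt0// ltr0n.
have nn0 : (n%:R : R) != 0 by rewrite gt_eqF.
have D0' : 2 * beta + p%:R != 0 by rewrite gt_eqF.
have h0 : 0 < h by rewrite powR_gt0.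
split=> //.
- have -> : 1 = powR n%:R 0 :> R by rewrite powRr0.
  by rewrite ler_powR// oppr_le0 divr_ge0// ltW.
- rewrite -powR_mulrn ?(ltW h0)// /h -powRrM.
  rewrite -{1}(powRr1 (ltW n0')) -powRD; last by rewrite nn0 implybT.
  by rewrite /a; congr powR; field.
- rewrite -[powR h beta ^+ 2]powR_mulrn ?powR_ge0// /h -!powRrM /a.
  rewrite -powRD; last by rewrite nn0 implybT.
  by rewrite (_ : _ + _ = 0) ?powRr0//; field.
Qed.

Lemma enorm_proj_ball_le1 {R : realType} d (v : 'rV[R]_d) : enorm (proj_ball v) <= 1.
Proof.
rewrite /proj_ball; case: (leP (enorm v) 1) => // v1.
have v0 : 0 < enorm v by exact: lt_trans v1.
by rewrite enormZ ?invr_ge0 ?(ltW v0)// mulVf// gt_eqF.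
Qed.

Lemma enormB_le2 {R : realType} d (u y : 'rV[R]_d) :
  enorm u <= 1 -> enorm y <= 1 -> enorm (u - y) <= 2.
Proof.
move=> u1 y1; rewrite -(@ler_pXn2r _ 2) ?nnegrE ?enorm_ge0//.
have u2 : enorm u ^+ 2 <= 1 by rewrite expr_le1// enorm_ge0.
have y2 : enorm y ^+ 2 <= 1 by rewrite expr_le1// enorm_ge0.
rewrite (@le_trans _ _ (2 * enorm u ^+ 2 + 2 * enorm y ^+ 2))//; last by lra.
rewrite !sqr_enorm !big_distrr -big_split/=; apply: ler_sum => j _.
by rewrite !mxE; have := sqr_ge0 (u ord0 j + y ord0 j); nra.
Qed.

(** Write [s = a e^2]. Since [a hb^2 = 1], the bias enters through [r = e hb a], the square root of
    [s]; once [s >= 64 C3^2] it costs at most [cc s / 8]. The variance costs as much by the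
    smallness of [cc], so [cc s / 4] of the gain [cc s / 2] remains. *)
Lemma tail_numerics {R : realType} (N1 C cc ks t1 zeta C2 C3 C4 a hb e rho : R) :
  0 <= N1 -> 0 <= C -> 0 < cc -> 0 <= t1 * zeta -> 0 <= C3 -> 0 <= C4 ->
  0 < a -> 0 <= hb -> 0 < e -> 0 <= rho ->
  a * hb ^+ 2 = 1 -> a * e ^+ 2 = ks * rho -> rho <= 4 * a ->
  1 + 64 * C3 ^+ 2 <= ks * rho -> 2 * cc * C4 <= 1 / 8 ->
  C2 <= t1 * zeta / 8 -> C2 <= cc * ks / 4 ->
  N1 * expR (1 - a * t1 * zeta / 2) +
    C * expR (cc * e * hb * a * C3 + 2 * (cc * e) ^+ 2 * a * C4 + 1 -
      cc * (a * e ^+ 2) / 2) <=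
  (N1 + C) * expR 1 * expR (- (C2 * rho)).
Proof.
move=> N10 C0 cc0 tz0 C30 C40 a0 hb0 e0 rho0 ahb se rhoa S0 ccC4 C2a C2b.
rewrite -[leRHS]mulrA -expRD [leRHS]mulrDl lerD//; apply: ler_wpM2l => //; rewrite ler_expR.
  (* The Gram exponent is in [a] and not in [rho]; [rho <= 4 a] converts it, which explains the 8 in
     the bound on [C2]. *)
  have := ler_wpM2r rho0 C2a; have := ler_wpM2l tz0 rhoa; lra.
set s := a * e ^+ 2 in se *.
pose r := e * hb * a; have r0 : 0 <= r by rewrite !mulr_ge0// ltW.
have r2 : r ^+ 2 = s.
  have -> : r ^+ 2 = s * (a * hb ^+ 2) by rewrite /r /s; ring.
  by rewrite ahb mulr1.
have rC3 : 8 * C3 <= r.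
  have h8 : 0 <= 8 * C3 by rewrite mulr_ge0.
  rewrite -(@ler_pXn2r _ 2) ?nnegrE// r2 se.
  by apply: le_trans S0; rewrite exprMn; have := sqr_ge0 C3; lra.
have h1 : cc * e * hb * a * C3 <= cc * s / 8.
  rewrite -r2 (_ : _ * C3 = cc * (r * C3)); last by rewrite /r; ring.
  rewrite -mulrA ler_wpM2l ?(ltW cc0)// expr2 -mulrA ler_wpM2l//; lra.
have s0 : 0 <= s by rewrite mulr_ge0 ?sqr_ge0// ltW.
have h2 : 2 * (cc * e) ^+ 2 * a * C4 <= cc * s / 8.
  rewrite (_ : _ * C4 = cc * s * (2 * cc * C4)); last by rewrite /s; ring.
  by rewrite ler_wpM2l ?mulr_ge0 ?(ltW cc0)//; lra.
have h3 : C2 * rho <= cc * s / 4.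
  by rewrite se; have := ler_wpM2r rho0 C2b; lra.
lra.
Qed.

Unset Implicit Arguments.

Theorem theorem10 (R : realType) (p : nat) (beta L mu_min mu_max c0 r0 : R)
    (leb : {measure set 'rV[R]_p -> \bar R}) (K : 'rV[R]_p -> R) :
  (0 < p)%N -> 0 < beta -> 0 < L -> 0 < mu_min -> mu_min <= mu_max ->
  0 < c0 -> 0 < r0 ->
  (* leb is Lebesgue measure on R^p *)
  is_lebesgue leb ->
  (* the fixed kernel K *)
  measurable_fun setT K ->
  (exists c : R, 0 < c /\ forall u, c * ((enorm u <= c)%R : bool)%:R <= K u) ->
  (\int[leb]_u (K u)%:E = 1)%E ->
  (exists B : R, forall u, (1 + powR (enorm u) (2 * beta)) * K u <= B) ->
  (\int[leb]_u ((1 + powR (enorm u) (2 * beta)) * K u)%:E < +oo)%E ->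
  (\int[leb]_u ((1 + powR (enorm u) (4 * beta)) * K u ^+ 2)%:E < +oo)%E ->
  exists C1 C2 : R, 0 < C1 /\ 0 < C2 /\
  forall (d : nat) (PXY : probability ('rV[R]_p * 'rV[R]_d)%type R)
         (fstar : 'rV[R]_p -> 'rV[R]_d) (q : 'rV[R]_p -> R)
         (Xc : set 'rV[R]_p),
    (0 < d)%N ->
    (* ||Y|| <= 1 *)
    PXY [set z | enorm z.2 <= 1] = 1%E ->
    (* X has density q with compact support Xc, mu_min <= q <= mu_max on Xc *)
    compact Xc -> measurable Xc ->
    measurable_fun setT q ->
    (forall x, ~ Xc x -> q x = 0) ->
    (forall x, Xc x -> mu_min <= q x <= mu_max) ->
    (forall A, measurable A -> (PXY (A `*` setT) = \int[leb]_(x in A) (q x)%:E)%E) ->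
    (* fstar(x) = E[Y | X = x] *)
    measurable_fun setT fstar ->
    (forall A, measurable A -> forall j : 'I_d,
       (\int[PXY]_(z in A `*` setT) (z.2 ord0 j)%:E =
        \int[PXY]_(z in A `*` setT) (fstar z.1 ord0 j)%:E)%E) ->
    (* fstar is (beta, L, R^p -> R^d)-Hoelder *)
    holder_vec beta L fstar ->
    (* Leb[Xc /\ B(x,r)] >= c0 Leb[B(x,r)] *)
    (forall x r, Xc x -> 0 < r <= r0 ->
       (c0%:E * leb (eball x r) <= leb (Xc `&` eball x r))%E) ->
    forall (delta : R) (n : nat), 0 < delta -> (0 < n)%N ->
    (* for P_X-almost all x *)
    exists Nul : set 'rV[R]_p, measurable Nul /\ PXY (Nul `*` setT) = 0%E /\
    forall x, ~ Nul x ->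
    forall (dO : measure_display) (Omega : measurableType dO)
           (P : probability Omega R)
           (Xs : 'I_n -> Omega -> 'rV[R]_p) (Ys : 'I_n -> Omega -> 'rV[R]_d),
      (forall i, measurable_fun setT (fun w => (Xs i w, Ys i w))) ->
      (* (X_i, Y_i)_{i<n} are mutually independent ... *)
      (forall B : 'I_n -> set ('rV[R]_p * 'rV[R]_d)%type,
         (forall i, measurable (B i)) ->
         P (\bigcap_(i in [set: 'I_n]) [set w | B i (Xs i w, Ys i w)]) =
         (\prod_(i < n) P [set w | B i (Xs i w, Ys i w)])%E) ->
      (* ... copies of (X, Y) *)
      (forall i B, measurable B -> P [set w | B (Xs i w, Ys i w)] = PXY B) ->
      let h := powR (n%:R) (- (1 / (2 * beta + p%:R))) in
      (* outer-probability bound on the deviation event *)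
      exists E : set Omega, measurable E /\
        [set w | delta <= enorm (lp_est_proj beta h K (fun i => Xs i w)
                                    (fun i => Ys i w) x - fstar x)] `<=` E /\
        (P E <= (C1 * expR (- C2 * powR (n%:R) (2 * beta / (2 * beta + p%:R))
                             * delta ^+ 2 / d%:R))%:E)%E.
Proof.
move=> p0 beta0 L0 mm0 mm c00 r00 lebP mK [c [c_gt0 Kcc]] _ [B KB] Iint _.
have K0 u : 0 <= K u by apply: le_trans (Kcc u); rewrite mulr_ge0// ltW.
have Kc' u : enorm u <= c -> c <= K u.
  by move=> uc; have := Kcc u; rewrite uc mulr1.
have B0 : 0 < B.
  apply: lt_le_trans (KB 0); rewrite mulr_gt0 ?ltr_wpDr ?powR_ge0//.
  apply: (lt_le_trans c_gt0); apply: Kc'; apply: ltW; apply: le_lt_trans c_gt0.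
  by rewrite /enorm big1 ?sqrtr0// => j _; rewrite mxE expr0n.
(* The kernel is at least [c] on this ball, and as [h <= 1] the radius [h * c1] is within reach of
   the thickness condition. *)
pose c1 := Num.min c r0.
have c1_gt0 : 0 < c1 by rewrite lt_min c_gt0.
have c1r0 : c1 <= r0 by rewrite ge_min lexx orbT.
have Kc u : eball 0 c1 u -> c <= K u.
  by rewrite /eball/= subr0 le_min => /andP[/Kc'].
have wK0 u : 0 <= weight beta u * K u by rewrite mulr_ge0// weight_ge0.
pose I := fine (\int[leb]_u (weight beta u * K u)%:E)%E.
have Ige0 : (0 <= \int[leb]_u (weight beta u * K u)%:E)%E.
  by apply: integral_ge0 => u _; rewrite lee_fin.
have I0 : 0 <= I by exact: fine_ge0.
have KI : (\int[leb]_u (weight beta u * K u)%:E <= I%:E)%E.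
  by rewrite /I fineK// ge0_fin_numE.
pose v := fine (leb (eball 0 c1)).
have vfin : leb (eball 0 c1) \is a fin_num by rewrite ge0_fin_numE// leb_eball_fin.
have vE : leb (eball 0 c1) = v%:E by rewrite /v fineK.
have v0 : 0 < v by rewrite -lte_fin -vE leb_eball_gt0.
have cv0 : 0 < c0 * v / 2 by rewrite !mulr_gt0.
have [eta eta0 sub] :=
  @sublevel_measure R p (floor_beta beta) leb lebP c1 _ (ltW c1_gt0) cv0.
pose MI := multi_index p (floor_beta beta).
pose M : R := #|{: MI}|%:R.
have M0 : 0 < M.
  by rewrite ltr0n; apply/card_gt0P; exists (mi_zero p (floor_beta beta)).
have M1 : 1 <= M by rewrite ler1n -(ltr0n R).
have mu_max0 : 0 < mu_max by exact: lt_le_trans mm.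
pose lamG : R := eta ^+ 2 * (mu_min * (c0 * v / 2)) / M.
have lamG0 : 0 < lamG by rewrite divr_gt0// mulr_gt0 ?exprn_gt0// mulr_gt0.
pose VG : R := gram_max beta c1 ^+ 2 * (mu_max * v).
have gm0 : 0 < gram_max beta c1 by exact: gram_max_gt0.
have VG0 : 0 < VG by rewrite mulr_gt0 ?exprn_gt0// mulr_gt0.
pose zeta : R := lamG / (2 * M).
have zeta0 : 0 < zeta by rewrite divr_gt0// mulr_gt0.
pose lam : R := c * lamG / 2.
have lam0 : 0 < lam by rewrite divr_gt0// mulr_gt0.
pose C3 : R := L * (mu_max * I).
have C30 : 0 <= C3 by rewrite !mulr_ge0// ltW.
pose C4 : R := (2 + L) ^+ 2 * B * (mu_max * I).
have C40 : 0 <= C4.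
  have := ltW B0; have := ltW mu_max0 => ? ?.
  by apply: mulr_ge0; apply: mulr_ge0 => //; exact: sqr_ge0.
(* The first term keeps exponents at most 1/2; the second makes the variance consume at most half of
   the deviation [zeta]. *)
pose t1 := Num.min (1 / (2 * gram_max beta c1)) (zeta / (4 * VG)).
have t10 : 0 < t1 by rewrite lt_min !divr_gt0 ?mulr_gt0.
have t1G : t1 * gram_max beta c1 <= 1 / 2.
  rewrite -ler_pdivlMr//; apply: (@le_trans _ _ (1 / (2 * gram_max beta c1))).
    by rewrite ge_min lexx.
  by rewrite le_eqVlt; apply/orP; left; apply/eqP; field; rewrite gt_eqF.
have t1V : 2 * t1 * VG <= zeta / 2.
  have h : t1 * VG <= zeta / 4.
    rewrite -ler_pdivlMr//.
    apply: (@le_trans _ _ (zeta / (4 * VG))); first by rewrite ge_min lexx orbT.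
    by rewrite invfM mulrA.
  by lra.
pose Bs := (2 + L) * B.
have Bs0 : 0 < Bs by apply: mulr_gt0 => //; apply: addr_gt0.
(* The first term keeps the score exponents at most 1/2, given [e <= lam] below; the second controls
   the variance term. *)
pose cc := Num.min (1 / (2 * (lam * Bs))) (1 / (16 * (C4 + 1))).
have C410 : 0 < C4 + 1 by apply: ltr_wpDl.
have lB0 : 0 < lam * Bs by exact: mulr_gt0.
have k1 : 0 < 1 / (2 * (lam * Bs)) by apply: divr_gt0 => //; exact: mulr_gt0.
have k2 : 0 < 1 / (16 * (C4 + 1)) by apply: divr_gt0 => //; exact: mulr_gt0.
have cc0 : 0 < cc by rewrite /cc lt_min k1.
have ccB : cc * (lam * Bs) <= 1 / 2.
  rewrite -ler_pdivlMr//.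
  apply: (@le_trans _ _ (1 / (2 * (lam * Bs)))); first by rewrite ge_min lexx.
  rewrite le_eqVlt; apply/orP; left; apply/eqP; field.
  by rewrite !gt_eqF.
have ccC4 : 2 * cc * C4 <= 1 / 8.
  have h : cc * (C4 + 1) <= 1 / 16.
    rewrite -ler_pdivlMr//.
    apply: (@le_trans _ _ (1 / (16 * (C4 + 1)))); first by rewrite ge_min lexx orbT.
    by rewrite le_eqVlt; apply/orP; left; apply/eqP; field; rewrite gt_eqF.
  by rewrite mulrDr in h; lra.
pose S0 : R := 1 + 64 * C3 ^+ 2.
pose ks := lam ^+ 2 / (4 * M).
have ks0 : 0 < ks by rewrite divr_gt0 ?exprn_gt0// mulr_gt0.
pose C2 := Num.min (t1 * zeta / 8) (cc * ks / 4).
have C20 : 0 < C2.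
  have k3 : 0 < t1 * zeta / 8 by apply: divr_gt0 => //; exact: mulr_gt0.
  have k4 : 0 < cc * ks / 4 by apply: divr_gt0 => //; exact: mulr_gt0.
  by rewrite /C2 lt_min k3.
pose N1 : R := #|{: MI * MI * bool}|%:R.
pose Cc : R := 4 * (1 / 2 + 4 / cc ^+ 2).
have Cc0 : 0 <= Cc by rewrite mulr_ge0// addr_ge0// divr_ge0// sqr_ge0.
(* The first summand makes the bound at least 1 while [ks * rho < S0], where the bias is not yet
   dominated; the second covers the remaining range. *)
pose C1 := expR (C2 * S0 / ks) + (N1 + Cc) * expR 1.
have NCe : 0 <= (N1 + Cc) * expR 1 by rewrite mulr_ge0 ?expR_ge0// addr_ge0.
have C10 : 0 < C1 by rewrite ltr_wpDr// expR_gt0.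
exists C1, C2; split => //; split => //.
move=> d PXY f q Xc d0 Y1 _ mXc mq q0 qP density mf regression f_holder thick.
move=> delta n delta0 n0.
exists (~` Xc); split; first exact: measurableC.
split; first exact: (PX_support mXc q0 density).
move=> x /contrapT Xx dO Omega P Xs Ys mZs indep same_law h.
have [h0 h1 hpa ahb] := powR_bandwidth n0 p0 beta0.
rewrite -/h in h0 h1 hpa ahb.
set a := powR n%:R (2 * beta / (2 * beta + p%:R)) in hpa ahb *.
have a0 : 0 < a by rewrite powR_gt0// ltr0n.
have d0' : 0 < d%:R :> R by rewrite ltr0n.
pose rho := a * delta ^+ 2 / d%:R.
have rho0 : 0 <= rho.
  by apply: divr_ge0 => //; apply: mulr_ge0; [exact: ltW|exact: sqr_ge0].
have -> : - C2 * a * delta ^+ 2 / d%:R = - (C2 * rho) by rewrite /rho; ring.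
have f1 := support_regression_le1 mm0 c00 r00 lebP Y1 mXc mq q0 qP density mf
  regression f_holder thick.
(* Beyond 2 the event is empty, both points being in the unit ball. Afterwards [delta <= 2] yields
   [e <= lam] and [rho <= 4 a]. *)
have [delta2|delta2] := ltP 2 delta.
  exists set0; split => //; split; last first.
    by rewrite measure0 lee_fin mulr_ge0 ?expR_ge0// ltW.
  move=> w /= dle; have := enormB_le2 (enorm_proj_ball_le1
    (lp_est beta h K (fun i => Xs i w) (fun i => Ys i w) x)) (f1 _ Xx).
  by move=> /(le_trans dle); rewrite leNgt delta2.
have [small|large] := ltP (ks * rho) S0.
  exists setT; split => //; split => //.
  apply: (le_trans (probability_le1 P measurableT)); rewrite lee_fin.
  rewrite /C1 mulrDl; apply: (@le_trans _ _ (expR (C2 * S0 / ks) * expR (- (C2 * rho)))).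
    rewrite -expRD -[leLHS](expR0 R) ler_expR subr_ge0 -mulrA ler_wpM2l ?(ltW C20)//.
    by rewrite ler_pdivlMr// mulrC ltW.
  by rewrite lerDl mulr_ge0// expR_ge0.
pose D := Num.sqrt (d%:R * M).
have D2 : D ^+ 2 = d%:R * M by rewrite sqr_sqrtr// mulr_ge0// ltW.
have D0 : 0 < D by rewrite sqrtr_gt0 mulr_gt0.
have D1 : 1 <= D.
  by rewrite -(@ler_pXn2r _ 2) ?nnegrE ?(ltW D0)// D2 expr1n;
    apply: mulr_ege1 => //; rewrite ler1n.
(* With [b = a * e] the squared error off the event is at most [delta^2 / 4], strictly below
   [delta^2]; [D^2 = d M] is the number of scores. *)
pose e := lam * delta / (2 * D).
have e0 : 0 < e by apply: divr_gt0; exact: mulr_gt0.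
have e_lam : e <= lam.
  rewrite /e ler_pdivrMr ?mulr_gt0// ler_wpM2l ?(ltW lam0)//; lra.
have se : a * e ^+ 2 = ks * rho.
  have gen (l y z : R) : y != 0 -> z != 0 ->
      a * (l ^+ 2 * delta ^+ 2 / (2 ^+ 2 * (y * z))) =
      l ^+ 2 / (4 * z) * (a * delta ^+ 2 / y).
    by move=> y0 z0; field; rewrite y0 z0.
  rewrite /e expr_div_n [(lam * delta) ^+ 2]exprMn [(2 * D) ^+ 2]exprMn D2.
  by apply: gen; rewrite gt_eqF.
have be : cc * (a * e ^+ 2) / (a * e) = cc * e by field; rewrite !gt_eqF.
have s1 : 1 <= a * e ^+ 2.
  by rewrite se (le_trans _ large)// lerDl mulr_ge0// sqr_ge0.
have eB : cc * (a * e ^+ 2) / (a * e) * Bs <= 1 / 2.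
  rewrite be (le_trans _ ccB)// -mulrA ler_wpM2l ?(ltW cc0)//.
  by rewrite ler_wpM2r// ltW.
have [E [mE Eerr PE]] := deviation_event beta0 L0 mm0 mm c00 r00 lebP mK K0
  c_gt0 c1_gt0 c1r0 Kc B0 KB KI v0 vE eta0 sub d0 Y1 mXc mq q0 qP density mf
  regression f_holder thick mZs indep same_law Xx h0 h1 t10 t1G t1V cc0
  (mulr_gt0 a0 e0) s1 n0 eB.
exists E; split => //; split.
  move=> w /= dle; apply: contrapT => /Eerr.
  rewrite hpa -/MI -/M => err.
  have : delta ^+ 2 <= delta ^+ 2 / 4.
    apply: (@le_trans _ _ (enorm (lp_est_proj beta h K (fun i => Xs i w)
        (fun i => Ys i w) x - f x) ^+ 2)).
      by rewrite lerXn2r ?nnegrE ?enorm_ge0// ltW.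
    apply: (le_trans err); rewrite -D2 le_eqVlt; apply/orP; left; apply/eqP.
    rewrite -/lam /e; field; by rewrite !gt_eqF.
  by have := exprn_gt0 2 delta0; lra.
apply: (le_trans PE); rewrite lee_fin hpa be -/N1 -/Cc -/C3 -/C4 -/zeta.
have num := @tail_numerics R N1 Cc cc ks t1 zeta C2 C3 C4 a (powR h beta) e rho.
apply: (@le_trans _ _ ((N1 + Cc) * expR 1 * expR (- (C2 * rho)))).
  apply: num => //; rewrite ?powR_ge0 ?ler0n//.
  - by rewrite mulr_ge0// ltW.
  - rewrite /rho ler_pdivrMr//; apply: (@le_trans _ _ (a * 4)).
      rewrite ler_wpM2l ?(ltW a0)//.
      have : delta ^+ 2 <= 2 ^+ 2 by rewrite lerXn2r ?nnegrE// ltW.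
      by rewrite expr2; lra.
    by rewrite mulrC ler_peMr ?mulr_ge0 ?(ltW a0)// ler1n.
  - by rewrite ge_min lexx.
  - by rewrite ge_min lexx orbT.
by rewrite /C1 [leRHS]mulrDl lerDr mulr_ge0 ?expR_ge0.
Qed.
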